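(* Let $r\in\mathbb{N}$. As $n\to\infty$, $$\mathcal{L}^{[r]}(p)(n)\sim\frac{\pi^{2^r-1}}{2^{5\cdot2^{r-1}+r-\frac12}\,3^{2^r-\frac12}}\cdot\frac{e^{2^r\pi\sqrt{\frac23n}}}{n^{2^r+3\cdot2^{r-1}-\frac32}}.$$
   Context: $p(n)$ is the number of partitions of $n$. For a sequence $\{a(n)\}_{n\ge0}$, $\mathcal{L}^{[1]}(a)$ is the sequence with $\mathcal{L}^{[1]}(a)(0):=a^2(0)$ and $\mathcal{L}^{[1]}(a)(n):=a^2(n)-a(n+1)a(n-1)$ for $n\ge1$. For $r\ge2$, $\mathcal{L}^{[r]}(a)(n):=\mathcal{L}^{[1]}\left(\mathcal{L}^{[r-1]}(a)\right)(n)$. *)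

(* Defs.v *)
From HB Require Import structures.
From mathcomp Require Import all_boot all_order all_algebra.
From mathcomp Require Import all_classical all_reals all_analysis.

Set Implicit Arguments.
Unset Strict Implicit.
Unset Printing Implicit Defensive.

Import Order.TTheory GRing.Theory Num.Theory.
Import numFieldNormedType.Exports.

Local Open Scope ring_scope.

(* A partition of n is encoded by its multiplicities: m i is the number of parts
   equal to i.+1. Parts and multiplicities of a partition of n are at most n, so
   the bounds lose nothing; for n = 0 there is exactly one (empty) m. *)
Definition partitions (n : nat) : {set {ffun 'I_n -> 'I_n.+1}} :=
  [set m : {ffun 'I_n -> 'I_n.+1} | (\sum_(i < n) i.+1 * m i == n)%N].

Definition num_partitions (n : nat) : nat := #|partitions n|.

Definition logconcave_op (R : pzRingType) (a : nat -> R) (n : nat) : R :=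
  if n is k.+1 then a k.+1 ^+ 2 - a k.+2 * a k else a 0%N ^+ 2.

(* The usual r-fold operator is indexed by r >= 1; here r = 0 gives a itself. *)
Definition iter_logconcave_op (R : pzRingType) (r : nat) (a : nat -> R) :
  nat -> R := iter r (@logconcave_op R) a.

(* Main.v *)
Require Import Defs.
From HB Require Import structures.
From mathcomp Require Import all_boot all_order all_algebra.
From mathcomp Require Import all_classical all_reals all_analysis.
From mathcomp Require Import zify ring lra.
Import Order.TTheory GRing.Theory Num.Theory.
Import numFieldNormedType.Exports.

(** Saddle-point method plus a calculus of formal expansions.  With [F(y)] the
    generating function at [q = exp(-y)], the coefficient [p(n)] is a Fourier
    integral of [F] over the circle of radius [exp(-y)].  Since
    [log F(y) = pi^2/(6y) + (1/2) log(y/2pi) - y/24 + O(y^K)] for every [K], with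
    matching expansions of all its derivatives, choosing [y = pi/sqrt(6n)] turns
    this integral, up to errors smaller than every power of [n], into a Gaussian
    one, and [p(n) = exp(c sqrt n) n^-1 f(n)] where [f] has a full asymptotic
    expansion in powers of [w = n^(-1/16)] and [f -> 1/(4 sqrt 3)].

    Modularity is replaced by Gauss's identity for [sum q^(s(s+1)/2)], which writes
    [F(y) / F(2y)^2] as a theta sum, equal to its integral up to a flat error.
    Thus [log F(y) - 2 log F(2y)] is known up to a flat error; iterating over
    [y/2, y/4, ...] and using [y log F(y) -> zeta(2)] gives [log F].

    The log-concavity operator acts on sequences [exp(A sqrt n) n^-B f(n)] of this
    type with [f -> C > 0].  In [a(n)^2 - a(n+1) a(n-1)] the second differences of
    [f] and of [log n] are [O(n^-2)], so the leading term comes from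
    [sqrt(n+1) + sqrt(n-1) - 2 sqrt n ~ -n^(-3/2)/4]: the result is again of this
    type, with [(A, B, C)] replaced by [(2A, 2B + 3/2, A C^2/4)].  Iterating gives
    the theorem. *)

Local Open Scope ring_scope.

Set Implicit Arguments.
Unset Strict Implicit.
Unset Printing Implicit Defensive.

(** * The recursion [n p(n) = sum sigma(k) p(n - k)] *)

Section restricted_partitions.

(** The operator cancels the leading terms of [a(n)^2] and [a(n+1) a(n-1)] and keeps a relative part
    of size [n^(-3/2)] only, so no expansion of [p(n)] of fixed length serves all [r]: errors must
    be smaller than every power of [n]. Powers of [w] also give control of differences: as
    [1/n = w^16], the shift [n -> n+1] sends [w] to [w (1 + w^16)^(-1/16)], which again expands in
    [w].

    The exponent 16 makes all scales integral powers: [y ~ w^8], the angle is [y^(3/2) t ~ w^12 t],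
    and [|t| <= 1/w] on the major arc. There the cubic term of the exponent, of size [y^(1/2) t^3],
    is [O(w)], while the Gaussian at the cutoff is [exp(-c/w^2)], hence flat.

    The doubling relation cannot see a term [c/y], because it solves [g(y) = 2 g(2y)]; only the
    limit of [y log F(y)] fixes [c].

    Complex numbers are avoided: the generating function off the real axis is a pair of
    trigonometric series, and the polar form of [F] replaces the complex logarithm. Integrals are
    differences of antiderivatives. *)

Definition trunc_prod (N B : nat) : {poly int} :=
  \prod_(i < N) \sum_(j < B.+1) 'X^(i.+1 * j).

Lemma prodXn (N : nat) (e : 'I_N -> nat) :
  \prod_(i < N) 'X^(e i) = 'X^(\sum_(i < N) e i) :> {poly int}.
Proof. by rewrite expr_sum. Qed.

Lemma trunc_prod_card N B n : (trunc_prod N B)`_n =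
  #|[set m : {ffun 'I_N -> 'I_B.+1} | (\sum_(i < N) i.+1 * m i == n)%N]|%:R.
Proof.
rewrite /trunc_prod bigA_distr_bigA/= coef_sum -sum1_card natr_sum.
rewrite [RHS]big_mkcond/=; apply: eq_bigr => m _.
by rewrite prodXn coefXn inE eq_sym; case: eqP.
Qed.

(** Multiplying the factor of the part [N.+1] by [1 - X^(N.+1)] telescopes to [1 - X^(N.+1 * B.+1)],
    whose second term lies above degree [n]. *)
Lemma trunc_prodS N B n : (n <= B)%N ->
  (trunc_prod N.+1 B)`_n = (trunc_prod N B)`_n +
    (if (N < n)%N then (trunc_prod N.+1 B)`_(n - N.+1) else 0).
Proof.
move=> nB.
have E : trunc_prod N.+1 B * (1 - 'X^(N.+1)) =
         trunc_prod N B * (1 - 'X^(N.+1 * B.+1)).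
  rewrite /trunc_prod big_ord_recr/= -mulrA; congr (_ * _).
  rewrite mulrC exprM -[in RHS](expr1n {poly int} B.+1) subrXX; congr (_ * _).
  by apply: eq_bigr => j _; rewrite expr1n mul1r exprM.
have := congr1 (fun p : {poly int} => p`_n) E.
rewrite !mulrBr !mulr1 !coefB !coefMXn ltnS.
have -> : (n < N.+1 * B.+1)%N by nia.
by rewrite subr0 leqNgt; case: ltnP => _ <-; rewrite ?subrK.
Qed.

Definition npart (N n : nat) : nat :=
  #|[set m : {ffun 'I_N -> 'I_n.+1} | (\sum_(i < N) i.+1 * m i == n)%N]|.

(** The bound on multiplicities is immaterial once it is at least [n]: for any two such bounds the
    coefficients obey the same recursion [trunc_prodS]. This frees the recursion from the bound [n]
    built into [npart N n], which changes with [n]. *)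
Lemma trunc_prod_npart N B n : (n <= B)%N -> (trunc_prod N B)`_n = (npart N n)%:R.
Proof.
move=> nB; rewrite -[RHS]trunc_prod_card.
suff H : forall B B', (n <= B)%N -> (n <= B')%N ->
    (trunc_prod N B)`_n = (trunc_prod N B')`_n by exact: H.
move=> {B nB}; elim: N n => [|N IH] n; first by move=> *; rewrite /trunc_prod !big_ord0.
elim/ltn_ind: n => n IHn B B' nB nB'.
rewrite (trunc_prodS N nB) (trunc_prodS N nB') (IH _ B B')//.
by case: ltnP => // Nn; congr (_ + _); apply: IHn; lia.
Qed.

Lemma npart0 n : npart 0 n = (n == 0)%N.
Proof.
apply/eqP; rewrite -(eqr_nat int) -(trunc_prod_npart 0 (leqnn n)).
by rewrite /trunc_prod big_ord0 coef1.
Qed.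

Lemma npartS N n : npart N.+1 n =
  (npart N n + if (N < n)%N then npart N.+1 (n - N.+1) else 0)%N.
Proof.
apply/eqP; rewrite -(eqr_nat int) natrD -!(@trunc_prod_npart _ n n)// trunc_prodS//.
case: ltnP => // Nn; rewrite -(@trunc_prod_npart _ n)//; lia.
Qed.

Lemma npart_mono N n : (npart N n <= npart N.+1 n)%N.
Proof. by rewrite npartS leq_addr. Qed.

Lemma npart_stable N n : (n <= N)%N -> npart N n = num_partitions n.
Proof.
move=> nN; rewrite -(subnKC nN); elim: (N - n)%N => [|k IH]; first by rewrite addn0.
by rewrite addnS npartS IH ltnNge leq_addr/= addn0.
Qed.

Lemma npart_le N n : (npart N n <= num_partitions n)%N.
Proof.
have [nN|Nn] := leqP n N; first by rewrite npart_stable.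
rewrite -(npart_stable (leqnn n)) -{2}(subnKC (ltnW Nn)).
elim: (n - N)%N => [|k IH]; first by rewrite addn0.
by rewrite addnS (leq_trans IH)// npart_mono.
Qed.

Definition sigma_le (N k : nat) : nat := (\sum_(d < N | d.+1 %| k) d.+1)%N.

Definition sigma (k : nat) : nat := sigma_le k k.

Lemma sigma_leS N k : sigma_le N.+1 k = (sigma_le N k + (N.+1 %| k) * N.+1)%N.
Proof.
rewrite /sigma_le big_mkcond big_ord_recr/= -big_mkcond/=; congr (_ + _)%N.
by case: ifP => _; rewrite ?mul1n ?mul0n.
Qed.

(** Iterates [npartS]: once one copy of the part [N.+1] is removed, sort the partitions by the
    number of copies left. *)
Lemma npart_unroll N n : (N < n)%N ->
  (\sum_(k < n) (N.+1 %| k.+1) * npart N (n - k.+1))%N = npart N.+1 (n - N.+1).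
Proof.
elim/ltn_ind: n => n IH Nn.
have -> : n = (N.+1 + (n - N.+1))%N by lia.
rewrite big_split_ord/= addKn big_ord_recr/= dvdnn mul1n addKn.
rewrite big1 ?add0n => [|k _]; last first.
  by rewrite gtnNdvd// ltnS.
rewrite npartS; congr (_ + _)%N; case: ltnP => Nn'.
  rewrite -IH//; last by lia.
  apply: eq_bigr => k _; congr ((nat_of_bool _) * npart _ _)%N.
    by rewrite -addnS dvdn_addr.
  by lia.
by apply: big1 => k _; rewrite -addnS dvdn_addr// gtnNdvd//; have := ltn_ord k; lia.
Qed.

(** The coefficient form of the logarithmic derivative of a finite Euler product. Going from [N] to
    [N.+1], the divisor sum gains [N.+1] on the multiples of [N.+1], which [npart_unroll] sums; the
    partitions that use [N.+1] are reached by a second induction on [n]. *)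
Lemma npart_sigma_le N n :
  (n * npart N n = \sum_(k < n) sigma_le N k.+1 * npart N (n - k.+1))%N.
Proof.
elim: N n => [|N IHN] n.
  rewrite npart0 big1; first by case: n => // n; rewrite muln0.
  by move=> k _; rewrite /sigma_le big_ord0.
elim/ltn_ind: n => n IHn.
have [nN|Nn] := leqP n N.
  have E m : (m <= n)%N -> npart N.+1 m = npart N m.
    by move=> mn; rewrite npartS ltnNge (leq_trans mn nN)/= addn0.
  rewrite E// IHN; apply: eq_bigr => k _; rewrite E ?leq_subr// sigma_leS.
  by rewrite gtnNdvd ?mul0n ?addn0// ltnS (leq_trans (ltn_ord k)).
have n1 : (n - N.+1 < n)%N by lia.
(* In the second term of [npartS] the factor [n] splits as [N.+1 + (n - N.+1)], so that the
   induction hypothesis for [n - N.+1] applies. *)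
have -> : (n * npart N.+1 n = n * npart N n + N.+1 * npart N.+1 (n - N.+1) +
    (n - N.+1) * npart N.+1 (n - N.+1))%N.
  by rewrite [npart N.+1 n]npartS Nn; nia.
rewrite (IHn _ n1) IHN -npart_unroll// big_distrr/= -big_split/=.
transitivity (\sum_(k < n) sigma_le N.+1 k.+1 * npart N (n - k.+1) +
  \sum_(k < n) sigma_le N.+1 k.+1 *
     (if N < n - k.+1 then npart N.+1 (n - k.+1 - N.+1) else 0))%N; last first.
  rewrite -big_split/=; apply: eq_bigr => k _.
  by rewrite -mulnDr -npartS.
congr (_ + _)%N.
  by apply: eq_bigr => k _; rewrite sigma_leS; nia.
have -> : (\sum_(k < n) sigma_le N.+1 k.+1 *
     (if N < n - k.+1 then npart N.+1 (n - k.+1 - N.+1) else 0) =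
   \sum_(0 <= k < n) sigma_le N.+1 k.+1 *
     (if N < n - k.+1 then npart N.+1 (n - k.+1 - N.+1) else 0))%N.
  by rewrite big_mkord.
(* For [k >= n - N.+1] the number [n - k.+1] is at most [N], and the summand is 0. *)
rewrite (@big_cat_nat _ _ _ (n - N.+1))//= ?leq_subr// [X in (_ + X)%N]big_nat_cond.
rewrite [X in (_ + X)%N]big1 ?addn0 => [|k]; last first.
  move=> /andP[/andP[nk kn] _].
  by rewrite ifF ?muln0//; apply/negbTE; rewrite -leqNgt; lia.
rewrite big_mkord; apply: eq_bigr => k _.
have -> : (N < n - k.+1)%N by have := ltn_ord k; lia.
by congr (_ * npart _ _)%N; lia.
Qed.

Lemma sigma_le_ge N k : (0 < k <= N)%N -> sigma_le N k = sigma k.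
Proof.
move=> /andP[k0 kN]; rewrite -(subnKC kN); elim: (N - k)%N => [|j IH].
  by rewrite addn0.
by rewrite addnS sigma_leS IH gtnNdvd// ?mul0n ?addn0// ltnS leq_addr.
Qed.

Lemma num_partitions_sigma n : (n * num_partitions n =
  \sum_(k < n) sigma k.+1 * num_partitions (n - k.+1))%N.
Proof.
rewrite -(npart_stable (leqnn n)) npart_sigma_le; apply: eq_bigr => k _.
by rewrite npart_stable ?leq_subr// sigma_le_ge//= ltn_ord.
Qed.

Lemma sigma_ge k : (k <= sigma k)%N.
Proof.
case: k => // k; rewrite /sigma sigma_leS dvdnn mul1n.
exact: leq_addl.
Qed.

Lemma sigma_lek k : (sigma k <= k ^ 2)%N.
Proof.
rewrite /sigma /sigma_le big_mkcond/= expnS expn1 -[X in (_ <= X * _)%N]card_ord.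
by rewrite -sum_nat_const; apply: leq_sum => i _; case: ifP.
Qed.

Lemma sigma0 : sigma 0 = 0%N.
Proof. by rewrite /sigma /sigma_le big_ord0. Qed.

Lemma num_partitions0 : num_partitions 0 = 1%N.
Proof. by rewrite -(npart_stable (leqnn 0)) npart0. Qed.

End restricted_partitions.

Local Open Scope classical_set_scope.
Local Open Scope ring_scope.

(** * Calculus: Taylor bounds, series, integrals of functions with a primitive *)

Section calculus.
Context {R : realType}.
Implicit Types (f g : R -> R) (x y r M : R).

Lemma within_continuous_is_derive f df (a b : R) :
  (forall x, x \in `[a, b]%R -> is_derive x 1 f (df x)) ->
  {within `[a, b], continuous f}.
Proof.
move=> fdf; apply: continuous_in_subspaceT => x; rewrite inE => xab.
apply: differentiable_continuous; apply/derivable1_diffP.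
by have [] := fdf x xab.
Qed.

Lemma MVT_is_derive f df (a b : R) : a <= b ->
  (forall x, a <= x <= b -> is_derive x 1 f (df x)) ->
  exists2 c, a <= c <= b & f b - f a = df c * (b - a).
Proof.
move=> ab fdf.
have fdf' x : x \in `[a, b]%R -> is_derive x 1 f (df x).
  by rewrite in_itv/= => /fdf.
have fdo x : x \in `]a, b[%R -> is_derive x 1 f (df x).
  by rewrite in_itv/= => /andP[/ltW ax /ltW xb]; apply: fdf; rewrite ax.
have [c cab ->] := MVT_segment ab fdo (within_continuous_is_derive fdf').
by exists c => //; move: cab; rewrite in_itv.
Qed.

Lemma MVT0 f df r x : (forall x, `|x| <= r -> is_derive x 1 f (df x)) ->
  `|x| <= r -> exists2 c, `|c| <= `|x| & f x - f 0 = df c * x.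
Proof.
move=> fdf xr; have [x0|x0] := leP 0 x.
  have [z|c /andP[c0 cx] ->] := @MVT_is_derive f df 0 x x0.
    move=> /andP[z0 zx]; apply: fdf; apply: le_trans xr.
    by rewrite !ger0_norm.
  by exists c; rewrite ?subr0// !ger0_norm.
have [z|c /andP[c0 cx] e] := @MVT_is_derive f df x 0 (ltW x0).
  move=> /andP[z0 zx]; apply: fdf; apply: le_trans xr.
  by rewrite !ler0_norm ?lerN2 ?(ltW x0).
exists c; first by rewrite !ler0_norm ?lerN2 ?(ltW x0).
by apply/eqP; rewrite -eqr_opp opprB e sub0r mulrN.
Qed.

(** A quadratic remainder can be summed over the terms of a series; this is how series are
    differentiated in [is_derive_Sum]. *)
Lemma is_derive_quadratic f x d (e M : R) : 0 < e ->
  (forall h, `|h| < e -> `|f (x + h) - f x - h * d| <= h ^+ 2 * M) ->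
  is_derive x 1 f d.
Proof.
move=> e0 fh.
have cv : (fun h => h^-1 *: ((f \o shift x) (h *: 1) - f x)) @ 0^' --> d.
  have M0 : 0 <= M.
    have := fh (e / 2); rewrite ger0_norm ?ltr_pdivrMr//; last by rewrite ltW// divr_gt0.
    rewrite ltr_pMr// => /(_ _)/(le_trans (normr_ge0 _)).
    rewrite (_ : 1 < 2 = true) ?ltr1n// => /(_ isT).
    by rewrite pmulr_rge0// exprn_gt0// divr_gt0.
  apply/cvgrPdist_le => eps eps0.
  near=> h => /=; rewrite /GRing.scale/= mulr1 [h + x]addrC.
  have h0 : h != 0 by near: h; exact: nbhs_dnbhs_neq.
  have he : `|h| < e.
    by near: h; exact: dnbhs0_lt.
  have hM : `|h| * M <= eps.
    have : `|h| < eps / (M + 1).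
      near: h; apply: dnbhs0_lt.
      by rewrite divr_gt0// ltr_wpDl.
    rewrite ltr_pdivlMr ?ltr_wpDl// => /ltW; apply: le_trans.
    by rewrite ler_wpM2l// lerDl.
  have -> : d - h^-1 * (f (x + h) - f x) = - (h^-1 * (f (x + h) - f x - h * d)).
    by field.
  rewrite normrN normrM; apply: le_trans hM.
  rewrite normrV ?unitfE// ler_pdivrMl ?normr_gt0//.
  rewrite mulrA -expr2 real_normK ?num_real//.
  exact: fh.
apply: DeriveDef; first by apply/cvg_ex; exists d.
exact/cvg_lim.
Unshelve. all: by end_near. Qed.

(* The constant [n!] is lost in the remainder: only the order [x ^+ n] matters. *)
Lemma taylor_bound (c : nat -> R -> R) n r M x :
  (forall i y, (i < n)%N -> `|y| <= r -> is_derive y 1 (c i) (c i.+1 y)) ->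
  (forall y, `|y| <= r -> `|c n y| <= M) -> `|x| <= r ->
  `|c 0%N x - \sum_(i < n) c i 0 * x ^+ i / i`!%:R| <= M * `|x| ^+ n.
Proof.
elim: n c x => [|n IH] c x dc cM xr.
  by rewrite big_ord0 subr0 expr0 mulr1; exact: cM.
pose g y := c 0%N y - \sum_(i < n.+1) c i 0 * y ^+ i / i`!%:R.
pose dg y := c 1%N y - \sum_(i < n) c i.+1 0 * y ^+ i / i`!%:R.
have dgP y : `|y| <= r -> is_derive y 1 g (dg y).
  move=> yr; rewrite /g /dg.
  pose p : {poly R} := \poly_(i < n.+1) (c i 0 / i`!%:R).
  have -> : (fun y => c 0%N y - \sum_(i < n.+1) c i 0 * y ^+ i / i`!%:R) =
            c 0%N - horner p.
    apply/funext => z; rewrite !fctE horner_poly; congr (_ - _).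
    by apply: eq_bigr => i _; rewrite mulrAC.
  have -> : \sum_(i < n) c i.+1 0 * y ^+ i / i`!%:R = p^`().[y].
    rewrite /p poly_def raddf_sum horner_sum big_ord_recl/=.
    rewrite derivZ derivXn mulr0n scaler0 horner0 add0r.
    apply: eq_bigr => i _.
    rewrite /bump/= add1n derivZ derivXn/= !hornerE hornerMn hornerXn factS natrM.
    have i0 : i`!%:R != 0 :> R by rewrite pnatr_eq0 -lt0n fact_gt0.
    have i1 : i.+1%:R != 0 :> R by rewrite pnatr_eq0.
    by rewrite -mulr_natr invfM; field; rewrite i0 nat1r i1.
  by apply: is_deriveB; apply: dc.
have [z zx] := MVT0 dgP xr.
have -> : g 0 = 0.
  rewrite /g big_ord_recl/= expr0 fact0 divr1 mulr1 big1 ?addr0 ?subrr// => i _.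
  by rewrite exprS mul0r mulr0 mul0r.
rewrite subr0 /g => ->; rewrite normrM exprSr mulrA ler_wpM2r//.
have zr : `|z| <= r := le_trans zx xr.
have M0 : 0 <= M := le_trans (normr_ge0 _) (cM _ zr).
apply: le_trans (IH (fun i => c i.+1) z _ _ _) _ => //.
- by move=> i y i1 yr; apply: dc.
- by rewrite ler_wpM2l// lerXn2r ?nnegrE.
Qed.

(* The [i]-th derivative of [cos]. *)
Definition cos_shift i x : R := cos (x + i%:R * (pi / 2)).

Lemma is_derive_cos_shift i x : is_derive x 1 (cos_shift i) (cos_shift i.+1 x).
Proof.
rewrite {2}/cos_shift -[i.+1%:R]natr1.
rewrite [_ * (_ / _)]mulrDl.
rewrite mul1r addrA cosDpihalf /cos_shift.
have := @is_derive1_comp _ (@cos R) (fun x => x + i%:R * (pi / 2)) x.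
move=> /(_ _ _ (is_derive_cos _) (is_deriveD (is_derive_id _ _) (is_derive_cst _ _ _))).
by rewrite addr0 mulr1.
Qed.

Lemma cos_taylor i n x : `|cos_shift i x -
  \sum_(k < n) cos_shift (i + k) 0 * x ^+ k / k`!%:R| <= `|x| ^+ n.
Proof.
rewrite -[leRHS]mul1r.
have := @taylor_bound (fun k => cos_shift (i + k)) n `|x| 1 x.
rewrite addn0; apply=> // [k y _ _|y _].
  by rewrite addnS; exact: is_derive_cos_shift.
exact: cos_max.
Qed.

Lemma cos_shift0 x : cos_shift 0 x = cos x.
Proof. by rewrite /cos_shift mul0r addr0. Qed.

(** Sine is index 3 of the family, so one statement about [cos_shift] serves real parts (index 0)
    and imaginary parts (index 3). *)
Lemma cos_shift3 x : cos_shift 3 x = sin x.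
Proof.
rewrite /cos_shift (_ : x + 3%:R * (pi / 2) = x - pi / 2 + pi *+ 2); last first.
  by rewrite -mulr_natr; field.
by rewrite cosD2pi cosBpihalf.
Qed.

Lemma expR_taylor n r x : `|x| <= r ->
  `|expR x - \sum_(k < n) x ^+ k / k`!%:R| <= expR r * `|x| ^+ n.
Proof.
move=> xr.
have := @taylor_bound (fun=> @expR R) n r (expR r) x.
under eq_bigr do rewrite expR0 mul1r.
apply => // y yr; rewrite ger0_norm ?expR_ge0// ler_expR.
by apply: le_trans yr; exact: ler_norm.
Qed.

End calculus.

(** * Absolutely summable real series *)

Section abs_sums.
Context {R : realType}.
Implicit Types (a b : nat -> R).

Definition abs_summable a := exists M, forall N, \sum_(k < N) `|a k| <= M.
Definition Sum a : R := limn (series a).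

Lemma abs_summableP a : abs_summable a <-> cvgn (series (fun k => `|a k|)).
Proof.
split=> [[M aM]|].
  apply: nondecreasing_is_cvgn; first by apply: nondecreasing_series => n _ _.
  by exists M => _ [N _ <-]; rewrite /series/= big_mkord.
move=> /cvg_seq_bounded/bounded_fun_has_ubound[M aM]; exists M => N.
by have := aM _ (imageT _ N); rewrite /series/= big_mkord.
Qed.

Lemma abs_summable_cvg a : abs_summable a -> series a @ \oo --> Sum a.
Proof. by move=> /abs_summableP; exact: normed_cvg. Qed.

Lemma abs_summable_le a b : (forall k, `|a k| <= b k) -> abs_summable b ->
  abs_summable a.
Proof.
move=> ab [M bM]; exists M => N; apply: le_trans (bM N); apply: ler_sum => k _.
by apply: le_trans (ab k) _; exact: ler_norm.
Qed.

Lemma abs_summable_norm a : abs_summable a -> abs_summable (fun k => `|a k|).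
Proof.
by move=> [M aM]; exists M => N; under eq_bigr do rewrite normr_id.
Qed.

Lemma abs_summableZ c a : abs_summable a -> abs_summable (fun k => c * a k).
Proof.
move=> [M aM]; exists (`|c| * M) => N; under eq_bigr do rewrite normrM.
by rewrite -mulr_sumr ler_wpM2l.
Qed.

Lemma abs_summableD a b : abs_summable a -> abs_summable b ->
  abs_summable (fun k => a k + b k).
Proof.
move=> [M aM] [M' bM]; exists (M + M') => N.
apply: le_trans (lerD (aM N) (bM N)); rewrite -big_split/=.
by apply: ler_sum => k _; exact: ler_normD.
Qed.

Lemma abs_summableB a b : abs_summable a -> abs_summable b ->
  abs_summable (fun k => a k - b k).
Proof.
move=> sa sb; have := abs_summableD sa (abs_summableZ (-1) sb).
by under eq_fun do rewrite mulN1r.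
Qed.

Lemma eq_Sum a b : (forall k, a k = b k) -> Sum a = Sum b.
Proof. by move=> ab; congr Sum; apply/funext. Qed.

Lemma SumZ c a : abs_summable a -> Sum (fun k => c * a k) = c * Sum a.
Proof. by move=> /abs_summable_cvg/cvgP sa; exact: (lim_seriesZ c sa). Qed.

Lemma SumD a b : abs_summable a -> abs_summable b ->
  Sum (fun k => a k + b k) = Sum a + Sum b.
Proof.
by move=> /abs_summable_cvg/cvgP sa /abs_summable_cvg/cvgP sb; exact: lim_seriesD.
Qed.

Lemma SumB a b : abs_summable a -> abs_summable b ->
  Sum (fun k => a k - b k) = Sum a - Sum b.
Proof.
move=> sa sb; rewrite -mulN1r -SumZ// -SumD//; last exact: abs_summableZ.
by apply: eq_Sum => k; rewrite mulN1r.
Qed.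

Lemma le_Sum a b : abs_summable a -> abs_summable b -> (forall k, a k <= b k) ->
  Sum a <= Sum b.
Proof.
move=> /abs_summable_cvg/cvgP sa /abs_summable_cvg/cvgP sb ab; apply: ler_lim => //.
by near=> n; rewrite /series/=; apply: ler_sum => k _.
Unshelve. all: by end_near. Qed.

Lemma norm_Sum a b : abs_summable b -> (forall k, `|a k| <= b k) ->
  `|Sum a| <= Sum b.
Proof.
move=> sb ab; have sa := abs_summable_le ab sb.
rewrite ler_norml; apply/andP; split.
  rewrite -mulN1r -SumZ//; apply: le_Sum => //; first exact: abs_summableZ.
  by move=> k; rewrite mulN1r; have := ab k; rewrite ler_norml => /andP[].
by apply: le_Sum => // k; have := ab k; rewrite ler_norml => /andP[].
Qed.

Lemma Sum_ge_partial a N : abs_summable a -> (forall k, 0 <= a k) ->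
  \sum_(k < N) a k <= Sum a.
Proof.
move=> /abs_summable_cvg/cvgP sa a0; have := @nondecreasing_cvgn_le _ (series a).
rewrite /series/= => /(_ _ sa N); rewrite big_mkord; apply.
by apply: nondecreasing_series => n _ _.
Qed.

Lemma Sum_ge0 a : abs_summable a -> (forall k, 0 <= a k) -> 0 <= Sum a.
Proof. by move=> sa a0; have := Sum_ge_partial 0 sa a0; rewrite big_ord0. Qed.

Lemma Sum_le_bounded a M : abs_summable a -> (forall N, \sum_(k < N) a k <= M) ->
  Sum a <= M.
Proof.
move=> /abs_summable_cvg/cvgP sa aM; apply: limr_le => //.
by near=> n; rewrite /series/= big_mkord.
Unshelve. all: by end_near. Qed.

Lemma term_le_Sum a k : abs_summable a -> (forall k, 0 <= a k) -> a k <= Sum a.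
Proof.
move=> sa a0; apply: le_trans (Sum_ge_partial k.+1 sa a0).
by rewrite big_ord_recr/= lerDr sumr_ge0.
Qed.

Lemma abs_summable0 : abs_summable (fun=> 0).
Proof. by exists 0 => N; rewrite big1// => i _; rewrite normr0. Qed.

Lemma Sum0 : Sum (fun=> 0) = 0.
Proof.
apply/cvg_lim => //; rewrite [X in X @ _](_ : _ = cst 0); first exact: cvg_cst.
by apply/funext => n; rewrite /series/= big1.
Qed.

Lemma abs_summable_sum (I : Type) (s : seq I) (a : I -> nat -> R) :
  (forall i, abs_summable (a i)) -> abs_summable (fun k => \sum_(i <- s) a i k).
Proof.
move=> sa; elim: s => [|i s IH].
  by under eq_fun do rewrite big_nil; exact: abs_summable0.
by under eq_fun do rewrite big_cons; exact: abs_summableD.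
Qed.

Lemma Sum_sum (I : Type) (s : seq I) (a : I -> nat -> R) :
  (forall i, abs_summable (a i)) ->
  Sum (fun k => \sum_(i <- s) a i k) = \sum_(i <- s) Sum (a i).
Proof.
move=> sa; elim: s => [|i s IH].
  by under eq_Sum do rewrite big_nil; rewrite Sum0 big_nil.
under eq_Sum do rewrite big_cons.
by rewrite SumD ?IH ?big_cons//; exact: abs_summable_sum.
Qed.

Lemma abs_summable_shift a : abs_summable a -> abs_summable (fun k => a k.+1).
Proof.
move=> sa; exists (Sum (fun k => `|a k|)) => N.
apply: le_trans (Sum_ge_partial N.+1 (abs_summable_norm sa) _) => //.
by rewrite big_ord_recl/= lerDr.
Qed.

Lemma Sum_recl a : abs_summable a -> Sum a = a 0%N + Sum (fun k => a k.+1).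
Proof.
move=> sa; have := abs_summable_cvg (abs_summable_shift sa) => c.
apply/cvg_lim => //; rewrite -cvg_shiftS.
rewrite [X in X @ _](_ : _ = cst (a 0%N) + series (fun k => a k.+1)).
  by apply: cvgD => //; exact: cvg_cst.
by apply/funext => n; rewrite /= fctE /series/= big_nat_recl.
Qed.

Lemma Sum_approx a (e : R) : abs_summable a -> (0 < e) ->
  exists N, forall n, (N <= n)%N -> `|Sum a - \sum_(k < n) a k| < e.
Proof.
move=> /abs_summable_cvg /cvgrPdist_lt/(_ e) + e0 => /(_ e0)[N _ HN].
by exists N => n Nn; have := HN n Nn; rewrite /series/= big_mkord.
Qed.

(** Summability at [x + h] need not be assumed: it follows from that of [f], [f'] and the remainder
    bounds. *)
Lemma is_derive_Sum (f f' : nat -> R -> R) (M : nat -> R) (x e : R) : 0 < e ->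
  abs_summable M -> abs_summable (f^~ x) -> abs_summable (f'^~ x) ->
  (forall k h, `|h| < e -> `|f k (x + h) - f k x - h * f' k x| <= h ^+ 2 * M k) ->
  is_derive x 1 (fun x => Sum (f^~ x)) (Sum (f'^~ x)).
Proof.
move=> e0 sM sf sf' H; apply: (@is_derive_quadratic _ _ _ _ _ (Sum M) e0).
move=> h he.
have sM' := abs_summableZ (h ^+ 2) sM.
have sfh : abs_summable (f^~ (x + h)).
  have s1 := abs_summable_le (fun k => H k h he) sM'.
  have := abs_summableD (abs_summableD s1 (abs_summableZ h sf')) sf.
  by under eq_fun do rewrite !subrK.
rewrite -SumZ// -SumZ// -SumB// -SumB//; last first.
- exact: abs_summableZ.
- exact: abs_summableB.
by apply: norm_Sum => // k; exact: H.
Qed.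

End abs_sums.

(** * Integrals through antiderivatives, and the Gaussian integral *)

Section primitives.
Context {R : realType}.
Implicit Types (f g F : R -> R) (a b c x y z : R).
Let mu := @lebesgue_measure R.

Lemma is_derive0_cst F x y : (forall z, is_derive z 1 F 0) -> F x = F y.
Proof.
move=> dF; have [xy|/ltW yx] := leP x y.
  have [c _] := MVT_is_derive xy (fun z _ => dF z).
  by rewrite mul0r => /eqP; rewrite subr_eq0 => /eqP.
have [c _] := MVT_is_derive yx (fun z _ => dF z).
by rewrite mul0r => /eqP; rewrite subr_eq0 => /eqP.
Qed.

Definition has_prim f := exists F : R -> R, forall x, is_derive x 1 F (f x).

Definition prim f : R -> R :=
  xget (fun=> 0) [set F : R -> R | forall x, is_derive x 1 F (f x)].

(* The integral of [f] over [[a, b]], meaningful only under [has_prim f]. *)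
Definition J f a b := prim f b - prim f a.

Lemma primP f x : has_prim f -> is_derive x 1 (prim f) (f x).
Proof. by move=> hf; have := xgetPex (fun=> 0) hf. Qed.

Let local_prim f (M : R) : continuous f -> 0 < M -> exists F : R -> R,
  F 0 = 0 /\ forall x, - M < x < M -> is_derive x 1 F (f x).
Proof.
move=> cf M0.
have fi : mu.-integrable `[- M, M] (EFin \o f).
  apply: continuous_compact_integrable; first exact: segment_compact.
  exact: continuous_subspaceT.
pose F x := (\int[mu]_(t in [set` `[- M, x]]) f t)%R.
have dF x : - M < x < M -> is_derive x 1 F (f x).
  move=> /andP[Mx xM].
  have [dF <-] := continuous_FTC1_closed xM fi Mx (cf x).
  by rewrite derive1E; exact: derivableP.
exists (F - cst (F 0)); split; first by rewrite !fctE subrr.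
move=> x xM; rewrite -[f x]subr0.
by apply: is_deriveB; exact: dF.
Qed.

(** On each [(-M, M)] the Lebesgue integral from [-M] gives a primitive; normalised to vanish at 0,
    any two of them agree where both are defined, so they glue. *)
Lemma continuous_has_prim f : continuous f -> has_prim f.
Proof.
move=> cf.
have H (M : R) : exists F : R -> R, 0 < M ->
    F 0 = 0 /\ forall x, - M < x < M -> is_derive x 1 F (f x).
  have [M0|M0] := ltP 0 M; last by exists f.
  by have [F HF] := local_prim cf M0; exists F.
have [P PM] := choice H.
have PE (M M' x : R) : 0 < M -> 0 < M' -> - M < x < M -> - M' < x < M' -> P M x = P M' x.
  move=> M0 M'0 xM xM'.
  have [P0 dP] := PM M M0; have [P'0 dP'] := PM M' M'0.
  have dD y : `|y| <= `|x| -> is_derive y 1 (P M - P M') 0.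
    move=> yx; rewrite -(subrr (f y)).
    have yM : - M < y < M by rewrite -ltr_norml (le_lt_trans yx)// ltr_norml.
    have yM' : - M' < y < M' by rewrite -ltr_norml (le_lt_trans yx)// ltr_norml.
    by apply: is_deriveB; [exact: dP|exact: dP'].
  have [c _] := MVT0 dD (lexx _).
  rewrite !fctE P0 P'0 mul0r !subr0 => /eqP.
  by rewrite subr_eq0 => /eqP.
(* The interval varies with [x], but near a given [x] all the values agree with the single primitive
   for [M = |x| + 2]. *)
exists (fun x => P (`|x| + 1) x) => x.
have M0 : 0 < `|x| + 2 by rewrite ltr_wpDl.
have [_ dP] := PM _ M0.
apply: (near_eq_is_derive _ (dP x _)); last first.
  by rewrite -ltr_norml ltrDl.
have : \forall a \near x, `|a - x| < 1.
  by near=> a; rewrite distrC; near: a; exact: cvgr_dist_lt.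
apply: filterS => y yx; apply/PE => //.
- rewrite -ltr_norml; apply: le_lt_trans (_ : `|y - x| + `|x| < _).
    by rewrite -{1}(subrK x y) ler_normD.
  by rewrite addrC ltrD2l (lt_trans yx)// ltr1n.
- by rewrite -ltr_norml ltrDl.
Unshelve. all: by end_near. Qed.

Lemma JE f F a b : (forall x, is_derive x 1 F (f x)) -> J f a b = F b - F a.
Proof.
move=> dF; have hf : has_prim f by exists F.
have : (prim f - F) a = (prim f - F) b.
  apply: is_derive0_cst => z; rewrite -(subrr (f z)).
  by apply: is_deriveB; exact: primP.
by rewrite !fctE /J => H; lra.
Qed.

Lemma JD f g a b : has_prim f -> has_prim g ->
  J (fun x => f x + g x) a b = J f a b + J g a b.
Proof.
move=> hf hg.
have d x : is_derive x 1 (prim f + prim g) (f x + g x).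
  by apply: is_deriveD; exact: primP.
by rewrite (JE a b d) !fctE /J; lra.
Qed.

Lemma has_primD f g : has_prim f -> has_prim g -> has_prim (fun x => f x + g x).
Proof.
move=> hf hg; exists (prim f + prim g) => x.
by apply: is_deriveD; exact: primP.
Qed.

Lemma has_primZ (k : R) f : has_prim f -> has_prim (fun x => k * f x).
Proof.
by move=> hf; exists (k \*: prim f) => x; apply: is_deriveZ; exact: primP.
Qed.

Lemma JZ (k : R) f a b : has_prim f -> J (fun x => k * f x) a b = k * J f a b.
Proof.
move=> hf; have d x : is_derive x 1 (k \*: prim f) (k * f x).
  by apply: is_deriveZ; exact: primP.
by rewrite (JE a b d) /J /= /GRing.scale/= mulrBr.
Qed.

Lemma JB f g a b : has_prim f -> has_prim g ->
  J (fun x => f x - g x) a b = J f a b - J g a b.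
Proof.
move=> hf hg.
have d x : is_derive x 1 (prim f - prim g) (f x - g x).
  by apply: is_deriveB; exact: primP.
by rewrite (JE a b d) !fctE /J; lra.
Qed.

Lemma has_primB f g : has_prim f -> has_prim g -> has_prim (fun x => f x - g x).
Proof.
move=> hf hg; exists (prim f - prim g) => x.
by apply: is_deriveB; exact: primP.
Qed.

Lemma eq_J f g a b : (forall x, f x = g x) -> J f a b = J g a b.
Proof. by move=> fg; congr J; apply/funext. Qed.

Lemma J_cst (k : R) a b : J (fun=> k) a b = k * (b - a).
Proof.
have d x : is_derive x 1 (k \*: id) k.
  by rewrite -[X in is_derive _ _ _ X]mulr1; exact: is_deriveZ.
by rewrite (JE a b d) /= /GRing.scale/= mulrBr.
Qed.

Lemma has_prim_cst (k : R) : has_prim (fun=> k).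
Proof. by apply: continuous_has_prim; exact: cst_continuous. Qed.

Lemma J_ge0 f a b : has_prim f -> a <= b -> (forall x, a <= x <= b -> 0 <= f x) ->
  0 <= J f a b.
Proof.
move=> hf ab f0.
have [c cab] := MVT_is_derive ab (fun x _ => primP x hf).
by rewrite /J => ->; rewrite mulr_ge0 ?subr_ge0 ?f0.
Qed.

Lemma le_J f g a b : has_prim f -> has_prim g -> a <= b ->
  (forall x, a <= x <= b -> f x <= g x) -> J f a b <= J g a b.
Proof.
move=> hf hg ab fg; rewrite -subr_ge0 -JB//; apply: J_ge0 => //.
  exact: has_primB.
by move=> x xab; rewrite subr_ge0 fg.
Qed.

Lemma norm_J f g a b : has_prim f -> has_prim g -> a <= b ->
  (forall x, a <= x <= b -> `|f x| <= g x) -> `|J f a b| <= J g a b.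
Proof.
move=> hf hg ab fg; rewrite ler_norml; apply/andP; split.
  rewrite -mulN1r -JZ//; apply: le_J => //; first exact: has_primZ.
  by move=> x /fg; rewrite mulN1r ler_norml => /andP[].
by apply: le_J => // x /fg; rewrite ler_norml => /andP[].
Qed.

Lemma has_prim_sum (I : Type) (s : seq I) (f : I -> R -> R) :
  (forall i, has_prim (f i)) -> has_prim (fun x => \sum_(i <- s) f i x).
Proof.
move=> hf; elim: s => [|i s IH].
  by under eq_fun do rewrite big_nil; exact: has_prim_cst.
by under eq_fun do rewrite big_cons; exact: has_primD.
Qed.

Lemma J_sum (I : Type) (s : seq I) (f : I -> R -> R) a b :
  (forall i, has_prim (f i)) ->
  J (fun x => \sum_(i <- s) f i x) a b = \sum_(i <- s) J (f i) a b.
Proof.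
move=> hf; elim: s => [|i s IH].
  by under eq_J do rewrite big_nil; rewrite J_cst mul0r big_nil.
under eq_J do rewrite big_cons.
by rewrite JD ?IH ?big_cons//; exact: has_prim_sum.
Qed.

Lemma is_derive_continuous (f df : R -> R) : (forall x, is_derive x 1 f (df x)) ->
  continuous f.
Proof.
move=> dfx x; apply/differentiable_continuous/derivable1_diffP.
by have [] := dfx x.
Qed.

Lemma is_derive_scale_arg f df k x : is_derive (k * x) 1 f df ->
  is_derive x 1 (fun x => f (k * x)) (k * df).
Proof.
move=> H; have := @is_derive1_comp _ f ( *%R k) x df k H.
rewrite mulrC; apply.
have := is_deriveZ k (is_derive_id x 1).
by rewrite /GRing.scale/= mulr1.
Qed.

Lemma gauss_prim : exists G : R -> R,
  [/\ forall x, is_derive x 1 G (expR (- x ^+ 2)),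
      forall x, G (- x) = - G x &
      G x @[x --> +oo] --> Num.sqrt pi / 2].
Proof.
have hg : has_prim (@gauss_fun R).
  exact/continuous_has_prim/continuous_gauss_fun.
pose G := prim gauss_fun - cst (prim gauss_fun 0).
have dG x : is_derive x 1 G (expR (- x ^+ 2)).
  rewrite -[X in is_derive _ _ _ X]subr0.
  by apply: is_deriveB; exact: primP.
have G0 : G 0 = 0 by rewrite /G !fctE subrr.
exists G; split => // [x|].
  have dN y : is_derive y 1 (fun y => G (- y)) (- expR (- y ^+ 2)).
    have := @is_derive_scale_arg G (expR (- y ^+ 2)) (-1) y.
    rewrite mulN1r => /(_ _)/= H.
    have -> : (fun y => G (- y)) = (fun y => G (-1 * y)).
      by apply/funext => z; rewrite mulN1r.
    rewrite -[X in is_derive _ _ _ X]mulN1r; apply: H.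
    by have := dG (- y); rewrite sqrrN.
  have dD z : is_derive z 1 ((fun y => G (- y)) + G) 0.
    rewrite -[X in is_derive _ _ _ X](addNr (expR (- z ^+ 2))).
    exact: is_deriveD (dN z) (dG z).
  have := is_derive0_cst x 0 dD.
  by rewrite !fctE oppr0 G0 addr0 => /eqP; rewrite addr_eq0 => /eqP.
have cG := is_derive_continuous dG.
have GE x : 0 < x -> G x = gauss_integral_proof.integral0_gauss x.
  move=> x0; have LR : derivable_oo_LRcontinuous G 0 x.
    split.
    + by move=> y _; have [] := dG y.
    + by apply: cvg_at_right_filter; exact: cG.
    + by apply: cvg_at_left_filter; exact: cG.
  have G'E : {in `]0, x[, G^`()%classic =1 gauss_fun}.
    by move=> y _; rewrite derive1E; have [_ ->] := dG y.
  have cg : {within `[0, x], continuous (@gauss_fun R)}.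
    by apply: continuous_subspaceT; exact: continuous_gauss_fun.
  have E := continuous_FTC2 x0 cg LR G'E.
  by rewrite /gauss_integral_proof.integral0_gauss /Rintegral E -EFinB/= G0 subr0.
(* The known limit is that of the square of the integral; the integral is nonnegative, so a square
   root recovers it. *)
have : Num.sqrt (gauss_integral_proof.integral0_gauss x ^+ 2) @[x --> +oo]
    --> Num.sqrt ((pi : R) / 4).
  apply: continuous_cvg; first exact: sqrt_continuous.
  exact: gauss_integral_proof.cvg_integral0_gauss_sqr.
have -> : Num.sqrt ((pi : R) / 4) = Num.sqrt pi / 2.
  rewrite sqrtrM ?pi_ge0// sqrtrV// (_ : 4 = 2 ^+ 2); last by rewrite expr2 -natrM.
  by rewrite sqrtr_sqr ger0_norm.
apply: cvg_trans; apply: near_eq_cvg; near=> x.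
rewrite sqrtr_sqr GE//.
by rewrite ger0_norm// gauss_integral_proof.integral0_gauss_ge0.
Unshelve. all: by end_near. Qed.

End primitives.

(** * The generating function and its logarithm *)

Section generating_functions.
Context {R : realType}.
Implicit Types (a b : nat -> R) (r x y h : R).

Lemma le_partial a m n : (forall k, 0 <= a k) -> (m <= n)%N ->
  \sum_(i < m) a i <= \sum_(i < n) a i.
Proof.
move=> a0 mn; have [k ->] : exists k, n = (m + k)%N by exists (n - m)%N; lia.
by rewrite big_split_ord/= lerDl sumr_ge0.
Qed.

Lemma cauchy_partial a b N :
  \sum_(n < N) \sum_(k < n.+1) a k * b (n - k)%N =
  \sum_(i < N) a i * \sum_(j < N - i) b j.
Proof.
elim: N => [|N IH]; first by rewrite !big_ord0.
rewrite big_ord_recr/= IH [in RHS]big_ord_recr/= subSnn big_ord1.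
rewrite [X in _ + X]big_ord_recr/= subnn addrA -big_split/=; congr (_ + _).
apply: eq_bigr => i _; rewrite subSn; last exact: ltnW.
by rewrite big_ord_recr/= mulrDr.
Qed.

Definition conv a b n := \sum_(k < n.+1) a k * b (n - k)%N.

Lemma abs_summable_conv a b : abs_summable a -> abs_summable b ->
  abs_summable (conv a b).
Proof.
move=> sa sb; have na := abs_summable_norm sa; have nb := abs_summable_norm sb.
exists (Sum (fun k => `|a k|) * Sum (fun k => `|b k|)) => N.
apply: (@le_trans _ _ (\sum_(n < N) \sum_(k < n.+1) `|a k| * `|b (n - k)%N|)).
  apply: ler_sum => n _; apply: le_trans (ler_norm_sum _ _ _) _.
  by apply: ler_sum => k _; rewrite normrM.
rewrite (cauchy_partial (fun k => `|a k|) (fun k => `|b k|)).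
apply: (@le_trans _ _ (\sum_(i < N) `|a i| * Sum (fun k => `|b k|))).
  by apply: ler_sum => i _; rewrite ler_wpM2l// Sum_ge_partial.
by rewrite -mulr_suml ler_wpM2r ?Sum_ge0//; exact: Sum_ge_partial.
Qed.

(** The partial sum up to [2N] is the sum of [a i] times the partial sum of [b] up to [2N - i]. For
    [i < N] the missing tail of [b] starts at [N] or later and is small; for [i >= N] the tail of
    [|a|] is small. *)
Lemma Sum_conv a b : abs_summable a -> abs_summable b ->
  Sum (conv a b) = Sum a * Sum b.
Proof.
move=> sa sb; have na := abs_summable_norm sa; have nb := abs_summable_norm sb.
pose A := Sum (fun k => `|a k|); pose B := Sum (fun k => `|b k|).
have A0 : 0 <= A by exact: Sum_ge0.
have B0 : 0 <= B by exact: Sum_ge0.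
apply/eqP; rewrite -subr_eq0 -normr_le0; apply/ler_addgt0Pr => e e0; rewrite add0r.
(* The denominator dominates the coefficients of [d] in the final bound
   [d + (A d + d (B + B)) + d |Sum b|]. *)
pose d := e / (1 + `|Sum b| + A + A + B + B).
have D0 : 0 < 1 + `|Sum b| + A + A + B + B.
  by rewrite -!addrA ltr_pwDl// !addr_ge0.
have d0 : 0 < d by rewrite divr_gt0.
have [N1 H1] := Sum_approx (abs_summable_conv sa sb) d0.
have [N2 H2] := Sum_approx sa d0.
have [N3 H3] := Sum_approx sb d0.
have [N4 H4] := Sum_approx na d0.
pose N := (N1 + N2 + N3 + N4)%N.
have K1 := H1 (N + N)%N ltac:(rewrite /N; lia).
have K2 := H2 (N + N)%N ltac:(rewrite /N; lia).
have K4 := H4 N ltac:(rewrite /N; lia).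
have K : `|\sum_(n < N + N) conv a b n - (\sum_(i < N + N) a i) * Sum b| <=
    A * d + d * (B + B).
  rewrite cauchy_partial mulr_suml -sumrB.
  apply: le_trans (ler_norm_sum _ _ _) _.
  rewrite big_split_ord/=; apply: lerD.
    apply: (@le_trans _ _ (\sum_(i < N) `|a i| * d)).
      apply: ler_sum => i _; rewrite -mulrBr normrM ler_wpM2l// distrC ltW//.
      by apply: H3; have := ltn_ord i; rewrite /N; lia.
    by rewrite -mulr_suml ler_wpM2r ?(ltW d0)//; exact: Sum_ge_partial.
  apply: (@le_trans _ _ (\sum_(i < N) `|a (N + i)%N| * (B + B))).
    apply: ler_sum => i _; rewrite -mulrBr normrM ler_wpM2l//.
    apply: le_trans (ler_normB _ _) _; apply: lerD; last exact: norm_Sum.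
    by apply: le_trans (ler_norm_sum _ _ _) _; exact: Sum_ge_partial.
  rewrite -mulr_suml ler_wpM2r ?addr_ge0//.
  have /ltW := K4; apply: le_trans; rewrite ler_normr; apply/orP; left.
  have := Sum_ge_partial (N + N) na (fun k => normr_ge0 _).
  by rewrite big_split_ord/= -/A => ?; rewrite lerBrDl.
have -> : Sum (conv a b) - Sum a * Sum b =
  (Sum (conv a b) - \sum_(n < N + N) conv a b n) +
  (\sum_(n < N + N) conv a b n - (\sum_(i < N + N) a i) * Sum b) -
  (Sum a - \sum_(i < N + N) a i) * Sum b by ring.
apply: le_trans (ler_normB _ _) _; rewrite normrM.
apply: (@le_trans _ _ (d + (A * d + d * (B + B)) + d * `|Sum b|)).
  apply: lerD; last by rewrite ler_wpM2r// ltW.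
  by apply: le_trans (ler_normD _ _) _; rewrite lerD// ltW.
have -> : e = d * (1 + `|Sum b| + A + A + B + B).
  by rewrite /d divfK// gt_eqF.
have := mulr_ge0 (ltW d0) A0; have := mulr_ge0 (ltW d0) B0.
by rewrite !mulrDr => ? ?; lra.
Qed.

(** By [npartS] the sums satisfy [S(N+1) = S(N) + r^(N+1) S(N+1)], which adds one factor to the
    product. *)
Lemma npart_gf N r : 0 <= r < 1 ->
  abs_summable (fun n => (npart N n)%:R * r ^+ n) /\
  Sum (fun n => (npart N n)%:R * r ^+ n) = \prod_(i < N) (1 - r ^+ i.+1)^-1.
Proof.
move=> /andP[r0 r1]; elim: N => [|N [sN SN]].
  have E n : (npart 0 n)%:R * r ^+ n = (n == 0%N)%:R :> R.
    by rewrite npart0; case: n => [|n]; rewrite ?mul0r// expr0 mul1r.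
  have s0 : abs_summable (fun n => (n == 0%N)%:R : R).
    exists 1 => -[|M]; first by rewrite big_ord0.
    by rewrite big_ord_recl/= normr1 big1 ?addr0// => i _; rewrite normr0.
  split; first by under eq_fun do rewrite E.
  under eq_Sum do rewrite E.
  by rewrite Sum_recl//= Sum0 addr0 big_ord0.
have rM : 0 < 1 - r ^+ N.+1 by rewrite subr_gt0 exprn_ilt1.
pose sh n : R := if (N < n)%N then (npart N.+1 (n - N.+1))%:R * r ^+ n else 0.
have E n : (npart N.+1 n)%:R * r ^+ n = (npart N n)%:R * r ^+ n + sh n :> R.
  rewrite {1}npartS natrD mulrDl /sh; case: ifP => //.
  by rewrite mul0r.
have shE n : sh (n + N.+1)%N = r ^+ N.+1 * ((npart N.+1 n)%:R * r ^+ n).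
  rewrite /sh addnK ifT; last by lia.
  by rewrite exprD; ring.
have sh0 n : (n <= N)%N -> sh n = 0 by move=> nN; rewrite /sh ltnNge nN.
have t0 n : 0 <= (npart N.+1 n)%:R * r ^+ n by rewrite mulr_ge0// exprn_ge0.
have tN0 n : 0 <= (npart N n)%:R * r ^+ n by rewrite mulr_ge0// exprn_ge0.
have S : abs_summable (fun n => (npart N.+1 n)%:R * r ^+ n).
  (* Summability comes first: each partial sum [T] satisfies [T <= S(N) + r^(N+1) T], and the
     witness is what this gives for [T]. *)
  exists (Sum (fun n => (npart N n)%:R * r ^+ n) / (1 - r ^+ N.+1)) => M.
  under eq_bigr do rewrite ger0_norm//.
  rewrite ler_pdivlMr// mulrBr mulr1 lerBlDr.
  under [leLHS]eq_bigr do rewrite E.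
  rewrite big_split/= lerD//; first exact: Sum_ge_partial.
  rewrite -(big_mkord xpredT sh).
  have -> : \sum_(0 <= i < M) sh i = \sum_(0 <= i < M - N.+1) sh (i + N.+1)%N.
    have [MN|NM] := leqP M N.+1.
      rewrite (eqP MN) [RHS]big_geq// big_nat big1// => i /andP[_ iM].
      by apply: sh0; rewrite -ltnS (leq_trans iM).
    rewrite (@big_cat_nat _ _ _ N.+1)//=; last exact: ltnW.
    rewrite big_nat big1 ?add0r; last by move=> i /andP[_ iN]; apply: sh0.
    by rewrite -{1}[N.+1]add0n big_addn.
  rewrite (eq_bigr _ (fun i _ => shE i)).
  rewrite -mulr_sumr mulrC ler_wpM2r ?exprn_ge0// big_mkord.
  exact: (@le_partial (fun n => (npart N.+1 n)%:R * r ^+ n) _ _ t0 (leq_subr _ _)).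
split=> //.
have shs : abs_summable sh.
  apply: abs_summable_le S => n; rewrite E ger0_norm ?lerDr//.
  by rewrite /sh; case: ifP => // _; rewrite mulr_ge0// exprn_ge0.
have shS : Sum sh = r ^+ N.+1 * Sum (fun n => (npart N.+1 n)%:R * r ^+ n).
  have H M : (M <= N.+1)%N -> abs_summable (fun n => sh (n + M)%N) /\
      Sum sh = Sum (fun n => sh (n + M)%N).
    elim: M => [|M IH] MN; first by under eq_fun do rewrite addn0.
    have [s1 ->] := IH (ltnW MN).
    rewrite (Sum_recl s1) add0n sh0// add0r.
    under [X in _ = Sum X]eq_fun do rewrite -addSnnS.
    under eq_fun do rewrite -addSnnS.
    by split => //; exact: (abs_summable_shift s1).
  have [_ ->] := H _ (leqnn _).
  by rewrite -SumZ//; apply: eq_Sum => n; rewrite shE.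
have H : Sum (fun n => (npart N.+1 n)%:R * r ^+ n) =
   Sum (fun n => (npart N n)%:R * r ^+ n) +
   r ^+ N.+1 * Sum (fun n => (npart N.+1 n)%:R * r ^+ n).
  by rewrite -shS -SumD//; apply: eq_Sum.
rewrite big_ord_recr/= -SN; apply: (mulIf (lt0r_neq0 rM)).
by rewrite divfK ?gt_eqF//; lra.
Qed.

Lemma pow_expR_le x j : 0 <= x -> x ^+ j <= j`!%:R * expR x.
Proof.
case: j => [|j] x0.
  by rewrite expr0 fact0 mul1r -expR0 ler_expR.
have := expR_ge1Dxn j x0; rewrite -ler_pdivrMl ?ltr0n ?fact_gt0// mulrC.
by apply: le_trans; rewrite lerDr.
Qed.

(** Each factor is [1 + r^(i+1) / (1 - r^(i+1))], at most [exp(r^i / (1 - r))]; the exponents form a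
    geometric series, so the bound is uniform in [N]. *)
Lemma prod_geom_bound N r : 0 <= r < 1 ->
  \prod_(i < N) (1 - r ^+ i.+1)^-1 <= expR ((1 - r) ^- 2).
Proof.
move=> /andP[r0 r1]; have r1' : 0 < 1 - r by rewrite subr_gt0.
have ri i : 0 < 1 - r ^+ i.+1 by rewrite subr_gt0 exprn_ilt1.
have geo M : \sum_(i < M) r ^+ i <= (1 - r)^-1.
  have H : (1 - r) * (\sum_(i < M) r ^+ i) = 1 - r ^+ M.
    by apply: oppr_inj; rewrite -mulNr !opprB subrX1.
  by rewrite -[leRHS]mulr1 ler_pdivlMl// H lerBlDr lerDl exprn_ge0.
apply: (@le_trans _ _ (\prod_(i < N) expR (r ^+ i / (1 - r)))).
  apply: ler_prod => i _; rewrite invr_ge0 ltW//=.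
  apply: le_trans (expR_ge1Dx _).
  have -> : (1 - r ^+ i.+1)^-1 = 1 + r ^+ i.+1 / (1 - r ^+ i.+1).
    by field; rewrite gt_eqF.
  rewrite lerD2l ler_pM ?exprn_ge0 ?invr_ge0 ?(ltW (ri _))//.
    by rewrite ler_wiXn2l// ltW.
  by rewrite lef_pV2 ?posrE// lerD2l lerN2 exprS ler_piMr// exprn_ile1// ltW.
rewrite -expR_sum ler_expR -mulr_suml expr2 invfM ler_wpM2r// invr_ge0 ltW//.
Qed.

(** The [N]-th product is squeezed between the [N]-th partial sum, since [npart N n] is the full
    count for [n <= N], and the whole sum, since [npart N n] never exceeds it. *)
Lemma num_partitions_gf r : 0 <= r < 1 ->
  abs_summable (fun n => (num_partitions n)%:R * r ^+ n) /\
  (fun N => \prod_(i < N) (1 - r ^+ i.+1)^-1) @ \oo -->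
    Sum (fun n => (num_partitions n)%:R * r ^+ n).
Proof.
move=> r01; have /andP[r0 r1] := r01.
have p0 n : 0 <= (num_partitions n)%:R * r ^+ n by rewrite mulr_ge0// exprn_ge0.
have c0 N n : 0 <= (npart N n)%:R * r ^+ n by rewrite mulr_ge0// exprn_ge0.
have le1 N : \sum_(n < N) (num_partitions n)%:R * r ^+ n <=
    \prod_(i < N) (1 - r ^+ i.+1)^-1.
  have [sN <-] := npart_gf N r01.
  apply: le_trans (Sum_ge_partial N sN (c0 N)); apply: ler_sum => n _.
  by rewrite npart_stable// ltnW.
have s : abs_summable (fun n => (num_partitions n)%:R * r ^+ n).
  exists (expR ((1 - r) ^- 2)) => N.
  under eq_bigr do rewrite ger0_norm//.
  by apply: le_trans (le1 N) _; exact: prod_geom_bound.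
split=> //.
have c1 := abs_summable_cvg s.
apply: squeeze_cvgr c1 (cvg_cst _); near=> N.
rewrite /series/= big_mkord le1/=.
have [sN <-] := npart_gf N r01; apply: le_Sum => // n.
by rewrite ler_wpM2r ?exprn_ge0// ler_nat npart_le.
Unshelve. all: by end_near. Qed.

End generating_functions.

(** * Series in [exp(-k y)]: bounds and termwise derivatives *)

Section dirichlet_exponents.
Context {R : realType}.
Implicit Types (a b : nat -> R) (r x y h t : R).

Definition ee y k : R := expR (- (k%:R * y)).

Lemma ee_ge0 y k : 0 <= ee y k. Proof. exact: expR_ge0. Qed.

Lemma eeX y k : ee y k = expR (- y) ^+ k.
Proof. by rewrite /ee -expRM_natl mulrN. Qed.

Lemma eeD y k l : ee y (k + l) = ee y k * ee y l.
Proof. by rewrite !eeX exprD. Qed.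

Lemma ee_half y k : ee y k = ee (y / 2) k * ee (y / 2) k.
Proof. by rewrite /ee -expRD; congr expR; field. Qed.

Lemma expRN_itv y : 0 < y -> 0 <= expR (- y) < 1.
Proof. by move=> y0; rewrite expR_ge0 expR_lt1 oppr_lt0. Qed.

Lemma abs_summable_ee y : 0 < y -> abs_summable (ee y).
Proof.
move=> y0; have /andP[r0 r1] := expRN_itv y0.
apply/abs_summableP.
have -> : (fun k => `|ee y k|) = geometric 1 (expR (- y)).
  by apply/funext => k; rewrite /= mul1r ger0_norm ?ee_ge0// eeX.
by apply: is_cvg_geometric_series; rewrite ger0_norm.
Qed.

(** One half of the exponential absorbs the power of [k], the other half keeps the series
    summable. *)
Lemma pow_ee_le y j k : 0 < y ->
  k%:R ^+ j * ee y k <= j`!%:R * (2 / y) ^+ j * ee (y / 2) k.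
Proof.
move=> y0; rewrite ee_half mulrA ler_wpM2r ?ee_ge0//.
have yk : 0 <= k%:R * (y / 2) by rewrite mulr_ge0// divr_ge0// ltW.
have := pow_expR_le j yk; rewrite exprMn /ee expRN ler_pdivrMr ?expR_gt0// => H.
rewrite -(ler_pM2r (exprn_gt0 j (divr_gt0 y0 (ltr0Sn R 1)))).
apply: le_trans H _; rewrite le_eqVlt; apply/orP; left; apply/eqP.
rewrite -[(2 / y)]invf_div exprVn; field.
by rewrite expf_neq0// gt_eqF// divr_gt0.
Qed.

Lemma abs_summable_pow_ee y j : 0 < y -> abs_summable (fun k => k%:R ^+ j * ee y k).
Proof.
move=> y0; have y2 : 0 < y / 2 by rewrite divr_gt0.
apply: abs_summable_le (abs_summableZ (j`!%:R * (2 / y) ^+ j) (abs_summable_ee y2)).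
by move=> k; rewrite ger0_norm ?pow_ee_le// mulr_ge0 ?ee_ge0 ?exprn_ge0.
Qed.

Lemma Sum_pow_ee_le y j : 0 < y <= 1 ->
  Sum (fun k => k%:R ^+ j * ee y k) <= j`!%:R * 2 ^+ j * 4 / y ^+ j.+1.
Proof.
move=> /andP[y0 y1]; have y2 : 0 < y / 2 by rewrite divr_gt0.
apply: (@le_trans _ _ (Sum (fun k => j`!%:R * (2 / y) ^+ j * ee (y / 2) k))).
  apply: le_Sum; first exact: abs_summable_pow_ee.
    exact/abs_summableZ/abs_summable_ee.
  by move=> k; exact: pow_ee_le.
rewrite SumZ; last exact: abs_summable_ee.
have S : Sum (ee (y / 2)) <= 4 / y.
  have /andP[r0 r1] := expRN_itv y2; set r := expR _ in r0 r1.
  apply: Sum_le_bounded; first exact: abs_summable_ee.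
  move=> N; under eq_bigr do rewrite eeX -/r.
  have r1' : 0 < 1 - r by rewrite subr_gt0.
  have H : (1 - r) * (\sum_(i < N) r ^+ i) = 1 - r ^+ N.
    by apply: oppr_inj; rewrite -mulNr !opprB subrX1.
  apply: (@le_trans _ _ (1 - r)^-1).
    by rewrite -[leRHS]mulr1 ler_pdivlMl// H lerBlDr lerDl exprn_ge0.
  rewrite -[4 / y]invf_div lef_pV2 ?posrE ?divr_gt0//.
  have := expR_ge1Dx (y / 2); have rE : r * expR (y / 2) = 1.
    by rewrite /r -expRD addNr expR0.
  move=> H2; have : r * (1 + y / 2) <= 1 by apply: le_trans (ler_wpM2l r0 H2) _; rewrite rE.
  by nra.
apply: le_trans (_ : j`!%:R * (2 / y) ^+ j * (4 / y) <= _).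
  by rewrite ler_wpM2l// mulr_ge0// exprn_ge0// divr_ge0// ltW.
rewrite exprMn exprS exprVn le_eqVlt; apply/orP; left; apply/eqP; field.
by rewrite gt_eqF ?gt_eqF ?exprn_gt0.
Qed.

Lemma expR_quad x h r : `|h| <= r ->
  `|expR (x + h) - expR x - h * expR x| <= h ^+ 2 * expR (x + r).
Proof.
move=> hr; have := expR_taylor 2 hr.
rewrite !big_ord_recl big_ord0/= expr0 expr1 !fact0 !divr1 addr0 => H.
have -> : expR (x + h) - expR x - h * expR x = expR x * (expR h - (1 + h)).
  by rewrite expRD; ring.
rewrite normrM ger0_norm ?expR_ge0// expRD mulrCA ler_wpM2l ?expR_ge0//.
by apply: le_trans H _; rewrite mulrC real_normK ?num_real.
Qed.

Lemma cos_shift_quad i x h :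
  `|cos_shift i (x + h) - cos_shift i x - h * cos_shift i.+1 x| <= h ^+ 2.
Proof.
have := @taylor_bound _ (fun k z => cos_shift (i + k) (x + z)) 2 `|h| 1 h.
rewrite !big_ord_recl big_ord0/= /bump/= !addn0 addn1 !addr0 expr0 expr1 !fact0.
rewrite !divr1 mulr1 mul1r real_normK ?num_real// [_ * h]mulrC opprD addrA.
apply=> // [k z _ _|y _]; last exact: cos_max.
rewrite addnS.
have := @is_derive1_comp _ (cos_shift (i + k)) (fun z => x + z) z.
move=> /(_ _ _ (is_derive_cos_shift _ _) (is_deriveD (is_derive_cst _ _ _) (is_derive_id _ _))).
by rewrite add0r mulr1.
Qed.

Lemma is_derive_trig_series a i t : abs_summable (fun k => k%:R ^+ 2 * a k) ->
  is_derive t 1 (fun t => Sum (fun k => a k * cos_shift i (k%:R * t)))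
    (Sum (fun k => k%:R * a k * cos_shift i.+1 (k%:R * t))).
Proof.
move=> sa; have s1 : abs_summable (fun k => k%:R * a k).
  apply: abs_summable_le (abs_summable_norm sa) => k.
  rewrite !normrM ler_wpM2r// !ger0_norm ?exprn_ge0//.
  by rewrite -natrM ler_nat; nia.
have s0 : abs_summable a.
  have := abs_summable_norm s1.
  (* Summability of [k a(k)] says nothing about [a 0]; the added multiple of [ee 1], which is 1 at
     [k = 0], covers that term. *)
  move=> s1'; have s2 : abs_summable (fun k => `|k%:R * a k| + `|a 0%N| * ee 1 k).
    apply: abs_summableD => //; apply: abs_summableZ; exact: abs_summable_ee.
  apply: abs_summable_le s2 => -[|k].
    by rewrite mul0r normr0 add0r /ee mul0r oppr0 expR0 mulr1.
  rewrite -[leLHS]addr0 lerD ?mulr_ge0 ?ee_ge0// normrM ler_peMl//.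
  by rewrite ger0_norm// ler1n.
apply: (@is_derive_Sum _ (fun k t => a k * cos_shift i (k%:R * t))
    (fun k t => k%:R * a k * cos_shift i.+1 (k%:R * t))
    (fun k => `|k%:R ^+ 2 * a k|) t 1) => //.
- exact: abs_summable_norm.
- apply: abs_summable_le (abs_summable_norm s0) => k.
  by rewrite normrM ler_piMr// cos_max.
- apply: abs_summable_le (abs_summable_norm s1) => k.
  by rewrite normrM ler_piMr// cos_max.
move=> k h _.
have -> : a k * cos_shift i (k%:R * (t + h)) - a k * cos_shift i (k%:R * t) -
    h * (k%:R * a k * cos_shift i.+1 (k%:R * t)) =
    a k * (cos_shift i (k%:R * t + k%:R * h) - cos_shift i (k%:R * t) -
     (k%:R * h) * cos_shift i.+1 (k%:R * t)).
  by rewrite mulrDr; ring.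
have -> : h ^+ 2 * `|k%:R ^+ 2 * a k| = `|a k| * (k%:R * h) ^+ 2.
  by rewrite normrM ger0_norm ?exprn_ge0//; ring.
by rewrite normrM ler_wpM2l// cos_shift_quad.
Qed.

Lemma is_derive_exp_series a y : 0 < y ->
  (forall z : R, 0 < z -> abs_summable (fun k => a k * ee z k)) ->
  (forall z : R, 0 < z -> abs_summable (fun k => k%:R * a k * ee z k)) ->
  (forall z : R, 0 < z -> abs_summable (fun k => k%:R ^+ 2 * a k * ee z k)) ->
  is_derive y 1 (fun y => Sum (fun k => a k * ee y k))
    (Sum (fun k => - (k%:R * a k * ee y k))).
Proof.
move=> y0 s0 s1 s2; have y2 : 0 < y / 2 by rewrite divr_gt0.
apply: (@is_derive_Sum _ (fun k y => a k * ee y k)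
    (fun k y => - (k%:R * a k * ee y k))
    (fun k => `|k%:R ^+ 2 * a k * ee (y / 2) k|) y (y / 2)) => //.
- exact/abs_summable_norm/s2.
- exact: s0.
- by apply: abs_summable_le (abs_summable_norm (s1 y y0)) => k; rewrite normrN.
move=> k h hy.
have hk : `|- (k%:R * h)| <= k%:R * (y / 2).
  by rewrite normrN normrM ger0_norm// ler_wpM2l// ltW.
have -> : a k * ee (y + h) k - a k * ee y k - h * - (k%:R * a k * ee y k) =
  a k * (expR (- (k%:R * y) + - (k%:R * h)) - expR (- (k%:R * y)) -
    - (k%:R * h) * expR (- (k%:R * y))).
  rewrite /ee (_ : - (k%:R * (y + h)) = - (k%:R * y) + - (k%:R * h)); last by ring.
  by ring.
rewrite normrM.
have := expR_quad (- (k%:R * y)) hk.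
have -> : - (k%:R * y) + k%:R * (y / 2) = - (k%:R * (y / 2)) by field.
rewrite -/(ee (y / 2) k) => /(ler_wpM2l (normr_ge0 (a k))) /le_trans; apply.
rewrite normrM normrM (ger0_norm (ee_ge0 _ _)) [`|k%:R ^+ 2|]ger0_norm ?exprn_ge0//.
by rewrite le_eqVlt; apply/orP; left; apply/eqP; ring.
Qed.

(** Without constant term, each [exp(-k y)] has [k >= 1] and is at most [exp(1 - y) exp(-k)]. This
    gives the limits at infinity that fix the constant in [PP_exp]. *)
Lemma expRN_vanishing a y : (forall k, 0 <= a k) -> a 0%N = 0 ->
  (forall z : R, 0 < z -> abs_summable (fun k => a k * ee z k)) -> 1 < y ->
  Sum (fun k => a k * ee y k) <= expR (1 - y) * Sum (fun k => a k * ee 1 k).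
Proof.
move=> a0 a00 s y1; have y0 : 0 < y by apply: lt_trans y1.
rewrite -SumZ; last exact: s.
apply: le_Sum; [exact: s|exact/abs_summableZ/s|].
case=> [|k]; first by rewrite a00 !mul0r mulr0.
rewrite mulrCA ler_wpM2l// /ee -expRD ler_expR.
have k0 : 0 <= k%:R :> R by [].
by rewrite -natr1; nra.
Qed.

End dirichlet_exponents.

(** * The partition generating function, its logarithm, and both at complex arguments *)

Section partition_series.
Context {R : realType}.
Implicit Types (a b : nat -> R) (x y z w h s t : R).

Definition pp n : R := (num_partitions n)%:R.
(* [PP] is the generating function of the partitions at [q = exp (- y)], [LL] are the
   coefficients of its logarithm, and [FF i] is [(- d/dy)^i (ln PP)]. *)
Definition LL k : R := (sigma k)%:R / k%:R.
Definition FF i y : R := Sum (fun k => k%:R ^+ i * LL k * ee y k).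
Definition PP y : R := Sum (fun n => pp n * ee y n).

Lemma pp_ge0 n : 0 <= pp n. Proof. exact: ler0n. Qed.

Lemma LL_ge0 k : 0 <= LL k. Proof. by rewrite /LL divr_ge0. Qed.

Lemma LL0 : LL 0 = 0. Proof. by rewrite /LL sigma0 mul0r. Qed.

Lemma LL_le k : LL k <= k%:R.
Proof.
case: k => [|k]; first by rewrite LL0.
by rewrite /LL ler_pdivrMr ?ltr0Sn// -natrM ler_nat mulnn sigma_lek.
Qed.

(** Lets the logarithm be compared with a geometric series on the minor arcs. *)
Lemma LL_ge1 k : 1 <= LL k.+1.
Proof. by rewrite /LL ler_pdivlMr ?ltr0Sn// mul1r ler_nat sigma_ge. Qed.

Lemma mulr_LL k : k%:R * LL k = (sigma k)%:R.
Proof.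
case: k => [|k]; first by rewrite LL0 mul0r sigma0.
by rewrite /LL mulrC divfK// pnatr_eq0.
Qed.

Lemma LL_summable i y : 0 < y -> abs_summable (fun k => k%:R ^+ i * LL k * ee y k).
Proof.
move=> y0; apply: (abs_summable_le _ (abs_summable_pow_ee i.+1 y0)) => k.
rewrite ger0_norm ?mulr_ge0 ?exprn_ge0 ?LL_ge0 ?ee_ge0//.
by rewrite ler_wpM2r ?ee_ge0// exprSr ler_wpM2l ?exprn_ge0// LL_le.
Qed.

Lemma pp_summable i y : 0 < y -> abs_summable (fun n => n%:R ^+ i * pp n * ee y n).
Proof.
move=> y0; have y2 : 0 < y / 2 by rewrite divr_gt0.
have y4 : 0 < y / 2 / 2 by rewrite divr_gt0.
have [s _] := num_partitions_gf (expRN_itv y2).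
apply: (abs_summable_le _ (abs_summableZ (i`!%:R * (2 / (y / 2)) ^+ i) s)) => n.
rewrite ger0_norm ?mulr_ge0 ?exprn_ge0 ?pp_ge0 ?ee_ge0//.
rewrite -eeX ee_half -/(pp n).
have -> : n%:R ^+ i * pp n * (ee (y / 2) n * ee (y / 2) n) =
  n%:R ^+ i * ee (y / 2) n * (pp n * ee (y / 2) n) by ring.
rewrite ler_wpM2r ?mulr_ge0 ?pp_ge0 ?ee_ge0//.
apply: le_trans (pow_ee_le _ _ y2) _.
rewrite ler_piMr//; first by rewrite mulr_ge0 ?exprn_ge0 ?divr_ge0// ltW.
by rewrite /ee expR_le1 oppr_le0 mulr_ge0// ltW.
Qed.

Lemma FF_ge0 i y : 0 < y -> 0 <= FF i y.
Proof.
move=> y0; apply: Sum_ge0; first exact: LL_summable.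
by move=> k; rewrite !mulr_ge0 ?exprn_ge0 ?LL_ge0 ?ee_ge0.
Qed.

Lemma FF_le i y : 0 < y <= 1 ->
  FF i y <= i.+1`!%:R * 2 ^+ i.+1 * 4 / y ^+ i.+2.
Proof.
move=> y01; have /andP[y0 _] := y01.
apply: le_trans (Sum_pow_ee_le i.+1 y01); apply: le_Sum.
- exact: LL_summable.
- exact: abs_summable_pow_ee.
by move=> k; rewrite ler_wpM2r ?ee_ge0// exprSr ler_wpM2l ?exprn_ge0// LL_le.
Qed.

Lemma PP_prod y : 0 < y ->
  (fun N => \prod_(i < N) (1 - expR (- y) ^+ i.+1)^-1) @ \oo --> PP y.
Proof.
move=> y0; have [_] := num_partitions_gf (expRN_itv y0).
rewrite /PP; under [X in _ -> _ --> X]eq_Sum do rewrite eeX.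
exact.
Qed.

Lemma PP_ge1 y : 0 < y -> 1 <= PP y.
Proof.
move=> y0; have := pp_summable 0 y0; under eq_fun do rewrite expr0 mul1r.
move=> s; have := @term_le_Sum _ _ 0%N s.
rewrite /pp num_partitions0 mul1r /ee mul0r oppr0 expR0; apply.
by move=> k; rewrite mulr_ge0 ?ee_ge0// ler0n.
Qed.

Lemma pp_recE n : n%:R * pp n = conv (fun k => (sigma k)%:R) pp n.
Proof.
rewrite /pp -natrM num_partitions_sigma /conv big_ord_recl/= sigma0 mul0r add0r.
rewrite natr_sum; apply: eq_bigr => k _; rewrite natrM.
by rewrite /bump/= add1n.
Qed.

Lemma pp_rec_ee y n : n%:R * pp n * ee y n =
  conv (fun k => k%:R * LL k * ee y k) (fun n => pp n * ee y n) n.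
Proof.
rewrite pp_recE /conv mulr_suml; apply: eq_bigr => k _.
have -> : ee y n = ee y k * ee y (n - k) by rewrite -eeD subnKC// -ltnS.
by rewrite mulr_LL; ring.
Qed.

Lemma is_derive_FF0 y : 0 < y -> is_derive y 1 (FF 0) (- FF 1 y).
Proof.
move=> y0.
have -> : FF 0 = fun y => Sum (fun k => LL k * ee y k).
  by apply/funext => z; rewrite /FF; apply: eq_Sum => k; rewrite expr0 mul1r.
have -> : - FF 1 y = Sum (fun k => - (k%:R * LL k * ee y k)).
  rewrite /FF -mulN1r -SumZ; last exact: LL_summable.
  by apply: eq_Sum => k; rewrite expr1 mulN1r.
apply: is_derive_exp_series => // z z0.
- by have := LL_summable 0 z0; under eq_fun do rewrite expr0 mul1r.
- by have := LL_summable 1 z0; under eq_fun do rewrite expr1.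
- exact: LL_summable.
Qed.

Lemma is_derive_PP y : 0 < y -> is_derive y 1 PP (- (FF 1 y * PP y)).
Proof.
move=> y0.
have -> : - (FF 1 y * PP y) = Sum (fun k => - (k%:R * pp k * ee y k)).
  have s1 := LL_summable 1 y0; have s2 := pp_summable 0 y0.
  rewrite /FF /PP -mulN1r.
  have -> : Sum (fun n => pp n * ee y n) = Sum (fun n => n%:R ^+ 0 * pp n * ee y n).
    by apply: eq_Sum => n; rewrite expr0 mul1r.
  rewrite -Sum_conv// -SumZ; last exact: abs_summable_conv.
  apply: eq_Sum => n; rewrite pp_rec_ee mulN1r; congr (- _).
  by apply: eq_bigr => k _; rewrite expr0 expr1 mul1r.
apply: is_derive_exp_series => // z z0.
- by have := pp_summable 0 z0; under eq_fun do rewrite expr0 mul1r.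
- by have := pp_summable 1 z0; under eq_fun do rewrite expr1.
- exact: pp_summable.
Qed.

(** The quotient of the two sides has derivative zero and tends to 1 as the argument goes to
    infinity. *)
Lemma PP_exp y : 0 < y -> PP y = expR (FF 0 y).
Proof.
move=> y0; pose G z := PP z * expR (- FF 0 z).
have dG z : 0 < z -> is_derive z 1 G 0.
  move=> z0.
  have d2 : is_derive z 1 (fun z => expR (- FF 0 z)) (expR (- FF 0 z) * FF 1 z).
    have := is_deriveN (is_derive_FF0 z0); rewrite opprK => dN.
    by have := @is_derive1_comp _ expR (- FF 0) z _ _ (is_derive_expR _) dN.
  have := is_deriveM (is_derive_PP z0) d2.
  move=> /trigger_derive; apply.
  by rewrite /GRing.scale/=; ring.
have GE z : y <= z -> G z = G y.
  move=> yz; have [|c _] := @MVT_is_derive _ G (fun=> 0) y z yz.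
    by move=> x /andP[yx _]; apply: dG; exact: lt_le_trans yx.
  by rewrite mul0r => /eqP; rewrite subr_eq0 => /eqP.
(* Both [PP z - 1] and [FF 0 z] are at most [exp(1 - z)] times their bound at 1. *)
pose K := PP 1 + FF 0 1.
have s1 : 0 < 1 :> R by [].
have G1 z : 1 < z -> `|G z - 1| <= expR (1 - z) * K.
  move=> z1; have z0 : 0 < z by apply: lt_trans z1.
  have F1 : FF 0 z <= expR (1 - z) * FF 0 1.
    apply: expRN_vanishing => //.
    - by move=> k; rewrite expr0 mul1r LL_ge0.
    - by rewrite LL0 mulr0.
    - by move=> w w0; exact: LL_summable.
  have P1 : PP z - 1 <= expR (1 - z) * PP 1.
    have sp w : 0 < w -> abs_summable (fun n => pp n * ee w n).
      by move=> w0; have := pp_summable 0 w0; under eq_fun do rewrite expr0 mul1r.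
    (* [pp] with its constant term removed, as [expRN_vanishing] requires. *)
    pose q n : R := if n is n.+1 then pp n.+1 else 0.
    have q0 n : 0 <= q n by case: n => // n; exact: pp_ge0.
    have qE w : 0 < w -> abs_summable (fun n => q n * ee w n) /\
        PP w = 1 + Sum (fun n => q n * ee w n).
      move=> w0.
      have sq : abs_summable (fun n => q n * ee w n).
        apply: (abs_summable_le _ (sp w w0)) => -[|n].
          by rewrite mul0r normr0 mulr_ge0 ?ee_ge0 ?pp_ge0.
        by rewrite ger0_norm// mulr_ge0 ?ee_ge0.
      split=> //; rewrite /PP (Sum_recl (sp w w0)) (Sum_recl sq).
      by rewrite /= mul0r add0r /pp num_partitions0 /ee mul0r oppr0 expR0 mulr1.
    have [sz ->] := qE z z0; have [s ->] := qE 1 s1.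
    rewrite addrC addKr; apply: le_trans (expRN_vanishing q0 _ _ z1) _ => //.
      by move=> w /qE[].
    by rewrite ler_wpM2l ?expR_ge0// lerDr.
  have F0 := FF_ge0 0 z0; have Pz := PP_ge1 z0.
  rewrite /G; have E1 : expR (- FF 0 z) <= 1 by rewrite -expR0 ler_expR oppr_le0.
  have E2 := expR_ge1Dx (- FF 0 z).
  have FP := FF_ge0 0 s1.
  rewrite /K mulrDr ler_norml; apply/andP; split; last first.
    have := expR_ge0 (- FF 0 z); have := expR_ge0 (1 - z) => e1 e2.
    have := mulr_ge0 e1 FP; nra.
  have := mulr_ge0 (expR_ge0 (1 - z)) (le_trans ler01 (PP_ge1 s1)).
  have := expR_ge0 (- FF 0 z); nra.
have Gy : G y = 1.
  apply/eqP; rewrite -subr_eq0 -normr_le0; apply/ler_addgt0Pr => e e0; rewrite add0r.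
  have K0 : 0 <= K by rewrite /K addr_ge0 ?FF_ge0// (le_trans ler01)// PP_ge1.
  (* Far enough to the right that [exp(z - 1) >= z >= K / e]. *)
  pose z := y + 2 + K / e.
  have yz : y <= z by rewrite /z -addrA lerDl addr_ge0// divr_ge0// ltW.
  have Ke : 0 <= K / e by rewrite divr_ge0// ltW.
  have z1 : 1 < z by rewrite /z; lra.
  rewrite -(GE z yz); apply: le_trans (G1 z z1) _.
  have := expR_ge1Dx (z - 1); rewrite -[1 - z]opprB expRN => H.
  rewrite mulrC ler_pdivrMr ?expR_gt0//.
  have H2 : K / e <= expR (z - 1) by apply: le_trans H; rewrite /z; lra.
  by move: H2; rewrite ler_pdivrMr// mulrC.
by move: Gy; rewrite /G expRN => /divr1_eq.
Qed.

(* [AA + i BB] and [CC + i DD] are the generating function and its logarithm at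
   [exp (- y + i t)], split into real and imaginary parts. *)
Definition AA y t : R := Sum (fun n => pp n * ee y n * cos_shift 0 (n%:R * t)).
Definition BB y t : R := Sum (fun n => pp n * ee y n * cos_shift 3 (n%:R * t)).
Definition CC y t : R := Sum (fun k => LL k * ee y k * cos_shift 0 (k%:R * t)).
Definition DD y t : R := Sum (fun k => LL k * ee y k * cos_shift 3 (k%:R * t)).

Lemma cos_shift1 x : cos_shift 1 x = - cos_shift 3 x.
Proof. by rewrite cos_shift3 /cos_shift mul1r cosDpihalf. Qed.

Lemma cos_shift4 x : cos_shift 4 x = cos_shift 0 x.
Proof.
rewrite cos_shift0 /cos_shift (_ : x + 4%:R * (pi / 2) = x + pi *+ 2) ?cosD2pi//.
by rewrite -mulr_natr; field.
Qed.

(** The [t]-derivative of [CC + i DD] is [i (TT + i SS)]. *)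
Definition SS y t : R := Sum (fun k => k%:R * LL k * ee y k * cos_shift 3 (k%:R * t)).
Definition TT y t : R := Sum (fun k => k%:R * LL k * ee y k * cos_shift 0 (k%:R * t)).

Lemma abs_summable_trig a i t : abs_summable a ->
  abs_summable (fun k => a k * cos_shift i (k%:R * t)).
Proof.
move=> sa; apply: (abs_summable_le _ (abs_summable_norm sa)) => k.
by rewrite normrM ler_piMr// cos_max.
Qed.

Lemma is_derive_CC y t : 0 < y -> is_derive t 1 (CC y) (- SS y t).
Proof.
move=> y0.
have := @is_derive_trig_series _ (fun k => LL k * ee y k) 0 t.
have E : Sum (fun k => k%:R * (LL k * ee y k) * cos_shift 1 (k%:R * t)) = - SS y t.
  rewrite -mulN1r -SumZ; last first.
    by have := LL_summable 1 y0; under eq_fun do rewrite expr1; exact: abs_summable_trig.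
  by apply: eq_Sum => k; rewrite cos_shift1; ring.
rewrite E; apply.
by have := LL_summable 2 y0; under eq_fun do rewrite -mulrA.
Qed.

Lemma is_derive_DD y t : 0 < y -> is_derive t 1 (DD y) (TT y t).
Proof.
move=> y0.
have := @is_derive_trig_series _ (fun k => LL k * ee y k) 3 t.
have E : Sum (fun k => k%:R * (LL k * ee y k) * cos_shift 4 (k%:R * t)) = TT y t.
  by apply: eq_Sum => k; rewrite cos_shift4 mulrA.
rewrite E; apply.
by have := LL_summable 2 y0; under eq_fun do rewrite -mulrA.
Qed.

Lemma Sum_sigma_conv y t (c d : nat) : 0 < y ->
  abs_summable (conv (fun k => k%:R * LL k * ee y k * cos_shift c (k%:R * t))
    (fun n => pp n * ee y n * cos_shift d (n%:R * t))) /\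
  Sum (conv (fun k => k%:R * LL k * ee y k * cos_shift c (k%:R * t))
    (fun n => pp n * ee y n * cos_shift d (n%:R * t))) =
  Sum (fun k => k%:R * LL k * ee y k * cos_shift c (k%:R * t)) *
  Sum (fun n => pp n * ee y n * cos_shift d (n%:R * t)).
Proof.
move=> y0.
have s1 : abs_summable (fun k => k%:R * LL k * ee y k * cos_shift c (k%:R * t)).
  by have := LL_summable 1 y0; under eq_fun do rewrite expr1; exact: abs_summable_trig.
have s2 : abs_summable (fun n => pp n * ee y n * cos_shift d (n%:R * t)).
  by have := pp_summable 0 y0; under eq_fun do rewrite expr0 mul1r; exact: abs_summable_trig.
by split; [exact: abs_summable_conv|exact: Sum_conv].
Qed.

(** The recursion [pp_rec_ee] with the addition formula for [n t = k t + (n - k) t]: the real and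
    imaginary parts of the derivative of a generating function are those of a product of two
    series. *)
Lemma is_derive_AA y t : 0 < y ->
  is_derive t 1 (AA y) (- (SS y t * AA y t + TT y t * BB y t)).
Proof.
move=> y0.
have := @is_derive_trig_series _ (fun k => pp k * ee y k) 0 t.
have [sa Sa] := Sum_sigma_conv t 3 0 y0; have [sb Sb] := Sum_sigma_conv t 0 3 y0.
have E : Sum (fun k => k%:R * (pp k * ee y k) * cos_shift 1 (k%:R * t)) =
    - (SS y t * AA y t + TT y t * BB y t).
  rewrite /SS /TT /AA /BB -Sa -Sb -SumD// -mulN1r -SumZ; last exact: abs_summableD.
  apply: eq_Sum => n; rewrite mulrA pp_rec_ee cos_shift1 mulrN mulN1r; congr (- _).
  rewrite /conv -big_split/= mulr_suml; apply: eq_bigr => k _.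
  have kn : (k <= n)%N by rewrite -ltnS.
  have -> : n%:R * t = k%:R * t + (n - k)%N%:R * t by rewrite natrB//; ring.
  by rewrite !cos_shift3 !cos_shift0 sinD; ring.
rewrite E; apply.
by have := pp_summable 2 y0; under eq_fun do rewrite -mulrA.
Qed.

Lemma is_derive_BB y t : 0 < y ->
  is_derive t 1 (BB y) (TT y t * AA y t - SS y t * BB y t).
Proof.
move=> y0.
have := @is_derive_trig_series _ (fun k => pp k * ee y k) 3 t.
have [sa Sa] := Sum_sigma_conv t 0 0 y0; have [sb Sb] := Sum_sigma_conv t 3 3 y0.
have E : Sum (fun k => k%:R * (pp k * ee y k) * cos_shift 4 (k%:R * t)) =
    TT y t * AA y t - SS y t * BB y t.
  rewrite /SS /TT /AA /BB -Sa -Sb -SumB//.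
  apply: eq_Sum => n; rewrite mulrA pp_rec_ee cos_shift4.
  rewrite /conv -sumrB mulr_suml; apply: eq_bigr => k _.
  have kn : (k <= n)%N by rewrite -ltnS.
  have -> : n%:R * t = k%:R * t + (n - k)%N%:R * t by rewrite natrB//; ring.
  by rewrite !cos_shift3 !cos_shift0 cosD; ring.
rewrite E; apply.
by have := pp_summable 2 y0; under eq_fun do rewrite -mulrA.
Qed.

Lemma series_at0 :
  (forall y, AA y 0 = PP y) /\ (forall y, BB y 0 = 0) /\ (forall y, DD y 0 = 0).
Proof.
split; first by move=> y; apply: eq_Sum => n; rewrite mulr0 cos_shift0 cos0 mulr1.
split=> y; rewrite -[RHS]Sum0; apply: eq_Sum => n;
  by rewrite mulr0 cos_shift3 sin0 mulr0.
Qed.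

(* Rotating [AA + i BB] back by [exp (CC + i DD)] gives a constant, since both have the
   same logarithmic derivative [- SS + i TT]. *)
Lemma AA_BB_polar y t : 0 < y ->
  AA y t = PP y * expR (CC y t - CC y 0) * cos (DD y t) /\
  BB y t = PP y * expR (CC y t - CC y 0) * sin (DD y t).
Proof.
move=> y0; have [A0 [B0 D0]] := series_at0.
pose E s := expR (- CC y s).
have dE s : is_derive s 1 E (E s * SS y s).
  have := is_deriveN (is_derive_CC s y0); rewrite opprK => dN.
  by have := @is_derive1_comp _ expR (- CC y) s _ _ (is_derive_expR _) dN.
pose cD s := cos (DD y s); pose sD s := sin (DD y s).
have dcD s : is_derive s 1 cD (- sD s * TT y s).
  exact: (@is_derive1_comp _ cos (DD y) s _ _ (is_derive_cos _) (is_derive_DD s y0)).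
have dsD s : is_derive s 1 sD (cD s * TT y s).
  exact: (@is_derive1_comp _ sin (DD y) s _ _ (is_derive_sin _) (is_derive_DD s y0)).
have dA s := is_derive_AA s y0.
have dB s := is_derive_BB s y0.
pose U := E * (AA y * cD + BB y * sD).
pose V := E * (BB y * cD - AA y * sD).
have dU s : is_derive s 1 U 0.
  have := is_deriveM (dE s)
    (is_deriveD (is_deriveM (dA s) (dcD s)) (is_deriveM (dB s) (dsD s))).
  move=> /trigger_derive; apply.
  by rewrite /GRing.scale/= !fctE; ring.
have dV s : is_derive s 1 V 0.
  have := is_deriveM (dE s)
    (is_deriveB (is_deriveM (dB s) (dcD s)) (is_deriveM (dA s) (dsD s))).
  move=> /trigger_derive; apply.
  by rewrite /GRing.scale/= !fctE; ring.
have := is_derive0_cst t 0 dU; have := is_derive0_cst t 0 dV.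
rewrite /U /V !fctE /E /cD /sD A0 B0 D0 cos0 sin0 !mulr0 !mul0r subr0 addr0 mulr0 mulr1.
rewrite !expRN => V0 U0.
have e1 := expR_gt0 (CC y t); have e0 := expR_gt0 (CC y 0).
have cs := cos2Dsin2 (DD y t).
have {}V0 : BB y t * cos (DD y t) = AA y t * sin (DD y t).
  by apply/eqP; rewrite -subr_eq0; move/eqP: V0; rewrite mulf_eq0 invr_eq0 gt_eqF.
have {}U0 : AA y t * cos (DD y t) + BB y t * sin (DD y t) =
    PP y * expR (CC y t - CC y 0).
  have : expR (CC y t) * ((expR (CC y t))^-1 *
    (AA y t * cos (DD y t) + BB y t * sin (DD y t))) =
    expR (CC y t) * ((expR (CC y 0))^-1 * PP y) by rewrite U0.
  by rewrite mulVKf ?gt_eqF// => ->; rewrite expRB; ring.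
(* Multiplying by [cos^2 + sin^2 = 1] inverts the rotation; [V0] exchanges the mixed products. *)
rewrite -U0; split.
  rewrite -[LHS]mulr1 -cs !expr2.
  by rewrite mulrDl [_ * sin _ * cos _]mulrAC V0; ring.
rewrite -[LHS]mulr1 -cs !expr2.
by rewrite mulrDr mulrA V0; ring.
Qed.

End partition_series.

(** * Gauss's identity and the theta sum *)

Section gauss_triangular.
Context {R : realType}.
Implicit Types (q x y z : R).

Definition tri (s : nat) : nat := (s * s.+1)./2.
Arguments tri : simpl never.

Lemma tri_double n : tri n.*2 = (n * n.*2.+1)%N.
Proof. by rewrite /tri -doubleMl doubleK. Qed.

Lemma tri_doubleS n : tri n.*2.+1 = (n.+1 * n.*2.+1)%N.
Proof. by rewrite /tri -doubleS -doubleMr doubleK mulnC. Qed.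

Definition evenodd_prod q n : R :=
  \prod_(j < n) ((1 - q ^+ j.*2.+2) / (1 - q ^+ j.*2.+1)).

Lemma evenodd_prod_gt0 q n : 0 <= q < 1 -> 0 < evenodd_prod q n.
Proof.
move=> /andP[q0 q1]; apply: prodr_gt0 => j _.
by rewrite divr_gt0 ?subr_gt0 ?exprn_ilt1.
Qed.

(** The finite form, due to Shanks, of Gauss's identity: it can be proved by induction, and its
    right-hand side is dominated by the term [s = 0]. *)
Lemma shanks q n : 0 <= q < 1 ->
  \sum_(s < n.*2) q ^+ tri s =
  \sum_(s < n) evenodd_prod q n / evenodd_prod q s * q ^+ (s * n.*2.+1).
Proof.
move=> q01; have /andP[q0 q1] := q01.
have P0 m : evenodd_prod q m != 0 by rewrite gt_eqF// evenodd_prod_gt0.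
have q1n m : 1 - q ^+ m.+1 != 0 by rewrite gt_eqF// subr_gt0 exprn_ilt1.
have PS m : evenodd_prod q m.+1 =
    evenodd_prod q m * ((1 - q ^+ m.*2.+2) / (1 - q ^+ m.*2.+1)).
  by rewrite /evenodd_prod big_ord_recr.
elim: n => [|n IH]; first by rewrite !big_ord0.
rewrite doubleS big_ord_recr/= big_ord_recr/= IH [in RHS]big_ord_recr/=.
rewrite tri_double tri_doubleS.
(* A telescoping certificate: passing from [n] to [n.+1] changes the [s]-th summand by
   [G s.+1 - G s]. [G 0] vanishes, and [G n] with the new summand [s = n] gives the two new
   triangular powers. *)
pose G s := evenodd_prod q n / evenodd_prod q s * q ^+ (s * n.*2.+1) *
  (1 - q ^+ s.*2) / (1 - q ^+ n.*2.+1).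
have H s : evenodd_prod q n.+1 / evenodd_prod q s * q ^+ (s * n.*2.+3) =
    evenodd_prod q n / evenodd_prod q s * q ^+ (s * n.*2.+1) + (G s.+1 - G s).
  have -> : (s * n.*2.+3 = s * n.*2.+1 + s.*2)%N by lia.
  rewrite /G !PS doubleS mulSn !exprD.
  have -> : q ^+ n.*2.+2 = q ^+ n.*2.+1 * q by rewrite exprSr.
  have -> : q ^+ s.*2.+2 = q ^+ s.*2.+1 * q by rewrite exprSr.
  have := q1n n.*2; have := q1n s.*2; have := q1n s.*2.+1.
  rewrite [q ^+ s.*2.+2]exprSr [q ^+ s.*2.+1]exprSr.
  move: (q ^+ n.*2.+1) (q ^+ s.*2) (q ^+ (s * n.*2.+1)) (evenodd_prod q n)
    (evenodd_prod q s) (P0 n) (P0 s).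
  move=> a b c P Q P1 Q1 h1 h2 h3; field.
  by rewrite h1 h2 h3 Q1.
rewrite (eq_bigr _ (fun s _ => H (nat_of_ord s))) big_split/= -!addrA; congr (_ + _).
rewrite -(big_mkord xpredT (fun s => G s.+1 - G s)) telescope_sumr//.
have -> : G 0%N = 0 by rewrite /G double0 expr0 subrr mulr0 mul0r.
rewrite subr0 /G PS.
have -> : (n * n.*2.+3 = n * n.*2.+1 + n.*2)%N by lia.
have -> : (n.+1 * n.*2.+1 = n * n.*2.+1 + n.*2.+1)%N by lia.
rewrite !exprD; have := q1n n.*2; have := P0 n.
rewrite [q ^+ n.*2.+2]exprSr [q ^+ n.*2.+1]exprSr.
move: (q ^+ n.*2) (q ^+ (n * n.*2.+1)) (evenodd_prod q n) => a b P P1 h.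
by field; rewrite h P1.
Qed.

(** Supplying the missing even factors gives a quotient of truncated generating functions at [q] and
    [q^2], hence [PP y / PP (2 * y) ^+ 2] in the limit. *)
Lemma evenodd_prodE q n : 0 <= q < 1 -> evenodd_prod q n =
  (\prod_(i < n.*2) (1 - q ^+ i.+1)^-1) / (\prod_(i < n) (1 - (q ^+ 2) ^+ i.+1)^-1) ^+ 2.
Proof.
move=> /andP[q0 q1].
have q1n m : 1 - q ^+ m.+1 != 0 by rewrite gt_eqF// subr_gt0 exprn_ilt1.
elim: n => [|n IH].
  by rewrite /evenodd_prod double0 !big_ord0 expr1n divr1.
rewrite /evenodd_prod big_ord_recr/= -/(evenodd_prod q n) IH doubleS !big_ord_recr/=.
rewrite -exprM mul2n doubleS.
have := q1n n.*2; have := q1n n.*2.+1.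
have : \prod_(i < n) (1 - (q ^+ 2) ^+ i.+1)^-1 != 0.
  apply/prodf_neq0 => i _; rewrite invr_eq0 -exprM mul2n doubleS; exact: q1n.
move: (\prod_(i < n) _) (\prod_(i < n.*2) _) (q ^+ n.*2.+1) (q ^+ n.*2.+2) => a b c d a0.
by move=> d0 c0; field; rewrite a0 c0 d0.
Qed.

Lemma gauss_triangular y : 0 < y ->
  (fun n => \sum_(s < n.*2) expR (- y) ^+ tri s) @ \oo -->
  expR (FF 0 y - 2 * FF 0 (2 * y)).
Proof.
move=> y0; have y20 : 0 < 2 * y by rewrite mulr_gt0.
have q01 := expRN_itv y0; have /andP[q0 q1] := q01.
set q := expR (- y) in q01 q0 q1 *.
have c1 := PP_prod y0; have c2 := PP_prod y20; rewrite -/q in c1.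
have qq : expR (- (2 * y)) = q ^+ 2 by rewrite /q -expRM_natl mulrN.
rewrite qq in c2.
have cP : evenodd_prod q @ \oo --> expR (FF 0 y - 2 * FF 0 (2 * y)).
  have -> : expR (FF 0 y - 2 * FF 0 (2 * y)) = PP y / PP (2 * y) ^+ 2.
    by rewrite !PP_exp// expRB expRM_natl.
  have -> : evenodd_prod q = (fun n => (\prod_(i < n.*2) (1 - q ^+ i.+1)^-1) /
      (\prod_(i < n) (1 - (q ^+ 2) ^+ i.+1)^-1) ^+ 2).
    by apply/funext => n; rewrite evenodd_prodE.
  apply: cvgM.
    apply: (cvg_comp _ _ _ c1).
    move=> A [N _ NA]; exists N => // n /= Nn; apply: NA => /=.
    by rewrite (leq_trans Nn)// -addnn leq_addr.
  apply: cvgV; last by apply: cvgM.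
  by rewrite expf_neq0// gt_eqF// (lt_le_trans ltr01)// PP_ge1.
have cE : (fun n => evenodd_prod q n * (1 + q ^+ n / (1 - q))) @ \oo -->
    expR (FF 0 y - 2 * FF 0 (2 * y)).
  rewrite -[X in _ --> X]mulr1; apply: cvgM => //.
  rewrite -[X in _ --> X]addr0; apply: cvgD; first exact: cvg_cst.
  rewrite -(mul0r (1 - q)^-1); apply: cvgM; last exact: cvg_cst.
  by apply: cvg_expr; rewrite ger0_norm.
apply: squeeze_cvgr cP cE; near=> n.
have n0 : (0 < n)%N by near: n; exists 1%N.
rewrite (shanks _ q01).
have Ppos m : 0 < evenodd_prod q m by exact: evenodd_prod_gt0.
have P1 m : 1 <= evenodd_prod q m.
  rewrite /evenodd_prod; elim/big_ind: _ => //[x z x1 z1|j _]; first by rewrite mulr_ege1.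
  rewrite ler_pdivlMr ?subr_gt0 ?exprn_ilt1// mul1r lerD2l lerN2.
  by rewrite exprS ler_piMl ?exprn_ge0// ltW.
have [m ->] : exists m, n = m.+1 by exists n.-1; rewrite prednK.
have P00 : evenodd_prod q 0 = 1 by rewrite /evenodd_prod big_ord0.
(* The term [s = 0] is the product itself. The others sum to at most the product times
   [q^n / (1 - q)], as every [evenodd_prod] is at least 1. *)
rewrite big_ord_recl/= P00 divr1 mul0n expr0 mulr1.
apply/andP; split.
  by rewrite lerDl sumr_ge0// => i _; rewrite mulr_ge0 ?exprn_ge0// divr_ge0 ?(ltW (Ppos _)).
rewrite mulrDr mulr1 lerD2l.
apply: (@le_trans _ _ (\sum_(i < m) evenodd_prod q m.+1 * (q ^+ m.+1 * q ^+ i))).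
  apply: ler_sum => i _; apply: ler_pM; rewrite ?exprn_ge0//.
  - by rewrite divr_ge0 ?(ltW (Ppos _)).
  - by rewrite ler_pdivrMr// ler_peMr// ltW.
  - by rewrite -exprD ler_wiXn2l// ?(ltW q1)// /bump/=; nia.
rewrite -mulr_sumr ler_wpM2l ?(ltW (Ppos _))// -mulr_sumr ler_wpM2l ?exprn_ge0//.
have r1' : 0 < 1 - q by rewrite subr_gt0.
have H : (1 - q) * (\sum_(i < m) q ^+ i) = 1 - q ^+ m.
  by apply: oppr_inj; rewrite -mulNr !opprB subrX1.
by rewrite -[leRHS]mulr1 ler_pdivlMl// H lerBlDr lerDl exprn_ge0.
Unshelve. all: by end_near. Qed.

End gauss_triangular.

(** * The theta sum compared with its integral *)

Section gaussian_sum.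
Context {R : realType}.
Implicit Types (x y z u v s d : R).

Lemma poly_gauss_bounded (p : {poly R}) : exists2 C : R, 0 <= C &
  forall u, `|p.[u]| * expR (- (u ^+ 2 / 2)) <= C.
Proof.
pose C := \sum_(i < size p) `|p`_i| * (1 + i`!%:R * 2 ^+ i).
exists C; first by apply: sumr_ge0 => i _; rewrite mulr_ge0// addr_ge0// mulr_ge0 ?exprn_ge0.
move=> u; rewrite horner_coef.
apply: le_trans (ler_wpM2r (expR_ge0 _) (ler_norm_sum _ _ _)) _.
rewrite mulr_suml; apply: ler_sum => i _.
rewrite normrM -mulrA ler_wpM2l// normrX.
have u2 : 0 <= u ^+ 2 / 2 by rewrite divr_ge0// sqr_ge0.
have := pow_expR_le i u2; rewrite expRN ler_pdivrMr ?expR_gt0// => H.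
have E1 : 1 <= expR (u ^+ 2 / 2) by have := expR_ge1Dx (u ^+ 2 / 2); lra.
have {}H : (`|u| ^+ i) ^+ 2 <= i`!%:R * 2 ^+ i * expR (u ^+ 2 / 2).
  have -> : (`|u| ^+ i) ^+ 2 = 2 ^+ i * (u ^+ 2 / 2) ^+ i.
    rewrite -exprMn -exprM mulnC exprM real_normK ?num_real//.
    by congr (_ ^+ i); field.
  rewrite -mulrA [leRHS]mulrCA; apply: ler_wpM2l => //.
rewrite mulrDl mul1r.
have w0 : 0 <= `|u| ^+ i by rewrite exprn_ge0.
(* [H] bounds the square of [|u|^i]: beyond 1 the power is at most its square, below 1 it is at most
   the exponential. *)
have [w1|w1] := leP (`|u| ^+ i) 1.
  have : 0 <= i`!%:R * 2 ^+ i * expR (u ^+ 2 / 2).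
    by rewrite !mulr_ge0 ?expR_ge0 ?exprn_ge0.
  lra.
by nra.
Qed.

(** [(-1)^j] times the probabilists' Hermite polynomial, so that [hg j] is the [j]-th derivative of
    [exp(-u^2/2)]. *)
Fixpoint herm (j : nat) : {poly R} :=
  if j is j.+1 then (herm j)^`() - 'X * herm j else 1.

Definition hg j u : R := (herm j).[u] * expR (- (u ^+ 2 / 2)).

Lemma is_derive_hg j u : is_derive u 1 (hg j) (hg j.+1 u).
Proof.
have d1 : is_derive u 1 (fun u => - (u ^+ 2 / 2)) (- u).
  have -> : (fun u => - (u ^+ 2 / 2)) = horner (- (2^-1 *: 'X^2)).
    by apply/funext => z; rewrite hornerN hornerZ hornerXn mulrC.
  have -> : - u = (- (2^-1 *: 'X^2))^`().[u].
    rewrite derivN derivZ derivXn hornerN hornerZ hornerMn hornerX.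
    by rewrite -mulr_natr; field.
  exact: is_derive_poly.
have d2 := @is_derive1_comp _ expR _ u _ _ (is_derive_expR _) d1.
have := is_deriveM (is_derive_poly (herm j) u) d2.
move=> /trigger_derive; apply.
by rewrite /hg /= /GRing.scale/= hornerD hornerN hornerM hornerX; ring.
Qed.

Lemma hg_bound j : exists2 C : R, 0 <= C & forall u, `|hg j u| <= C / (1 + u ^+ 2).
Proof.
have [C C0 HC] := poly_gauss_bounded (herm j * (1 + 'X^2)).
exists C => // u; rewrite ler_pdivlMr; last by rewrite ltr_pwDl// sqr_ge0.
apply: le_trans (HC u); rewrite /hg hornerM !normrM (ger0_norm (expR_ge0 _)).
have u1 : 0 <= 1 + u ^+ 2 by rewrite addr_ge0 ?sqr_ge0.
rewrite hornerD hornerXn hornerC (ger0_norm u1).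
by rewrite le_eqVlt; apply/orP; left; apply/eqP; ring.
Qed.

(** A telescoping majorant: with the constant 3 the induction step leaves the numerator
    [(2N - 1)(N - 1)], nonnegative at every natural number. *)
Lemma sum_inv_sqr_le N : \sum_(a < N) (1 + a%:R ^+ 2)^-1 <= 3 - 3 / N.+1%:R :> R.
Proof.
elim: N => [|N IH]; first by rewrite big_ord0 divr1 subrr.
rewrite big_ord_recr/=; apply: le_trans (lerD IH (lexx _)) _.
rewrite -addrA lerD2l lerNr opprD opprK lerBrDr.
have N0 : 0 <= N%:R :> R by [].
rewrite -(natr1 N.+1) -(natr1 N).
have h1 : 0 < 1 + N%:R ^+ 2 :> R by rewrite ltr_pwDl// sqr_ge0.
have h2 : 0 < N%:R + 1 :> R by lra.
have h3 : 0 < N%:R + 1 + 1 :> R by lra.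
rewrite -subr_ge0.
have -> : 3 / (N%:R + 1) - (3 / (N%:R + 1 + 1) + (1 + N%:R ^+ 2)^-1) =
  (2 * N%:R - 1) * (N%:R - 1) / ((N%:R + 1) * (N%:R + 1 + 1) * (1 + N%:R ^+ 2)) :> R.
  by field; rewrite !gt_eqF.
have den : 0 <= (N%:R + 1) * (N%:R + 1 + 1) * (1 + N%:R ^+ 2) :> R.
  by apply/ltW; rewrite !mulr_gt0.
apply: divr_ge0 => //.
case: N {IH N0 h1 h2 h3 den} => [|N]; first by rewrite mulr0; lra.
by rewrite -natr1; have N0 : 0 <= N%:R :> R by []; nra.
Qed.

(** A symmetric truncation of the sum of [hg j] over the lattice [v (Z + s)], which would be
    1-periodic in [s]. *)
Definition shift_sum j v N s : R := \sum_(i < N + N) hg j (v * (i%:R - N%:R + s)).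

Lemma is_derive_shift_sum j v N s :
  is_derive s 1 (shift_sum j v N) (v * shift_sum j.+1 v N s).
Proof.
rewrite /shift_sum mulr_sumr.
have -> : (fun s => \sum_(i < N + N) hg j (v * (i%:R - N%:R + s))) =
    \sum_(i < N + N) (fun s => hg j (v * (i%:R - N%:R + s))).
  by apply/funext => z; rewrite fct_sumE.
apply: is_derive_sum => i.
have d1 : is_derive s 1 (fun s => v * (i%:R - N%:R + s)) v.
  have := is_deriveZ v (is_deriveD (is_derive_cst (i%:R - N%:R : R) s 1) (is_derive_id s 1)).
  by move=> /trigger_derive; apply; rewrite /GRing.scale/= add0r mulr1.
have := @is_derive1_comp _ (hg j) _ s _ _ (is_derive_hg j _) d1.
by move=> /trigger_derive; apply; rewrite mulrC.
Qed.

(** Uniform in [N]. The loss [v^(-2)], from [1 + (v u)^2 >= v^2 (1 + a^2)], is harmless because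
    [shift_sum_small] gains any power of [v]. *)
Lemma shift_sum_bound j : exists2 C : R, 0 <= C & forall v N s, 0 < v <= 1 -> 0 <= s <= 1 ->
  `|shift_sum j v N s| <= C / v ^+ 2.
Proof.
have [C C0 HC] := hg_bound j; exists (6 * C); first by rewrite mulr_ge0.
move=> v N s /andP[v0 v1] /andP[s0 s1].
have T u (a : nat) : a%:R ^+ 2 <= u ^+ 2 ->
    `|hg j (v * u)| <= C / v ^+ 2 * (1 + a%:R ^+ 2)^-1.
  move=> au; apply: le_trans (HC _) _.
  have h1 : 0 < 1 + (v * u) ^+ 2 by rewrite ltr_pwDl// sqr_ge0.
  have h2 : 0 < v ^+ 2 * (1 + a%:R ^+ 2).
    by rewrite mulr_gt0 ?exprn_gt0// ltr_pwDl// sqr_ge0.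
  rewrite -mulrA ler_wpM2l// -invfM lef_pV2 ?posrE//.
  rewrite mulrDr mulr1 exprMn lerD//; first by rewrite exprn_ile1// ltW.
  by rewrite ler_wpM2l// sqr_ge0.
have S3 : \sum_(a < N) (1 + a%:R ^+ 2)^-1 <= 3 :> R.
  by apply: le_trans (sum_inv_sqr_le N) _; rewrite lerBlDr lerDl divr_ge0.
have V0 : 0 <= C / v ^+ 2 by rewrite divr_ge0// sqr_ge0.
rewrite /shift_sum big_split_ord/=; apply: le_trans (ler_normD _ _) _.
have -> : 6 * C / v ^+ 2 = C / v ^+ 2 * 3 + C / v ^+ 2 * 3 by rewrite -mulrA; ring.
apply: lerD; apply: le_trans (ler_norm_sum _ _ _) _.
  apply: (@le_trans _ _ (\sum_(i < N) C / v ^+ 2 * (1 + (N - i.+1)%N%:R ^+ 2)^-1)).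
    apply: ler_sum => i _; apply: T.
    rewrite natrB// -natr1.
    have : i%:R + 1 <= N%:R :> R by rewrite natr1 ler_nat.
    move=> H; have : 0 <= N%:R - (i%:R + 1) :> R by lra.
    by nra.
  rewrite -mulr_sumr ler_wpM2l//; apply: le_trans S3.
  rewrite (reindex_inj rev_ord_inj)/=.
  apply: ler_sum => i _; rewrite (_ : (N - (N - i.+1).+1 = i)%N)//.
  by have := ltn_ord i; lia.
apply: (@le_trans _ _ (\sum_(i < N) C / v ^+ 2 * (1 + i%:R ^+ 2)^-1)).
  apply: ler_sum => i _; apply: T; rewrite natrD.
  have -> : N%:R + i%:R - N%:R + s = i%:R + s by ring.
  by rewrite lerXn2r ?nnegrE ?addr_ge0// lerDl.
by rewrite -mulr_sumr ler_wpM2l.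
Qed.

Lemma shift_sum_boundary j v N :
  shift_sum j v N 1 - shift_sum j v N 0 = hg j (v * N%:R) - hg j (- (v * N%:R)).
Proof.
have E i : hg j (v * (i%:R - N%:R + 1)) = hg j (v * (i.+1%:R - N%:R + 0)).
  by congr (hg j (_ * _)); rewrite -natr1; ring.
rewrite /shift_sum (eq_bigr _ (fun i _ => E (nat_of_ord i))) -sumrB.
rewrite -(big_mkord xpredT (fun i => hg j (v * (i.+1%:R - N%:R + 0)) - hg j (v * (i%:R - N%:R + 0)))).
rewrite telescope_sumr// natrD addr0 addrK; congr (_ - hg j _).
by rewrite sub0r addr0 mulrN.
Qed.

Lemma hg_vanish j v d : 0 < v -> 0 < d -> exists N0, forall N, (N0 <= N)%N ->
  `|hg j (v * N%:R) - hg j (- (v * N%:R))| <= d.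
Proof.
move=> v0 d0; have [C C0 HC] := hg_bound j.
have [N0 HN0] : exists N0 : nat, 2 * C / (d * v ^+ 2) < N0%:R.
  exists (Num.bound (2 * C / (d * v ^+ 2))).
  by apply: archi_boundP; rewrite divr_ge0 ?mulr_ge0 ?sqr_ge0// ltW.
exists N0.+1 => N NN0; apply: le_trans (ler_normB _ _) _.
have N1 : 1 <= N%:R :> R by rewrite ler1n; lia.
have NN : N0%:R <= N%:R :> R by rewrite ler_nat ltnW.
have v2 : 0 < v ^+ 2 by rewrite exprn_gt0.
apply: le_trans (lerD (HC _) (HC _)) _; rewrite sqrrN.
have -> : C / (1 + (v * N%:R) ^+ 2) + C / (1 + (v * N%:R) ^+ 2) =
  2 * C / (1 + (v * N%:R) ^+ 2) by rewrite -mulrA; ring.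
rewrite ler_pdivrMr; last by rewrite ltr_pwDl// sqr_ge0.
have := lt_le_trans HN0 NN; rewrite ltr_pdivrMr ?mulr_gt0// exprMn => H.
apply: le_trans (ltW H) _.
rewrite [N%:R * _]mulrC -mulrA ler_wpM2l ?(ltW d0)//.
have : v ^+ 2 * N%:R <= v ^+ 2 * N%:R ^+ 2 by rewrite ler_wpM2l ?(ltW v2)// expr2 ler_peMl//; lra.
lra.
Qed.

(* A derivative of a periodic function vanishes somewhere, so it is bounded by the next
   one; each step gains a factor [v]. The finite sums are periodic up to [d]. *)
Lemma shift_sum_small m j : exists2 C : R, 0 <= C & forall v d, 0 < v <= 1 -> 0 < d ->
  exists N0, forall N s, (N0 <= N)%N -> 0 <= s <= 1 ->
  `|shift_sum j.+1 v N s| <= C * v ^+ m / v ^+ 2 + d.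
Proof.
elim: m j => [|m IH] j.
  have [C C0 HC] := shift_sum_bound j.+1; exists C => // v d v01 d0; exists 0%N.
  move=> N s _ s01; rewrite expr0 mulr1; apply: le_trans (HC _ _ _ v01 s01) _.
  by rewrite lerDl ltW.
have [C C0 HC] := IH j.+1; exists C => // v d v01 d0.
have /andP[v0 v1] := v01; have d2 : 0 < d / 2 by rewrite divr_gt0.
have [N1 H1] := HC v (d / 2) v01 d2.
have [N2 H2] := hg_vanish j v0 (mulr_gt0 v0 d2).
exists (N1 + N2)%N => N s NN s01.
have NN1 : (N1 <= N)%N by rewrite (leq_trans (leq_addr _ _) NN).
have NN2 : (N2 <= N)%N by rewrite (leq_trans (leq_addl _ _) NN).
have [x x01] := MVT_is_derive ler01 (fun z _ => is_derive_shift_sum j v N z).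
rewrite subr0 mulr1 shift_sum_boundary => Ex.
have x1 : `|shift_sum j.+1 v N x| <= d / 2.
  have := H2 N NN2; rewrite Ex normrM (ger0_norm (ltW v0)).
  by rewrite ler_pM2l.
have L a b : 0 <= a <= 1 -> 0 <= b <= 1 -> a <= b ->
    `|shift_sum j.+1 v N b - shift_sum j.+1 v N a| <= C * v ^+ m.+1 / v ^+ 2 + d / 2.
  move=> /andP[a0 a1] /andP[b0 b1] ab.
  have [c /andP[ac cb] ->] := MVT_is_derive ab (fun z _ => is_derive_shift_sum j.+1 v N z).
  have c01 : 0 <= c <= 1 by rewrite (le_trans a0 ac) (le_trans cb b1).
  have := H1 N c NN1 c01; set S := shift_sum _ _ _ _ => HS.
  rewrite !normrM (ger0_norm (ltW v0)) [`|b - a|]ger0_norm ?subr_ge0//.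
  have ba1 : b - a <= 1 by lra.
  apply: (@le_trans _ _ (v * `|S|)); first by rewrite ler_piMr// mulr_ge0// ltW.
  apply: le_trans (ler_wpM2l (ltW v0) HS) _.
  rewrite mulrDr [v ^+ m.+1]exprS lerD//; last by rewrite ler_piMl// ltW.
  by rewrite le_eqVlt; apply/orP; left; apply/eqP; ring.
rewrite -[shift_sum _ _ _ _](subrK (shift_sum j.+1 v N x)).
have -> : C * v ^+ m.+1 / v ^+ 2 + d = C * v ^+ m.+1 / v ^+ 2 + d / 2 + d / 2.
  by rewrite -addrA -splitr.
apply: le_trans (ler_normD _ _) _; apply: lerD => //.
by have [sx|/ltW xs] := leP s x; [rewrite distrC|]; apply: L.
Qed.

(** At [s = 1/2] the lattice is symmetric about 0. With [v^2 = y], the exponent [y (s + 1/2)^2 / 2]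
    is [y tri s + y/8], the origin of [exp(-y/8)] in [gaussian_sum]. *)
Lemma shift_sum_half v N : shift_sum 0 v N (1 / 2) =
  2 * \sum_(s < N) expR (- ((v * (s%:R + 1 / 2)) ^+ 2 / 2)).
Proof.
have E u : hg 0 u = expR (- (u ^+ 2 / 2)) by rewrite /hg/= hornerC mul1r.
rewrite /shift_sum big_split_ord/= mulr_natl mulr2n; congr (_ + _); last first.
  by apply: eq_bigr => i _; rewrite natrD E; congr (expR (- ((_ * _) ^+ 2 / 2))); ring.
rewrite (reindex_inj rev_ord_inj)/=; apply: eq_bigr => i _; rewrite E.
congr expR; congr (- (_ / 2)); rewrite natrB ?ltn_ord// -natr1; by field.
Qed.

Lemma tri_natr (s : nat) : (tri s)%:R = (s%:R * (s%:R + 1)) / 2 :> R.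
Proof.
have : ((tri s).*2 = s * s.+1)%N.
  by rewrite /tri even_halfK// oddM oddS andbN.
move=> /(congr1 (fun n => n%:R : R)); rewrite natrM -natr1 -muln2 natrM => <-.
by field.
Qed.

(** The sum at the shift [1/2] is compared with its mean over shifts in [[0, 1]]. The mean is a
    Gaussian integral over a long interval, and the oscillation in the shift is small by
    [shift_sum_small]. *)
Lemma gaussian_sum m : exists2 C : R, 0 <= C & forall y, 0 < y <= 1 ->
  `|2 * expR (- (y / 8)) * expR (FF 0 y - 2 * FF 0 (2 * y)) - Num.sqrt (2 * pi / y)|
    <= C * y ^+ m.
Proof.
(* The mean value theorem contributes one more factor [v]; with the [v^(-2)] of the bound,
   [v^(2m+1)] becomes [v^(2m) = y^m]. *)
have [C C0 HC] := shift_sum_small (m.*2.+1) 0; exists C => // y /andP[y0 y1].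
pose v := Num.sqrt y.
have v0 : 0 < v by rewrite sqrtr_gt0.
have vy : v ^+ 2 = y by rewrite sqr_sqrtr// ltW.
have v1 : v <= 1 by rewrite -sqrtr1 ler_wsqrtr.
have v01 : 0 < v <= 1 by rewrite v0.
have [G [dG Godd Glim]] := @gauss_prim R.
pose w := v / Num.sqrt 2.
have s20 : 0 < Num.sqrt 2 :> R by rewrite sqrtr_gt0.
have w0 : 0 < w by rewrite divr_gt0.
have w2 : w ^+ 2 = y / 2 by rewrite exprMn exprVn vy sqr_sqrtr.
have c1 : (fun N => shift_sum 0 v N (1 / 2)) @ \oo -->
    2 * expR (- (y / 8)) * expR (FF 0 y - 2 * FF 0 (2 * y)).
  have E N : shift_sum 0 v N (1 / 2) =
      2 * expR (- (y / 8)) * \sum_(s < N) expR (- y) ^+ tri s.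
    rewrite shift_sum_half -mulrA; congr (_ * _); rewrite mulr_sumr.
    apply: eq_bigr => s _; rewrite -expRM_natl -expRD; congr expR.
    by rewrite exprMn vy tri_natr; field.
  have cE := gauss_triangular y0.
  have mono : nondecreasing_seq (fun N => \sum_(s < N) expR (- y) ^+ tri s).
    apply/nondecreasing_seqP => N; rewrite big_ord_recr/= lerDl.
    by rewrite exprn_ge0// expR_ge0.
  under eq_fun do rewrite E; apply: cvgM; first exact: cvg_cst.
  have ub N : \sum_(s < N) expR (- y) ^+ tri s <= expR (FF 0 y - 2 * FF 0 (2 * y)).
    have mono2 : nondecreasing_seq (fun n => \sum_(s < n.*2) expR (- y) ^+ tri s).
      by move=> a b ab; apply: mono; rewrite leq_double.
    rewrite -(cvg_lim _ cE)//.
    apply: le_trans (nondecreasing_cvgn_le mono2 _ N); last by apply/cvg_ex; eexists; exact: cE.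
    by apply: mono; rewrite -addnn leq_addr.
  have cv : cvgn (fun N => \sum_(s < N) expR (- y) ^+ tri s).
    apply: nondecreasing_is_cvgn => //; exists (expR (FF 0 y - 2 * FF 0 (2 * y))).
    by move=> _ [N _ <-]; exact: ub.
  have cd : (fun n => \sum_(s < n.*2) expR (- y) ^+ tri s) @ \oo -->
      limn (fun N => \sum_(s < N) expR (- y) ^+ tri s).
    apply: (cvg_comp _ _ _ cv).
    move=> A [N _ NA]; exists N => // n /= Nn; apply: NA => /=.
    by rewrite (leq_trans Nn)// -addnn leq_addr.
  by rewrite -(cvg_lim _ cE)// (cvg_lim _ cd).
have c2 : (fun N : nat => 2 * (G (w * N%:R) / w)) @ \oo --> Num.sqrt (2 * pi / y).
  have -> : Num.sqrt (2 * pi / y) = 2 * (Num.sqrt pi / 2 / w).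
    rewrite sqrtrM ?mulr_ge0 ?pi_ge0// sqrtrM// sqrtrV ?(ltW y0)// -/v /w.
    by field; rewrite !gt_eqF.
  apply: cvgM; first exact: cvg_cst.
  apply: cvgM; last exact: cvg_cst.
  apply: (@cvg_comp _ _ _ (fun N : nat => w * N%:R) G _ _ _ _ Glim).
  apply/cvgryPge => M; have := nbhs_infty_ger (M / w); apply: filterS => N.
  by rewrite ler_pdivrMr// mulrC.
have key d : 0 < d -> \forall N \near \oo,
    `|shift_sum 0 v N (1 / 2) - 2 * (G (w * N%:R) / w)| <= C * y ^+ m + d.
  move=> d0; have [N0 HN0] := HC v d v01 d0; exists N0 => // N /= NN.
  (* A primitive of the sum in the shift. Its increment over [[0, 1]] telescopes to the integral
     over the whole truncated line, and it is a value of the sum at some shift [x]. *)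
  pose W s := \sum_(i < N + N) G (w * (i%:R - N%:R + s)) / w.
  have dW s : is_derive s 1 W (shift_sum 0 v N s).
    rewrite /W /shift_sum.
    have -> : (fun s => \sum_(i < N + N) G (w * (i%:R - N%:R + s)) / w) =
      \sum_(i < N + N) (fun s => G (w * (i%:R - N%:R + s)) / w).
      by apply/funext => z; rewrite fct_sumE.
    apply: is_derive_sum => i.
    have d1 : is_derive s 1 (fun s => w * (i%:R - N%:R + s)) w.
      have := is_deriveZ w (is_deriveD (is_derive_cst (i%:R - N%:R : R) s 1) (is_derive_id s 1)).
      by move=> /trigger_derive; apply; rewrite /GRing.scale/= add0r mulr1.
    have := is_deriveZ w^-1 (@is_derive1_comp _ G _ s _ _ (dG _) d1).
    have -> : w^-1 \*: (G \o (fun s => w * (i%:R - N%:R + s))) =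
      (fun s => G (w * (i%:R - N%:R + s)) / w).
      by apply/funext => z; rewrite /= /GRing.scale/= mulrC.
    move=> /trigger_derive; apply.
    rewrite /GRing.scale/= mulrCA mulVf ?gt_eqF// mulr1 /hg/= hornerC mul1r.
    by congr expR; rewrite [(w * _) ^+ 2]exprMn w2 [(v * _) ^+ 2]exprMn vy; field.
  have [x x01] := MVT_is_derive ler01 (fun z _ => dW z).
  have -> : W 1 - W 0 = 2 * (G (w * N%:R) / w).
    have E i : G (w * (i%:R - N%:R + 1)) / w = G (w * (i.+1%:R - N%:R + 0)) / w.
      by congr (G (_ * _) / _); rewrite -natr1; ring.
    rewrite /W (eq_bigr _ (fun i _ => E (nat_of_ord i))) -sumrB.
    rewrite -(big_mkord xpredT (fun i => G (w * (i.+1%:R - N%:R + 0)) / w - G (w * (i%:R - N%:R + 0)) / w)).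
    rewrite telescope_sumr// natrD addr0 addrK sub0r addr0 mulrN Godd.
    by ring.
  rewrite subr0 mulr1 => ->.
  have L a b : 0 <= a <= 1 -> 0 <= b <= 1 -> a <= b ->
      `|shift_sum 0 v N b - shift_sum 0 v N a| <= C * y ^+ m + d.
    move=> /andP[a0 a1] /andP[b0 b1] ab.
    have [c /andP[ac cb] ->] := MVT_is_derive ab (fun z _ => is_derive_shift_sum 0 v N z).
    have c01 : 0 <= c <= 1 by rewrite (le_trans a0 ac) (le_trans cb b1).
    have := HN0 N c NN c01; set S := shift_sum _ _ _ _ => HS.
    rewrite !normrM (ger0_norm (ltW v0)) [`|b - a|]ger0_norm ?subr_ge0//.
    have ba1 : b - a <= 1 by lra.
    apply: (@le_trans _ _ (v * `|S|)); first by rewrite ler_piMr// mulr_ge0// ltW.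
    apply: le_trans (ler_wpM2l (ltW v0) HS) _.
    rewrite mulrDr lerD//; last by rewrite ler_piMl// ltW.
    rewrite -vy -exprM mul2n [v ^+ m.*2.+1]exprS.
    rewrite le_eqVlt; apply/orP; left; apply/eqP; field.
    by rewrite gt_eqF.
  have h01 : 0 <= (1 / 2 : R) <= 1 by lra.
  by have [sx|/ltW xs] := leP (1 / 2 : R) x; [rewrite distrC|]; apply: L.
apply/ler_addgt0Pr => d d0.
have c3 : (fun N : nat => `|shift_sum 0 v N (1 / 2) - 2 * (G (w * N%:R) / w)|) @ \oo -->
  `|2 * expR (- (y / 8)) * expR (FF 0 y - 2 * FF 0 (2 * y)) - Num.sqrt (2 * pi / y)|.
  by apply: cvg_norm; apply: cvgB.
rewrite -(cvg_lim _ c3)//; apply: limr_le; last exact: key.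
by apply/cvg_ex; eexists; exact: c3.
Qed.

End gaussian_sum.

(** * The value of [zeta(2)] *)

Section zeta_two.
Context {R : realType}.
Implicit Types (x y z : R).

Lemma sin_bounds x : 0 < x < pi / 2 -> x * cos x <= sin x <= x.
Proof.
move=> /andP[x0 x1]; have pi0 := @pi_gt0 R.
have [c /andP[c0 cx]] := MVT_is_derive (ltW x0) (fun z _ => is_derive_sin z).
rewrite sin0 !subr0 => ->; rewrite [x * _]mulrC !(mulrC _ x) ler_pM2l//.
have cl := cos_le1 c.
rewrite ler_piMr ?(ltW x0)// andbT.
have [->//|/eqP xc] := eqVneq c x.
apply/ltW; rewrite ltr_cos ?in_itv/=; first by rewrite lt_neqAle cx andbT; apply/eqP.
- by apply/andP; split; lra.
- by apply/andP; split; lra.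
Qed.

Definition sin_node m k : R := pi * (2 * k%:R + 1) / 2 ^+ m.+2.

Lemma sin_node_itv m k : (k < 2 ^ m)%N -> 0 < sin_node m k < pi / 2.
Proof.
move=> km; have pi0 := @pi_gt0 R; have p0 : 0 < 2 ^+ m.+2 :> R by rewrite exprn_gt0.
have k0 : 0 <= k%:R :> R by [].
have km' : k%:R + 1 <= 2 ^+ m :> R by rewrite natr1 -natrX ler_nat.
have h : 0 < 2 * k%:R + 1 :> R by lra.
apply/andP; split; first by rewrite /sin_node divr_gt0// mulr_gt0.
rewrite /sin_node -mulrA ltr_pM2l// ltr_pdivrMr// !exprS; lra.
Qed.

(** Each node pairs with its reflection in [pi/4], and [1/sin^2 x + 1/cos^2 x = 4/sin^2 (2x)] maps
    the pair to a node of the previous level. *)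
Lemma sum_inv_sin2 m : \sum_(k < 2 ^ m) (sin (sin_node m k) ^+ 2)^-1 = 2 * 4 ^+ m.
Proof.
elim: m => [|m IH].
  rewrite expn0 big_ord1 expr0 mulr1 /sin_node mulr0 add0r mulr1 expr2.
  have -> : pi / (2 * 2) = pi / 4 :> R by congr (_ / _); rewrite -natrM.
  have p4 : tan (pi / 4) = 1 :> R := tan_piquarter R.
  have := @pi_gt0 R => pi0.
  have c0 : cos (pi / 4) != 0 :> R.
    by rewrite gt_eqF// cos_gt0_pihalf//; apply/andP; split; lra.
  have sc : sin (pi / 4) = cos (pi / 4) :> R.
    by move: p4; rewrite /tan => /divr1_eq.
  have := cos2Dsin2 (pi / 4 : R); rewrite sc => H.
  have -> : cos (pi / 4) * cos (pi / 4) = 2^-1 :> R by rewrite -expr2; lra.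
  by rewrite invrK.
rewrite exprS mulrCA -IH mulr_sumr expnS mul2n -addnn big_split_ord/=.
rewrite [X in _ + X](reindex_inj rev_ord_inj)/= -big_split/=.
apply: eq_bigr => k _; have km : (k < 2 ^ m)%N by [].
have -> : sin_node m.+1 (2 ^ m + (2 ^ m - k.+1)) = pi / 2 - sin_node m.+1 k.
  rewrite /sin_node natrD natrB// -natr1 natrX !exprS; field.
  by rewrite expf_neq0.
have -> : sin_node m k = sin_node m.+1 k *+ 2.
  by rewrite /sin_node -mulr_natr !exprS; field; rewrite expf_neq0.
have /andP[x0 x1] : 0 < sin_node m.+1 k < pi / 2.
  by apply: sin_node_itv; rewrite expnS; lia.
set x := sin_node m.+1 k in x0 x1 *.
rewrite sin_mulr2n -opprB sinN sinBpihalf opprK.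
have s0 : 0 < sin x by rewrite sin_gt0_pihalf// x0.
have c0 : 0 < cos x by rewrite cos_gt0_pihalf// x1 andbT; have := @pi_gt0 R; lra.
have := cos2Dsin2 x => H.
rewrite -mulr_natr.
have -> : (sin x ^+ 2)^-1 + (cos x ^+ 2)^-1 =
  (cos x ^+ 2 + sin x ^+ 2) / ((sin x ^+ 2) * (cos x ^+ 2)).
  by field; rewrite !gt_eqF.
by rewrite H; field; rewrite !gt_eqF.
Qed.

Definition odd_zeta N : R := \sum_(k < N) ((2 * k%:R + 1) ^+ 2)^-1.

(** [1/sin^2 x - 1 <= 1/x^2 <= 1/sin^2 x] at the nodes, summed with [sum_inv_sin2]: the total error
    is the number [2^m] of nodes, against a main term of order [4^m]. *)
Lemma odd_zeta_bounds m :
  pi ^+ 2 / 8 - pi ^+ 2 / 16 / 2 ^+ m <= odd_zeta (2 ^ m) <= pi ^+ 2 / 8.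
Proof.
have pi0 := @pi_gt0 R.
have E : odd_zeta (2 ^ m) = pi ^+ 2 / 4 ^+ m.+2 * \sum_(k < 2 ^ m) (sin_node m k ^+ 2)^-1.
  rewrite /odd_zeta mulr_sumr; apply: eq_bigr => k _.
  have k0 : 2 * k%:R + 1 != 0 :> R by rewrite gt_eqF// ltr_wpDl// mulr_ge0.
  have -> : 4 ^+ m.+2 = (2 ^+ m.+2) ^+ 2 :> R.
    by rewrite -exprM mulnC exprM; congr (_ ^+ _); rewrite expr2 -natrM.
  rewrite /sin_node; have := pi0; move: (pi : R) => p p0; field.
  by rewrite k0 expf_neq0//= gt_eqF.
have p4 : 0 < 4 ^+ m :> R by rewrite exprn_gt0.
have q0 : 0 <= pi ^+ 2 / 4 ^+ m.+2 :> R by rewrite divr_ge0 ?sqr_ge0// exprn_ge0.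
have T k : (k < 2 ^ m)%N -> (sin (sin_node m k) ^+ 2)^-1 - 1 <= (sin_node m k ^+ 2)^-1
    <= (sin (sin_node m k) ^+ 2)^-1.
  move=> km; have itv := sin_node_itv km; have /andP[x0 x1] := itv.
  have := sin_bounds itv; set x := sin_node m k in x0 x1 itv * => /andP[h1 h2].
  have s0 : 0 < sin x by rewrite sin_gt0_pihalf.
  have c0 : 0 < cos x by rewrite cos_gt0_pihalf// x1 andbT; lra.
  apply/andP; split; last first.
    by rewrite lef_pV2 ?posrE ?exprn_gt0// lerXn2r// ?nnegrE ltW.
  have -> : (sin x ^+ 2)^-1 - 1 = cos x ^+ 2 / sin x ^+ 2.
    by rewrite cos2sin2; field; rewrite gt_eqF.
  rewrite ler_pdivrMr ?exprn_gt0// mulrC ler_pdivlMr ?exprn_gt0// -exprMn mulrC.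
  by rewrite lerXn2r// ?nnegrE ?mulr_ge0// ltW.
have S1 : \sum_(k < 2 ^ m) (sin_node m k ^+ 2)^-1 <= 2 * 4 ^+ m.
  by rewrite -sum_inv_sin2; apply: ler_sum => k _; have /andP[] := T k (ltn_ord k).
have S2 : 2 * 4 ^+ m - 2 ^+ m <= \sum_(k < 2 ^ m) (sin_node m k ^+ 2)^-1.
  rewrite -sum_inv_sin2.
  have -> : 2 ^+ m = \sum_(k < 2 ^ m) 1 :> R.
    by rewrite sumr_const card_ord natrX.
  by rewrite -sumrB; apply: ler_sum => k _; have /andP[] := T k (ltn_ord k).
have E4 : 4 ^+ m = 2 ^+ m * 2 ^+ m :> R by rewrite -exprMn; congr (_ ^+ _); rewrite -natrM.
have p2 : 0 < 2 ^+ m :> R by rewrite exprn_gt0.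
rewrite E; apply/andP; split.
  apply: le_trans (ler_wpM2l q0 S2).
  rewrite !exprS E4 le_eqVlt; apply/orP; left; apply/eqP; field.
  by rewrite gt_eqF.
apply: le_trans (ler_wpM2l q0 S1) _.
by rewrite !exprS le_eqVlt; apply/orP; left; apply/eqP; field; rewrite gt_eqF.
Qed.

Definition zeta2 N : R := \sum_(d < N) (d.+1%:R ^+ 2)^-1.

Lemma nondecreasing_zeta2 : nondecreasing_seq zeta2.
Proof.
apply/nondecreasing_seqP => N; rewrite /zeta2 big_ord_recr/= lerDl.
by rewrite invr_ge0 sqr_ge0.
Qed.

(** The even terms are a quarter of the series, so the limit [l] solves [l = pi^2/8 + l/4]. *)
Lemma cvg_zeta2 : zeta2 @ \oo --> pi ^+ 2 / 6.
Proof.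
have co : odd_zeta @ \oo --> pi ^+ 2 / 8.
  have mono : nondecreasing_seq odd_zeta.
    apply/nondecreasing_seqP => N; rewrite /odd_zeta big_ord_recr/= lerDl.
    by rewrite invr_ge0 sqr_ge0.
  have ub N : odd_zeta N <= pi ^+ 2 / 8.
    have /andP[_] := odd_zeta_bounds N; apply: le_trans; apply: mono.
    by rewrite ltnW// ltn_expl.
  have cg : (fun m : nat => pi ^+ 2 / 8 - pi ^+ 2 / 16 * (1 / 2) ^+ m : R) @ \oo --> pi ^+ 2 / 8.
    rewrite -[X in _ --> X]subr0; apply: cvgB; first exact: cvg_cst.
    rewrite -[X in _ --> X](mulr0 (pi ^+ 2 / 16)); apply: cvgM; first exact: cvg_cst.
    by apply: cvg_expr; rewrite ger0_norm ?divr_ge0//; lra.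
  apply/cvgrPdist_le => e e0.
  have /cvgrPdist_le/(_ e e0)[m _ Hm] := cg.
  exists (2 ^ m)%N => // N /= mN.
  have H1 := Hm m (leqnn m); rewrite /= opprB addrC subrK in H1.
  have /andP[H2 _] := odd_zeta_bounds m; have H3 := mono _ _ mN; have H4 := ub N.
  have H5 : pi ^+ 2 / 16 * (1 / 2) ^+ m = pi ^+ 2 / 16 / 2 ^+ m :> R.
    by rewrite div1r exprVn.
  rewrite H5 in H1.
  rewrite ger0_norm ?subr_ge0//; move: H1; rewrite ger0_norm; last first.
    by apply: divr_ge0; [exact/divr_ge0/ler0n/sqr_ge0|exact: exprn_ge0].
  by move=> H1; lra.
have cz : cvgn zeta2.
  apply: nondecreasing_is_cvgn; first exact: nondecreasing_zeta2.
  exists 3 => _ [N _ <-]; apply: le_trans (_ : 3 - 3 / N.+1%:R <= _); last first.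
    by rewrite lerBlDr lerDl divr_ge0.
  apply: le_trans (sum_inv_sqr_le N); apply: ler_sum => a _.
  have a0 : 0 <= a%:R :> R by [].
  have h : 0 < 1 + a%:R ^+ 2 :> R by rewrite ltr_pwDl// sqr_ge0.
  by rewrite lef_pV2 ?posrE ?exprn_gt0// -natr1; nra.
have E N : zeta2 N.*2 = odd_zeta N + 4^-1 * zeta2 N.
  elim: N => [|N IH]; first by rewrite /zeta2 /odd_zeta !big_ord0 mulr0 addr0.
  rewrite doubleS /zeta2 2!big_ord_recr/= -/(zeta2 _) IH /odd_zeta big_ord_recr/=.
  rewrite -/(odd_zeta N) [in RHS]big_ord_recr/= -/(zeta2 N).
  rewrite -!natr1 -muln2 natrM.
  have N0 : 0 <= N%:R :> R by [].
  field; rewrite !gt_eqF//; lra.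
have := cz => /cvg_ex[/= l cl].
have cd : (fun N => zeta2 N.*2) @ \oo --> l.
  apply: (cvg_comp _ _ _ cl).
  move=> A [N _ NA]; exists N => // n /= Nn; apply: NA => /=.
  by rewrite (leq_trans Nn)// -addnn leq_addr.
have cd2 : (fun N => zeta2 N.*2) @ \oo --> pi ^+ 2 / 8 + 4^-1 * l.
  under eq_fun do rewrite E; apply: cvgD => //.
  by apply: cvgM => //; exact: cvg_cst.
have H : pi ^+ 2 / 8 + 4^-1 * l = l by exact: cvg_unique cd2 cd.
by have -> : pi ^+ 2 / 6 = l by lra.
Qed.

Lemma zeta2_le N : zeta2 N <= pi ^+ 2 / 6.
Proof.
rewrite -(cvg_lim (@Rhausdorff R) cvg_zeta2).
by apply: nondecreasing_cvgn_le; [exact: nondecreasing_zeta2|apply/cvg_ex; eexists; exact: cvg_zeta2].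
Qed.

(** [sigma k / k] is the sum of [1/m] over the factorisations [k = d m]; so [FF 0] is a double
    series whose inner sums over [d] are geometric. *)
Lemma LL_pairs N k : (k < N)%N -> LL k =
  \sum_(m < N) \sum_(d < N) (if (d.+1 * m.+1 == k)%N then m.+1%:R^-1 else 0) :> R.
Proof.
move=> kN; rewrite exchange_big/=.
case: k kN => [|k] kN.
  by rewrite LL0 big1// => d _; rewrite big1.
have Ed (d : nat) : \sum_(m < N) (if (d.+1 * m.+1 == k.+1)%N then m.+1%:R^-1 else 0) =
    (if (d.+1 %| k.+1)%N then d.+1%:R / k.+1%:R else 0) :> R.
  case: ifPn => [dk|dk]; last first.
    rewrite big1// => m _; rewrite ifF//; apply/negbTE.
    by apply: contra dk => /eqP <-; exact: dvdn_mulr.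
  have q0 : (0 < k.+1 %/ d.+1)%N by rewrite divn_gt0// dvdn_leq.
  have qN : ((k.+1 %/ d.+1).-1 < N)%N.
    by apply: leq_ltn_trans kN; rewrite (leq_trans (leq_pred _))// leq_div.
  rewrite (bigD1 (Ordinal qN))//= prednK// mulnC divnK// eqxx big1 ?addr0.
    have q1 : (k.+1 %/ d.+1)%:R != 0 :> R by rewrite pnatr_eq0 -lt0n.
    have d1 : d.+1%:R != 0 :> R by rewrite pnatr_eq0.
    have -> : k.+1%:R = (k.+1 %/ d.+1)%:R * d.+1%:R :> R by rewrite -natrM divnK.
    by field; rewrite q1 nat1r d1.
  move=> m mq; rewrite ifF//; apply/negbTE; apply: contra mq => /eqP H.
  by apply/eqP/val_inj => /=; rewrite -H mulKn.
under eq_bigr do rewrite Ed.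
rewrite /LL -(@sigma_le_ge N k.+1) ?(ltnW kN)//.
rewrite /sigma_le natr_sum mulr_suml [LHS]big_mkcond/=.
by apply: eq_bigr => d _.
Qed.

Lemma FF0_pairs y N : \sum_(k < N) LL k * ee y k =
  \sum_(m < N) m.+1%:R^-1 * \sum_(d < N | (d.+1 * m.+1 < N)%N) ee y (d.+1 * m.+1).
Proof.
have -> : \sum_(k < N) LL k * ee y k = \sum_(k < N) \sum_(m < N) \sum_(d < N)
  (if (d.+1 * m.+1 == k)%N then m.+1%:R^-1 * ee y k else 0).
  apply: eq_bigr => k _; rewrite (LL_pairs (ltn_ord k)) mulr_suml.
  apply: eq_bigr => m _; rewrite mulr_suml; apply: eq_bigr => d _.
  by case: ifP => //; rewrite mul0r.
rewrite exchange_big/=; apply: eq_bigr => m _.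
rewrite exchange_big/= mulr_sumr [RHS]big_mkcond/=; apply: eq_bigr => d _.
case: ifPn => dm.
  rewrite (bigD1 (Ordinal dm))//= eqxx big1 ?addr0// => k kd.
  by rewrite ifF//; apply/negbTE; apply: contra kd => /eqP H; apply/eqP/val_inj.
rewrite big1// => k _; rewrite ifF//; apply/negbTE; apply: contra dm => /eqP ->.
exact: ltn_ord.
Qed.

Lemma geom_ee_le y m N : 0 < y -> \sum_(d < N) ee y (d.+1 * m.+1) <= (m.+1%:R * y)^-1.
Proof.
move=> y0; pose t := m.+1%:R * y; have t0 : 0 < t by rewrite mulr_gt0.
have E (d : nat) : ee y (d.+1 * m.+1) = expR (- t) * expR (- t) ^+ d.
  by rewrite -exprS -expRM_natl /ee natrM /t; congr expR; ring.
rewrite (eq_bigr _ (fun d _ => E (nat_of_ord d))) -mulr_sumr.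
have /andP[q0 q1] := expRN_itv t0; set q := expR (- t) in q0 q1 *.
have r1' : 0 < 1 - q by rewrite subr_gt0.
have H : (1 - q) * (\sum_(i < N) q ^+ i) = 1 - q ^+ N.
  by apply: oppr_inj; rewrite -mulNr !opprB subrX1.
have S : \sum_(i < N) q ^+ i <= (1 - q)^-1.
  by rewrite -[leRHS]mulr1 ler_pdivlMl// H lerBlDr lerDl exprn_ge0.
apply: le_trans (ler_wpM2l q0 S) _; rewrite ler_pdivrMr// ler_pdivlMl//.
have := expR_ge1Dx t => H2; have : q * expR t = 1 by rewrite /q -expRD addNr expR0.
move=> qe; have : q * (1 + t) <= 1 by apply: le_trans (ler_wpM2l q0 H2) _; rewrite qe.
by rewrite -/t; lra.
Qed.

(** The geometric inner sums are [1/(exp(m y) - 1)], at most [1/(m y)]. *)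
Lemma FF0_le_zeta2 y : 0 < y -> y * FF 0 y <= pi ^+ 2 / 6.
Proof.
move=> y0; rewrite mulrC -ler_pdivlMr//; apply: Sum_le_bounded; first exact: LL_summable.
move=> N; under eq_bigr do rewrite expr0 mul1r.
rewrite FF0_pairs ler_pdivlMr// mulr_suml; apply: le_trans (zeta2_le N).
apply: ler_sum => m _; rewrite -mulrA expr2 invfM ler_wpM2l// -ler_pdivlMr//.
rewrite -invfM; apply: le_trans (geom_ee_le m N y0).
by rewrite big_mkcond/=; apply: ler_sum => d _; case: ifP => // _; exact: ee_ge0.
Qed.

Lemma cvgn_sum M (f : nat -> nat -> R) (l : nat -> R) :
  (forall m, f m @ \oo --> l m) ->
  (fun D => \sum_(m < M) f m D) @ \oo --> \sum_(m < M) l m.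
Proof.
move=> fl; elim: M => [|M IH].
  rewrite big_ord0; under eq_fun do rewrite big_ord0; exact: cvg_cst.
by rewrite big_ord_recr/=; under eq_fun do rewrite big_ord_recr/=; exact: cvgD.
Qed.

(** Keeps the terms [m <= M] and uses [1/(exp t - 1) >= 1/t - 1]; each of them then costs at most
    [y]. *)
Lemma zeta2_le_FF0 y M : 0 < y -> zeta2 M - y * M%:R <= y * FF 0 y.
Proof.
move=> y0.
have H D : \sum_(m < M) m.+1%:R^-1 * \sum_(d < D) ee y (d.+1 * m.+1) <= FF 0 y.
  (* Large enough to exceed every product [d.+1 * m.+1] with [d < D] and [m < M]. *)
  pose N := (M * D + M + D).+1.
  apply: (@le_trans _ _ (\sum_(k < N) LL k * ee y k)); last first.
    have := Sum_ge_partial N (LL_summable 0 y0).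
    under eq_bigr do rewrite expr0 mul1r; apply.
    by move=> k; rewrite expr0 mul1r mulr_ge0 ?LL_ge0 ?ee_ge0.
  rewrite FF0_pairs.
  pose f (m : nat) : R := m.+1%:R^-1 * \sum_(d < N | (d.+1 * m.+1 < N)%N) ee y (d.+1 * m.+1).
  apply: (@le_trans _ _ (\sum_(m < M) f m)); last first.
    apply: (@le_partial _ f); last by rewrite /N; lia.
    by move=> m; rewrite mulr_ge0 ?invr_ge0// sumr_ge0// => d _; exact: ee_ge0.
  apply: ler_sum => m _; rewrite ler_wpM2l ?invr_ge0//.
  pose g (d : nat) : R := if (d.+1 * m.+1 < N)%N then ee y (d.+1 * m.+1) else 0.
  rewrite [leRHS]big_mkcond/=.
  apply: (@le_trans _ _ (\sum_(d < D) g d)); last first.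
    apply: (@le_partial _ g); last by rewrite /N; lia.
    by move=> d; rewrite /g; case: ifP => // _; exact: ee_ge0.
  apply: ler_sum => d _; rewrite /g ifT//.
  by have := ltn_ord d; have := ltn_ord m; rewrite /N; nia.
have geo m : (fun D => \sum_(d < D) ee y (d.+1 * m.+1)) @ \oo -->
    expR (- (m.+1%:R * y)) / (1 - expR (- (m.+1%:R * y))).
  pose t := m.+1%:R * y; have t0 : 0 < t by rewrite mulr_gt0.
  have /andP[q0 q1] := expRN_itv t0; rewrite -/t; set q := expR (- t) in q0 q1 *.
  have E : (fun D => \sum_(d < D) ee y (d.+1 * m.+1)) = series (geometric q q).
    apply/funext => D; rewrite /series/= big_mkord; apply: eq_bigr => d _.
    by rewrite -exprS /q -expRM_natl /ee natrM /t; congr expR; ring.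
  by rewrite E; apply: cvg_geometric_series; rewrite ger0_norm.
have L : \sum_(m < M) m.+1%:R^-1 *
    (expR (- (m.+1%:R * y)) / (1 - expR (- (m.+1%:R * y)))) <= FF 0 y.
  have cs : (fun D => \sum_(m < M) m.+1%:R^-1 * \sum_(d < D) ee y (d.+1 * m.+1)) @ \oo -->
     \sum_(m < M) m.+1%:R^-1 * (expR (- (m.+1%:R * y)) / (1 - expR (- (m.+1%:R * y)))).
    apply: (@cvgn_sum M (fun m D => m.+1%:R^-1 * \sum_(d < D) ee y (d.+1 * m.+1))
      (fun m => m.+1%:R^-1 * (expR (- (m.+1%:R * y)) / (1 - expR (- (m.+1%:R * y)))))).
    by move=> m; apply: cvgM; [exact: cvg_cst|exact: geo].
  rewrite -(cvg_lim (@Rhausdorff R) cs); apply: limr_le.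
    by apply/cvg_ex; eexists; exact: cs.
  by near=> D; exact: H.
apply: le_trans (ler_wpM2l (ltW y0) L).
rewrite mulr_sumr.
have -> : y * M%:R = \sum_(m < M) y by rewrite sumr_const card_ord mulr_natr.
rewrite /zeta2 -sumrB; apply: ler_sum => m _.
pose t := m.+1%:R * y; have t0 : 0 < t by rewrite mulr_gt0.
have m1 : 1 <= m.+1%:R :> R by rewrite ler1n.
have m0 : 0 < m.+1%:R :> R by [].
rewrite -/t.
have /andP[q0 q1] := expRN_itv t0; set q := expR (- t) in q0 q1 *.
have Hq : 1 - t <= q by apply: le_trans (expR_ge1Dx (- t)).
have r1' : 0 < 1 - q by rewrite subr_gt0.
have Q : t^-1 - 1 <= q / (1 - q).
  rewrite ler_pdivlMr//; have ti0 : 0 <= t^-1 by rewrite invr_ge0 ltW.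
  have tq : 1 - q <= t by lra.
  have := ler_wpM2l ti0 tq; rewrite mulVf ?gt_eqF// => h; lra.
have -> : (m.+1%:R ^+ 2)^-1 - y = y * (m.+1%:R^-1 * (t^-1 - m.+1%:R)).
  by rewrite /t; field; rewrite !gt_eqF.
rewrite ler_wpM2l ?(ltW y0)// ler_wpM2l ?invr_ge0//.
by apply: le_trans Q; rewrite lerD2l lerN2.
Unshelve. all: by end_near. Qed.

Lemma FF0_limit (e : R) : 0 < e -> exists2 d : R, 0 < d &
  forall y, 0 < y <= d -> `|y * FF 0 y - pi ^+ 2 / 6| <= e.
Proof.
move=> e0; have e2 : 0 < e / 2 by rewrite divr_gt0.
have /cvgrPdist_le/(_ (e / 2) e2)[M _ HM] := cvg_zeta2.
have /= := HM M (leqnn M); rewrite ler_norml => /andP[_ H].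
exists (e / 2 / M.+1%:R); first by rewrite divr_gt0.
move=> y /andP[y0 yd]; have := zeta2_le_FF0 M y0; have := FF0_le_zeta2 y0.
move: yd; rewrite ler_pdivlMr// => yd.
have : y * M%:R <= y * M.+1%:R by rewrite ler_wpM2l ?(ltW y0)// ler_nat.
by move=> *; rewrite ler_norml; apply/andP; split; lra.
Qed.

End zeta_two.

(** * Expansion of the logarithm of the generating function *)

Section log_partition_asymptotics.
Context {R : realType}.
Implicit Types (x y z h u : R).

Definition flat0 (f : R -> R) := forall K : nat, exists C d : R,
  [/\ 0 <= C, 0 < d <= 1 & forall y, 0 < y <= d -> `|f y| <= C * y ^+ K].

Lemma ln_le_sub1 x : 0 < x -> ln x <= x - 1.
Proof.
move=> x0; rewrite (_ : ln x = ln (1 + (x - 1))); first by apply: le_ln1Dx; lra.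
by congr ln; ring.
Qed.

Lemma ln_lower x : 0 < x -> 1 - x^-1 <= ln x.
Proof.
move=> x0; have := @ln_le_sub1 x^-1; rewrite invr_gt0 => /(_ x0).
by rewrite lnV ?posrE//; lra.
Qed.

Lemma norm_ln1D u : `|u| <= 1 / 2 -> `|ln (1 + u)| <= 2 * `|u|.
Proof.
rewrite ler_norml => /andP[u1 u2].
have u0 : 0 < 1 + u by lra.
have := ln_le_sub1 u0; have := ln_lower u0.
have -> : 1 - (1 + u)^-1 = u / (1 + u) by field; rewrite gt_eqF.
have v0 : 0 <= (1 + u)^-1 by rewrite invr_ge0 ltW.
have v2 : (1 + u)^-1 <= 2.
  by rewrite invf_ple ?posrE//; lra.
have [un|un] := leP 0 u.
  by rewrite [`|u|]ger0_norm// => h1 h2; rewrite ler_norml; apply/andP; split; nra.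
rewrite [`|u|]ltr0_norm// => h1 h2; rewrite ler_norml; apply/andP; split; nra.
Qed.

(* [EE], resp. [EF i], is the expansion of [FF 0], resp. [FF i], at [y = 0]. *)
Definition EE y : R := pi ^+ 2 / 6 / y + 1 / 2 * ln (y / (2 * pi)) - y / 24.

Definition EF (i : nat) y : R :=
  if i is j.+1 then pi ^+ 2 / 6 * i`!%:R / y ^+ i.+1 - j`!%:R / 2 / y ^+ i + (i == 1%N)%:R / 24
  else EE y.

Lemma pi2_gt1 : 1 < 2 * pi :> R.
Proof. by have := @pi_ge2 R; lra. Qed.

Lemma half_ln_sqrt x : 0 < x -> ln (Num.sqrt x) = 1 / 2 * ln x.
Proof.
by move=> x0; rewrite -powR12_sqrt ?(ltW x0)// ln_powR; congr (_ * _); rewrite div1r.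
Qed.

(** [gaussian_sum] divided by its main term, then a logarithm. [EE] is built so that [EE y - 2 EE
    (2y) = 1/2 ln(2 pi / y) - ln 2 + y/8]; its [1/y] term drops out. *)
Lemma FF0_doubling m : exists C d : R, [/\ 0 <= C, 0 < d <= 1 & forall y, 0 < y <= d ->
  `|(FF 0 y - EE y) - 2 * (FF 0 (2 * y) - EE (2 * y))| <= C * y ^+ m.+1].
Proof.
have [C C0 HC] := @gaussian_sum R m.+1.
(* For such [y] the relative error is at most [C y <= 1/2], where [norm_ln1D] applies. *)
exists (2 * C), (1 / (2 * C + 2)); split.
- by rewrite mulr_ge0.
- by rewrite divr_gt0//= ?ler_pdivrMr; lra.
move=> y /andP[y0]; rewrite ler_pdivlMr; last by lra.
move=> yd; have y1 : y <= 1 by nra.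
have pi0 := @pi_gt0 R; have pi2 := pi2_gt1.
have := HC y; rewrite y0 y1 => /(_ isT).
set X := 2 * _ * _; set s := Num.sqrt _ => H.
have s0 : 0 < s by rewrite sqrtr_gt0 divr_gt0// mulr_gt0.
have s1 : 1 <= s.
  have q1 : 1 <= 2 * pi / y by rewrite ler_pdivlMr// mul1r; lra.
  by apply: le_trans (ler_wsqrtr q1); rewrite sqrtr1.
have X0 : 0 < X by rewrite !mulr_gt0 ?expR_gt0.
pose u := X / s - 1.
have uE : u = (X - s) / s by rewrite /u; field; rewrite gt_eqF.
have yK : 0 <= y ^+ m.+1 by rewrite exprn_ge0// ltW.
have uC : `|u| <= C * y ^+ m.+1.
  rewrite uE normrM normfV (gtr0_norm s0) ler_pdivrMr//; apply: le_trans H _.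
  by rewrite ler_peMr// mulr_ge0.
have yK1 : y ^+ m.+1 <= y by rewrite exprS ler_piMr ?(ltW y0)// exprn_ile1// ltW.
have u2 : `|u| <= 1 / 2.
  apply: le_trans uC _; apply: le_trans (ler_wpM2l C0 yK1) _; lra.
have := norm_ln1D u2; rewrite /u addrC subrK ln_div ?posrE// => H2.
have E : ln X - ln s = (FF 0 y - EE y) - 2 * (FF 0 (2 * y) - EE (2 * y)).
  rewrite /X lnM ?posrE ?mulr_gt0 ?expR_gt0// lnM ?posrE ?expR_gt0// !expRK.
  rewrite /s half_ln_sqrt ?divr_gt0 ?mulr_gt0// ln_div ?posrE ?mulr_gt0// /EE.
  rewrite !ln_div ?posrE ?mulr_gt0// !lnM ?posrE//.
  by field; rewrite gt_eqF.
rewrite -E; apply: le_trans H2 _.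
by rewrite -mulrA ler_wpM2l.
Qed.

Lemma EE_limit e : 0 < e -> exists2 d : R, 0 < d &
  forall y, 0 < y <= d -> `|y * EE y - pi ^+ 2 / 6| <= e.
Proof.
move=> e0; have pi0 := @pi_gt0 R; have pi2 := pi2_gt1.
(* From [ln s <= s] with [s = sqrt(2 pi / y)]: the logarithmic part is at most [sqrt(2 pi y)], and
   this is at most [e/2] for [y <= d0]. *)
pose d0 : R := e ^+ 2 / (8 * pi).
pose d := Num.min 1 (Num.min d0 e).
have d00 : 0 < d0 by rewrite divr_gt0 ?mulr_gt0// exprn_gt0.
exists d; first by rewrite !lt_min ltr01 d00 e0.
move=> y /andP[y0]; rewrite !le_min => /and3P[y1 yd0 ye].
have E : y * EE y - pi ^+ 2 / 6 = - (y * ln (Num.sqrt (2 * pi / y))) - y ^+ 2 / 24.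
  rewrite half_ln_sqrt ?divr_gt0 ?mulr_gt0// /EE !ln_div ?posrE ?mulr_gt0//.
  by field; rewrite gt_eqF.
rewrite E; set s := Num.sqrt _.
have s0 : 0 < s by rewrite sqrtr_gt0 divr_gt0 ?mulr_gt0.
have s2 : s ^+ 2 = 2 * pi / y by rewrite sqr_sqrtr// divr_ge0 ?mulr_ge0// ltW.
have s1 : 1 <= s.
  have q1 : 1 <= 2 * pi / y by rewrite ler_pdivlMr// mul1r; lra.
  by apply: le_trans (ler_wsqrtr q1); rewrite sqrtr1.
have l0 : 0 <= ln s by rewrite ln_ge0.
have l1 : ln s <= s by rewrite ltW// ln_sublinear.
have ys : y * s <= e / 2.
  have ys2 : (y * s) ^+ 2 = 2 * pi * y by rewrite exprMn s2; field; rewrite gt_eqF.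
  have e4 : 2 * pi * y <= (e / 2) ^+ 2.
    move: yd0; rewrite /d0 ler_pdivlMr ?mulr_gt0// => yd0.
    have -> : (e / 2) ^+ 2 = e ^+ 2 / 4 by field.
    by rewrite ler_pdivlMr//; lra.
  have ys0 : 0 <= y * s by rewrite mulr_ge0// ltW.
  have e20 : 0 <= e / 2 by rewrite divr_ge0// ltW.
  by rewrite -(@ler_pXn2r _ 2) ?nnegrE// ys2.
have yl : y * ln s <= e / 2 by apply: le_trans ys; rewrite ler_wpM2l// ltW.
have yl0 : 0 <= y * ln s by rewrite mulr_ge0// ltW.
have y2 : y ^+ 2 <= e by rewrite expr2; nra.
have y20 : 0 <= y ^+ 2 by rewrite sqr_ge0.
by rewrite ler_norml; apply/andP; split; lra.
Qed.

(** Multiplied by [y], the remainder is invariant under doubling up to a flat error. Descend to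
    [y / 2^J], where it is as small as desired because [y FF 0 y] and [y EE y] have the same
    limit. *)
Lemma FF0_asymp : flat0 (fun y => FF 0 y - EF 0 y).
Proof.
move=> K.
have [C [d [C0 /andP[d0 d1] H]]] := FF0_doubling K.
pose Phi y := y * (FF 0 y - EE y).
have step z : 0 < z <= d -> `|Phi (2 * z)| <= `|Phi z| + C * z ^+ K.+2.
  move=> /andP[z0 zd]; have := H z; rewrite z0 zd => /(_ isT) Hz.
  have -> : Phi (2 * z) = Phi z - z * ((FF 0 z - EE z) - 2 * (FF 0 (2 * z) - EE (2 * z))).
    by rewrite /Phi; ring.
  apply: le_trans (ler_normB _ _) _; rewrite lerD2l normrM (gtr0_norm z0).
  by rewrite [z ^+ K.+2]exprS mulrCA ler_wpM2l// ltW.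
(* The error committed at [y / 2^j] is at most [C y^(K+2) / 2^j]; the factor [1 - 2^(-J)] is the
   geometric sum. *)
have iter_ J y : 0 < y <= d ->
    `|Phi y| <= `|Phi (y / 2 ^+ J)| + C * y ^+ K.+2 * (1 - (2 ^+ J)^-1).
  move=> /andP[y0 yd]; elim: J => [|J IH].
    by rewrite expr0 divr1 invr1 subrr mulr0 addr0.
  apply: le_trans IH _.
  have p0 : 0 < 2 ^+ J.+1 :> R by rewrite exprn_gt0.
  have p1 : 1 <= 2 ^+ J.+1 :> R by rewrite exprn_ege1// ler1n.
  pose z := y / 2 ^+ J.+1.
  have z0 : 0 < z by rewrite divr_gt0.
  have zy : z <= y by rewrite ler_pdivrMr// ler_peMr// ltW.
  have -> : y / 2 ^+ J = 2 * z.
    by rewrite /z exprS; field; rewrite expf_neq0.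
  have zd : 0 < z <= d by rewrite z0 (le_trans zy).
  have yK : 0 <= y ^+ K.+1 by rewrite exprn_ge0// ltW.
  have zK : z ^+ K.+2 <= y ^+ K.+2 * (2 ^+ J.+1)^-1.
    rewrite exprSr [y ^+ K.+2]exprSr -mulrA -/z.
    by rewrite ler_wpM2r ?(ltW z0)// lerXn2r// nnegrE ltW.
  have H1 := step z zd; have H2 := ler_wpM2l C0 zK.
  have E : (2 ^+ J)^-1 = 2 * (2 ^+ J.+1)^-1 :> R.
    by rewrite exprS; field; rewrite expf_neq0.
  rewrite E -/z; set t := (2 ^+ J.+1)^-1 in H2 *.
  apply: le_trans (lerD H1 (lexx _)) _; rewrite -addrA lerD2l.
  by move: H2; rewrite mulrA; lra.
exists C, d; split=> //; first by rewrite d0.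
move=> y /andP[y0 yd]; rewrite /EF.
have yd' : 0 < y <= d by rewrite y0.
suff PhiC : `|Phi y| <= C * y ^+ K.+1.
  move: PhiC; rewrite /Phi normrM (gtr0_norm y0) exprS mulrCA.
  by rewrite ler_pM2l.
have y1 : y <= 1 by apply: le_trans d1.
have yK : C * y ^+ K.+2 <= C * y ^+ K.+1.
  by rewrite ler_wpM2l// ler_wiXn2l// ltW.
apply: le_trans yK; apply/ler_addgt0Pr => e e0.
have e2 : 0 < e / 2 by rewrite divr_gt0.
have [d2 d20 H2] := FF0_limit e2; have [d3 d30 H3] := EE_limit e2.
have [J HJ] : exists J : nat, y / 2 ^+ J <= Num.min d2 d3.
  have m0 : 0 < Num.min d2 d3 by rewrite lt_min d20.
  exists (Num.bound (y / Num.min d2 d3)).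
  rewrite ler_pdivrMr ?exprn_gt0// -ler_pdivrMl// mulrC ltW//.
  apply: lt_trans (archi_boundP _) _; first by rewrite divr_ge0// ltW.
  by rewrite -natrX ltr_nat ltn_expl.
have z0 : 0 < y / 2 ^+ J by rewrite divr_gt0// exprn_gt0.
move: HJ; rewrite le_min => /andP[zd2 zd3].
have := H2 _; move=> /(_ (y / 2 ^+ J)); rewrite z0 zd2 => /(_ isT) K2.
have := H3 _; move=> /(_ (y / 2 ^+ J)); rewrite z0 zd3 => /(_ isT) K3.
apply: le_trans (iter_ J y yd') _.
have PhiE : `|Phi (y / 2 ^+ J)| <= e.
  have -> : Phi (y / 2 ^+ J) = (y / 2 ^+ J * FF 0 (y / 2 ^+ J) - pi ^+ 2 / 6) -
     (y / 2 ^+ J * EE (y / 2 ^+ J) - pi ^+ 2 / 6) by rewrite /Phi; ring.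
  by apply: le_trans (ler_normB _ _) _; rewrite [e]splitr lerD.
have t0 : 0 <= (2 ^+ J)^-1 :> R by rewrite invr_ge0 exprn_ge0.
have cK : 0 <= C * y ^+ K.+2 by rewrite mulr_ge0// exprn_ge0// ltW.
by rewrite addrC; apply: lerD => //; rewrite ler_piMr//; lra.
Qed.

(** Termwise [0 <= exp(-u) - 1 + u <= u^2] for [u >= 0]; a step to the right keeps the remainder
    expressed at [y] itself. *)
Lemma FF_difference i y h : 0 < y -> 0 <= h ->
  `|FF i (y + h) - FF i y + h * FF i.+1 y| <= h ^+ 2 * FF i.+2 y.
Proof.
move=> y0 h0; have yh : 0 < y + h by rewrite ltr_wpDr.
rewrite /FF -SumZ; last exact: LL_summable.
rewrite -SumB; [|exact: LL_summable..].
rewrite -SumD; last exact/abs_summableZ/LL_summable; last by apply: abs_summableB; exact: LL_summable.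
rewrite -SumZ; last exact: LL_summable.
apply: norm_Sum => [|k]; first exact/abs_summableZ/LL_summable.
pose u := k%:R * h; have u0 : 0 <= u by rewrite mulr_ge0.
have -> : k%:R ^+ i * LL k * ee (y + h) k - k%:R ^+ i * LL k * ee y k +
   h * (k%:R ^+ i.+1 * LL k * ee y k) = k%:R ^+ i * LL k * ee y k * (expR (- u) - 1 + u).
  rewrite {1}/ee (_ : - (k%:R * (y + h)) = - (k%:R * y) + - u); last by rewrite /u; ring.
  by rewrite expRD -/(ee y k) exprS /u; ring.
have -> : h ^+ 2 * (k%:R ^+ i.+2 * LL k * ee y k) = k%:R ^+ i * LL k * ee y k * u ^+ 2.
  by rewrite !exprS /u expr0; ring.
have c0 : 0 <= k%:R ^+ i * LL k * ee y k by rewrite !mulr_ge0 ?exprn_ge0 ?LL_ge0 ?ee_ge0.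
rewrite normrM (ger0_norm c0) ler_wpM2l//.
have e1 := expR_ge1Dx (- u); have e2 := expR_ge1Dx u.
have e3 : expR (- u) * expR u = 1 by rewrite -expRD addNr expR0.
have e4 : expR (- u) <= (1 + u)^-1.
  rewrite -[leRHS]mul1r ler_pdivlMr ?ltr_pwDl//.
  by rewrite -[leRHS]e3 ler_wpM2l ?expR_ge0.
have e5 : (1 + u)^-1 <= 1 - u + u ^+ 2.
  rewrite -[leLHS]mul1r ler_pdivrMr ?ltr_pwDl//.
  have -> : (1 - u + u ^+ 2) * (1 + u) = 1 + u ^+ 3 by ring.
  by rewrite lerDl exprn_ge0.
by rewrite ler_norml; apply/andP; split; nra.
Qed.

(** With [u = h/y], Bernoulli's inequality on both sides: [1 - n u <= (1 - u)^n <= (1 + u)^(-n) <=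
    1/(1 + n u)]. Here [h <= y] ensures [1 - u >= 0]. *)
Lemma inv_pow_difference n y h : 0 < y -> 0 <= h <= y ->
  `|((y + h) ^+ n)^-1 - (y ^+ n)^-1 + h * (n%:R / y ^+ n.+1)| <=
    n%:R ^+ 2 * h ^+ 2 / y ^+ n.+2.
Proof.
move=> y0 /andP[h0 hy]; pose u := h / y.
have u0 : 0 <= u by rewrite divr_ge0// ltW.
have u1 : u <= 1 by rewrite ler_pdivrMr// mul1r.
have hE : h = u * y by rewrite /u divfK// gt_eqF.
have v0 : 0 < 1 + u by rewrite ltr_pwDl.
have -> : ((y + h) ^+ n)^-1 - (y ^+ n)^-1 + h * (n%:R / y ^+ n.+1) =
    (y ^+ n)^-1 * (((1 + u) ^+ n)^-1 - 1 + n%:R * u).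
  have -> : y + h = y * (1 + u) by rewrite hE; ring.
  rewrite exprMn hE exprS; field.
  by rewrite !expf_neq0// gt_eqF.
have -> : n%:R ^+ 2 * h ^+ 2 / y ^+ n.+2 = (y ^+ n)^-1 * ((n%:R * u) ^+ 2).
  rewrite hE 2![y ^+ _.+1]exprS; field; by rewrite expf_neq0 gt_eqF.
rewrite normrM ger0_norm ?invr_ge0 ?exprn_ge0 ?(ltW y0)//.
rewrite ler_wpM2l ?invr_ge0 ?exprn_ge0 ?(ltW y0)//.
have B1 : 1 + n%:R * u <= (1 + u) ^+ n.
  elim: n => [|n IH]; first by rewrite mul0r addr0 expr0.
  rewrite exprS -natr1.
  have := ler_wpM2l (ltW v0) IH.
  have : 0 <= n%:R * (u ^+ 2) by rewrite mulr_ge0// sqr_ge0.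
  by nra.
have B2 : 1 - n%:R * u <= (1 - u) ^+ n.
  elim: n {B1} => [|n IH]; first by rewrite mul0r subr0 expr0.
  rewrite exprS -natr1.
  have w0 : 0 <= 1 - u by lra.
  have := ler_wpM2l w0 IH.
  have : 0 <= n%:R * (u ^+ 2) by rewrite mulr_ge0// sqr_ge0.
  by nra.
have B3 : (1 - u) ^+ n <= ((1 + u) ^+ n)^-1.
  rewrite -[leRHS]mul1r ler_pdivlMr ?exprn_gt0// -exprMn exprn_ile1//; first by nra.
  have := sqr_ge0 u; nra.
have n0 : 0 <= n%:R * u by rewrite mulr_ge0.
have B4 : ((1 + u) ^+ n)^-1 <= 1 - n%:R * u + (n%:R * u) ^+ 2.
  apply: (@le_trans _ _ (1 + n%:R * u)^-1).
    by rewrite lef_pV2 ?posrE ?exprn_gt0// ltr_pwDl.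
  rewrite -[leLHS]mul1r ler_pdivrMr ?ltr_pwDl//.
  have -> : (1 - n%:R * u + (n%:R * u) ^+ 2) * (1 + n%:R * u) = 1 + (n%:R * u) ^+ 3 by ring.
  by rewrite lerDl exprn_ge0.
by rewrite ler_norml; apply/andP; split; nra.
Qed.

Lemma EF_difference i : exists2 C : R, 0 <= C & forall y h, 0 < y <= 1 -> 0 <= h <= y ->
  `|EF i (y + h) - EF i y + h * EF i.+1 y| <= C * h ^+ 2 / y ^+ i.+3.
Proof.
have pi0 := @pi_gt0 R.
case: i => [|i].
  exists (pi ^+ 2 / 6 + 1); first by rewrite addr_ge0// divr_ge0// sqr_ge0.
  move=> y h /andP[y0 y1] hy; have /andP[h0 hy1] := hy.
  have D1 := inv_pow_difference 1 y0 hy; rewrite !expr1 expr1n mul1r in D1.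
  have yh0 : 0 < y + h by rewrite ltr_wpDr.
  pose u := h / y.
  have u0 : 0 <= u by rewrite divr_ge0// ltW.
  have v0 : 0 < 1 + u by rewrite ltr_pwDl.
  have hE : h = u * y by rewrite /u divfK// gt_eqF.
  have L : `|ln (1 + u) - u| <= u ^+ 2.
    have := ln_le_sub1 v0; have := ln_lower v0.
    have : (1 + u)^-1 <= 1 - u + u ^+ 2.
      rewrite -[leLHS]mul1r ler_pdivrMr//.
      have -> : (1 - u + u ^+ 2) * (1 + u) = 1 + u ^+ 3 by ring.
      by rewrite lerDl exprn_ge0.
    by move=> *; rewrite ler_norml; apply/andP; split; lra.
  have -> : EF 0 (y + h) - EF 0 y + h * EF 1 y =
     pi ^+ 2 / 6 * ((y + h)^-1 - y^-1 + h * (1%:R / y ^+ 2)) +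
     1 / 2 * (ln (1 + u) - u).
    have -> : ln (1 + u) = ln ((y + h) / (2 * pi)) - ln (y / (2 * pi)).
      rewrite -ln_div ?posrE ?divr_gt0 ?mulr_gt0//; congr ln.
      by rewrite /u; move: (pi : R) pi0 => p p0; field; rewrite !gt_eqF.
    have -> : EF 1 y = pi ^+ 2 / 6 / y ^+ 2 - 1 / 2 / y + 1 / 24.
      by rewrite /EF eqxx expr1 factS fact0 muln1 mulr1.
    rewrite /EF /EE /u; move: (pi : R) (ln _) (ln _) => p a b; field.
    by rewrite !gt_eqF.
  have p0 : 0 <= pi ^+ 2 / 6 :> R by rewrite divr_ge0// sqr_ge0.
  have h2 : 0 <= h ^+ 2 / y ^+ 2 by rewrite divr_ge0 ?sqr_ge0.
  have uE : u ^+ 2 <= h ^+ 2 / y ^+ 3.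
    rewrite /u exprMn exprVn ler_wpM2l ?sqr_ge0// lef_pV2 ?posrE ?exprn_gt0//.
    by rewrite ler_wiXn2l// ltW.
  apply: le_trans (ler_normD _ _) _.
  have -> : (pi ^+ 2 / 6 + 1) * h ^+ 2 / y ^+ 3 =
     pi ^+ 2 / 6 * (h ^+ 2 / y ^+ 3) + h ^+ 2 / y ^+ 3 by ring.
  apply: lerD; first by rewrite normrM (ger0_norm p0) ler_wpM2l.
  apply: le_trans uE; apply: le_trans L; rewrite normrM ler_piMl// ger0_norm; lra.
pose a : R := pi ^+ 2 / 6 * i.+1`!%:R; pose b : R := i`!%:R / 2.
have a0 : 0 <= a by rewrite mulr_ge0// divr_ge0// sqr_ge0.
have b0 : 0 <= b by rewrite divr_ge0.
exists (a * i.+2%:R ^+ 2 + b * i.+1%:R ^+ 2); first by apply: addr_ge0; apply: mulr_ge0 => //; exact: sqr_ge0.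
move=> y h /andP[y0 y1] hy.
have D1 := inv_pow_difference i.+2 y0 hy; have D2 := inv_pow_difference i.+1 y0 hy.
have -> : EF i.+1 (y + h) - EF i.+1 y + h * EF i.+2 y =
   a * (((y + h) ^+ i.+2)^-1 - (y ^+ i.+2)^-1 + h * (i.+2%:R / y ^+ i.+3)) -
   b * (((y + h) ^+ i.+1)^-1 - (y ^+ i.+1)^-1 + h * (i.+1%:R / y ^+ i.+2)).
  rewrite /EF /a /b [i.+2`!]factS [i.+1`!]factS !natrM/= mul0r addr0; ring.
apply: le_trans (ler_normB _ _) _.
have -> : (a * i.+2%:R ^+ 2 + b * i.+1%:R ^+ 2) * h ^+ 2 / y ^+ i.+4 =
  a * (i.+2%:R ^+ 2 * h ^+ 2 / y ^+ i.+4) + b * (i.+1%:R ^+ 2 * h ^+ 2 / y ^+ i.+4).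
  by ring.
apply: lerD; first by rewrite normrM (ger0_norm a0) ler_wpM2l.
rewrite normrM (ger0_norm b0) ler_wpM2l//; apply: le_trans D2 _.
have hh0 : 0 <= i.+1%:R ^+ 2 * h ^+ 2 by apply: mulr_ge0; exact: sqr_ge0.
rewrite ler_wpM2l// lef_pV2 ?posrE ?exprn_gt0//.
by rewrite ler_wiXn2l// ltW.
Qed.

(* Landau's trick: a flat remainder whose second difference quotients grow at most
   polynomially has a flat derivative; no differentiation of the theta series is needed. *)
Lemma FF_asymp i : flat0 (fun y => FF i y - EF i y).
Proof.
elim: i => [|i IH]; first exact: FF0_asymp.
move=> K; have [C1 C10 HC1] := EF_difference i.
(* The step is [h = y^M]: second-order terms, divided by [h], are of size [h / y^(i+4) = y^K], and a
   flat error of order [K + M] survives the division. *)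
pose M := (K + i + 4)%N.
have [C2 [d [C20 /andP[d0 d1] H]]] := IH (K + M)%N.
pose C3 : R := i.+3`!%:R * 2 ^+ i.+3 * 4.
have C30 : 0 <= C3.
  by apply: mulr_ge0 => //; apply: mulr_ge0 => //; exact: exprn_ge0.
exists (C2 + C2 * 2 ^+ (K + M) + C3 + C1), (d / 2); split.
- by rewrite !addr_ge0// mulr_ge0// exprn_ge0.
- by apply/andP; split; lra.
move=> y /andP[y0 yd].
have y1 : y <= 1 by lra.
pose h := y ^+ M.
have h0 : 0 < h by rewrite exprn_gt0.
have hy : h <= y by rewrite /h /M addn4 exprS ler_piMr ?(ltW y0)// exprn_ile1// ltW.
have yh : 0 < y + h by rewrite ltr_wpDr// ltW.
have E0 : h * (FF i.+1 y - EF i.+1 y) =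
  (FF i (y + h) - FF i y + h * FF i.+1 y) -
  (EF i (y + h) - EF i y + h * EF i.+1 y) +
  ((FF i y - EF i y) - (FF i (y + h) - EF i (y + h))) by ring.
have B1 := FF_difference i y0 (ltW h0).
have B2 : `|EF i (y + h) - EF i y + h * EF i.+1 y| <= C1 * h ^+ 2 / y ^+ i.+3.
  by apply: HC1; rewrite ?y0 ?y1// (ltW h0).
have B3 : `|FF i y - EF i y| <= C2 * y ^+ (K + M) by apply: H; rewrite y0; lra.
have B4 : `|FF i (y + h) - EF i (y + h)| <= C2 * 2 ^+ (K + M) * y ^+ (K + M).
  apply: le_trans (H _ _) _; first by rewrite yh; lra.
  rewrite -mulrA ler_wpM2l// -exprMn lerXn2r ?nnegrE ?(ltW yh)//; first by rewrite mulr_ge0 ?ltW.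
  by lra.
have B5 : FF i.+2 y <= C3 / y ^+ i.+4 by apply: FF_le; rewrite y0.
have yM : h * y ^+ K = y ^+ (K + M) by rewrite /h -exprD addnC.
have hh : h / y ^+ i.+4 = y ^+ K.
  rewrite /h /M -addnA addn4.
  by rewrite exprD mulfK// expf_neq0// gt_eqF.
have hh3 : h / y ^+ i.+3 <= y ^+ K.
  rewrite -hh ler_wpM2l ?(ltW h0)// lef_pV2 ?posrE ?exprn_gt0//.
  by rewrite ler_wiXn2l// ltW.
have yK0 : 0 <= y ^+ K by rewrite exprn_ge0// ltW.
rewrite -(ler_pM2l h0) -{1}(gtr0_norm h0) -normrM E0.
apply: le_trans (ler_normD _ _) _.
have T1 : h ^+ 2 * FF i.+2 y <= h * (C3 * y ^+ K).
  rewrite expr2 -mulrA ler_wpM2l ?(ltW h0)//.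
  by apply: le_trans (ler_wpM2l (ltW h0) B5) _; rewrite mulrCA hh.
have T2 : C1 * h ^+ 2 / y ^+ i.+3 <= h * (C1 * y ^+ K).
  have -> : C1 * h ^+ 2 / y ^+ i.+3 = h * (C1 * (h / y ^+ i.+3)) by ring.
  by rewrite ler_wpM2l ?(ltW h0)// ler_wpM2l.
have -> : h * ((C2 + C2 * 2 ^+ (K + M) + C3 + C1) * y ^+ K) =
  (h * (C3 * y ^+ K) + h * (C1 * y ^+ K)) +
  (C2 * y ^+ (K + M) + C2 * 2 ^+ (K + M) * y ^+ (K + M)) by rewrite -yM; ring.
apply: lerD; apply: le_trans (ler_normB _ _) _; apply: lerD => //.
- by apply: le_trans B1 T1.
- by apply: le_trans B2 T2.
Qed.

End log_partition_asymptotics.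

(** * The Fourier integral and the minor arcs *)

Section circle_method.
Context {R : realType}.
Implicit Types (x y z h u t : R).

(** The recurrence [cos((k+2)t) = 2 cos t cos((k+1)t) - cos(k t)] turns into a linear equation for
    the sum. *)
Lemma poisson_kernel (q t : R) : 0 <= q < 1 ->
  abs_summable (fun k => q ^+ k * cos (k%:R * t)) /\
  (1 - 2 * q * cos t + q ^+ 2) * Sum (fun k => q ^+ k * cos (k%:R * t)) = 1 - q * cos t.
Proof.
move=> /andP[q0 q1].
have sq : abs_summable (fun k => q ^+ k).
  apply/abs_summableP.
  have -> : (fun k => `|q ^+ k|) = geometric 1 q.
    by apply/funext => k; rewrite /= mul1r ger0_norm ?exprn_ge0.
  by apply: is_cvg_geometric_series; rewrite ger0_norm.
have s : abs_summable (fun k => q ^+ k * cos (k%:R * t)).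
  apply: (abs_summable_le _ sq) => k.
  by rewrite normrM ger0_norm ?exprn_ge0// ler_piMr ?exprn_ge0// cos_max.
split=> //; have s1 := abs_summable_shift s; have s2 := abs_summable_shift s1.
have E0 := Sum_recl s; have E1 := Sum_recl s1.
have E2 : Sum (fun k => q ^+ k.+2 * cos (k.+2%:R * t)) =
    2 * q * cos t * Sum (fun k => q ^+ k.+1 * cos (k.+1%:R * t)) -
    q ^+ 2 * Sum (fun k => q ^+ k * cos (k%:R * t)).
  rewrite -SumZ// -SumZ// -SumB//; last first.
  - exact: abs_summableZ.
  - exact: abs_summableZ.
  apply: eq_Sum => k.
  have -> : k.+2%:R * t = k.+1%:R * t + t by rewrite -[k.+2%:R]natr1; ring.
  have -> : cos (k%:R * t) = cos (k.+1%:R * t - t).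
    by congr cos; rewrite -natr1; ring.
  by rewrite cosD cosB !exprS expr0; ring.
rewrite expr0 mul0r cos0 mulr1 in E0; rewrite expr1 mul1r E2 in E1.
move: E0 E1; move: (Sum _) (Sum _) => G H E0 E1.
have HE : G = H - 1 by rewrite E0; ring.
rewrite HE in E1.
have -> : (1 - 2 * q * cos t + q ^+ 2) * H =
  H - (2 * q * cos t * (H - 1) - q ^+ 2 * H) - 2 * q * cos t by ring.
have -> : 2 * q * cos t * (H - 1) - q ^+ 2 * H = H - 1 - q * cos t by rewrite [in RHS]E1; ring.
by ring.
Qed.

(** Up to [pi/4], [sin x >= x cos x >= x/2]; beyond it [sin x >= 1/2], while [x/4 < 1/2]. *)
Lemma sin_lower x : 0 <= x <= pi / 2 -> x / 4 <= sin x.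
Proof.
move=> /andP[x0 x2]; have pi0 := @pi_gt0 R.
have [xp|xp] := leP x (pi / 4); last first.
  have s4 : sin (pi / 4) ^+ 2 = 1 / 2 :> R.
    have := @cos2Dsin2 R (pi / 4).
    have -> : cos (pi / 4) = sin (pi / 4) :> R.
      by rewrite -[RHS]cosBpihalf -[RHS]cosN; congr cos; lra.
    by move=> ?; lra.
  have sp : 0 < sin (pi / 4) :> R by rewrite sin_gt0_pihalf//; apply/andP; split; lra.
  have s12 : 1 / 2 <= sin (pi / 4) :> R by nra.
  have : sin (pi / 4) <= sin x.
    by apply/ltW; rewrite ltr_sin ?in_itv//=; apply/andP; split; lra.
  have := @pihalf_lt2 R; lra.
have [->|xn0] := eqVneq x 0; first by rewrite mul0r sin0.
have xx0 : 0 < x by rewrite lt_neqAle eq_sym xn0.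
have /andP[+ _] : x * cos x <= sin x <= x by apply: sin_bounds; apply/andP; split; lra.
apply: le_trans; rewrite ler_pM2l//.
have s4 : cos (pi / 4) ^+ 2 = 1 / 2 :> R.
  have := @cos2Dsin2 R (pi / 4).
  have -> : sin (pi / 4) = cos (pi / 4) :> R.
    by rewrite -[LHS]cosBpihalf -[LHS]cosN; congr cos; lra.
  by move=> ?; lra.
have cp : 0 < cos (pi / 4) :> R by rewrite cos_gt0_pihalf//; apply/andP; split; lra.
have c12 : 1 / 2 <= cos (pi / 4) :> R by nra.
have : cos (pi / 4) <= cos x.
  have [->//|xn4] := eqVneq x (pi / 4).
  apply/ltW; rewrite ltr_cos ?in_itv/=; first by rewrite lt_neqAle xn4.
  - by apply/andP; split; lra.
  - by apply/andP; split; lra.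
lra.
Qed.

Lemma one_sub_cos_lower t : `|t| <= pi -> t ^+ 2 / 32 <= 1 - cos t.
Proof.
move=> tpi; rewrite -cos_norm -(real_normK (num_real t)); set s := `|t| in tpi *.
have s0 : 0 <= s by exact: normr_ge0.
have := @sin_lower (s / 2); rewrite divr_ge0//= ler_pM2r// => /(_ tpi) H.
have E : 1 - cos s = 2 * sin (s / 2) ^+ 2.
  have -> : cos s = cos (s / 2 *+ 2) by congr cos; rewrite -mulr_natr; field.
  by rewrite cos_mulr2n cos2sin2 -mulr_natr; ring.
rewrite E; have h0 : 0 <= s / 2 / 4 by rewrite !divr_ge0.
have : (s / 2 / 4) ^+ 2 <= sin (s / 2) ^+ 2 by rewrite lerXn2r// nnegrE// (le_trans h0).
rewrite (_ : (s / 2 / 4) ^+ 2 = s ^+ 2 / 64); last by field.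
by move=> ?; lra.
Qed.

Lemma LL_ee_summable y : 0 < y -> abs_summable (fun k => LL k * ee y k).
Proof. by move=> y0; have := LL_summable 0 y0; under eq_fun do rewrite expr0 mul1r. Qed.

(** All terms [cos(k t) - 1] are nonpositive and [LL k >= 1] for positive [k], so replacing [LL k]
    by 1 only raises the sum, which becomes a difference of Poisson kernels. The conclusion is
    cleared of its denominator: it bounds the difference by [- t^2 / (64 y^3 + 4 y t^2)]. *)
Lemma CC_minor y t : 0 < y <= 1 / 2 -> `|t| <= pi ->
  (CC y t - CC y 0) * (64 * y ^+ 3 + 4 * y * t ^+ 2) <= - t ^+ 2.
Proof.
move=> /andP[y0 y1] tpi; have /andP[q0 q1] := expRN_itv y0.
have qy : 1 - y <= expR (- y) by apply: expR_ge1Dx.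
set q := expR (- y) in q0 q1 qy.
have qh : 1 / 2 <= q by lra.
have q01 : 0 <= q < 1 by rewrite q0.
have [s1 S1] := poisson_kernel t q01; have [s0 S0] := poisson_kernel 0 q01.
pose G s := Sum (fun k => q ^+ k * cos (k%:R * s)).
have le1 : CC y t - CC y 0 <= G t - G 0.
  have sL := LL_ee_summable y0.
  rewrite /CC /G -SumB; [|exact: abs_summable_trig..]; rewrite -SumB//.
  apply: le_Sum; [by apply: abs_summableB; exact: abs_summable_trig|exact: abs_summableB|].
  case=> [|k]; first by rewrite !mul0r !subrr.
  rewrite mulr0 !cos_shift0 cos0 -!mulrBr eeX -/q -mulrA.
  have c0 : cos (k.+1%:R * t) - 1 <= 0 by rewrite subr_le0 cos_le1.
  have : q ^+ k.+1 * (cos (k.+1%:R * t) - 1) <= 0.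
    by rewrite mulr_ge0_le0// exprn_ge0.
  have := @LL_ge1 R k; nra.
rewrite cos0 -/(G 0) in S0; rewrite -/(G t) in S1.
pose v := 1 - cos t; have vE : cos t = 1 - v by rewrite /v; ring.
have v0 : 0 <= v by rewrite subr_ge0 cos_le1.
have vt := one_sub_cos_lower tpi; rewrite -/v in vt.
have p1 : 0 < 1 - q by rewrite subr_gt0.
have D0 : 0 < (1 - q) ^+ 2 + 2 * q * v.
  by rewrite ltr_pwDl ?exprn_gt0// mulr_ge0// mulr_ge0.
have G0 : G 0 = (1 - q)^-1.
  apply: (mulfI (lt0r_neq0 p1)); rewrite mulfV ?gt_eqF//.
  apply: (mulfI (lt0r_neq0 p1)); transitivity ((1 - 2 * q * 1 + q ^+ 2) * G 0); first by ring.
  by rewrite S0; ring.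
have Gt : G t = (1 - q + q * v) / ((1 - q) ^+ 2 + 2 * q * v).
  apply: (mulfI (lt0r_neq0 D0)); rewrite mulrC [RHS]mulrC divfK ?gt_eqF//.
  have -> : 1 - q + q * v = 1 - q * cos t by rewrite vE; ring.
  by rewrite -S1 vE; ring.
have E : G t - G 0 = - (q * (1 + q) * v / ((1 - q) * ((1 - q) ^+ 2 + 2 * q * v))).
  by rewrite Gt G0; field; rewrite !gt_eqF.
have T0 : 0 <= t ^+ 2 by rewrite sqr_ge0.
have P0 : 0 <= 64 * y ^+ 3 + 4 * y * t ^+ 2.
  have y30 : 0 <= y ^+ 3 by rewrite exprn_ge0// ltW.
  by have := mulr_ge0 (ltW y0) T0; lra.
apply: le_trans (ler_wpM2r P0 le1) _.
rewrite E mulNr lerN2 mulrAC ler_pdivlMr ?mulr_gt0//.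
have q2 : 1 - q <= y by lra.
have k1 : (1 - q) * ((1 - q) ^+ 2 + 2 * q * v) <= y * (y ^+ 2 + 2 * v).
  apply: ler_pM; rewrite ?(ltW p1) ?(ltW D0)//; apply: lerD.
    by rewrite lerXn2r// nnegrE ltW.
  by rewrite ler_wpM2r//; lra.
apply: le_trans (ler_wpM2l T0 k1) _.
have k2 : 1 / 2 * v <= q * (1 + q) * v by rewrite ler_wpM2r//; nra.
apply: le_trans (ler_wpM2r P0 k2).
have -> : 1 / 2 * v * (64 * y ^+ 3 + 4 * y * t ^+ 2) =
  y * (32 * v * y ^+ 2 + 2 * v * t ^+ 2) by field.
have -> : t ^+ 2 * (y * (y ^+ 2 + 2 * v)) = y * (t ^+ 2 * y ^+ 2 + 2 * v * t ^+ 2) by ring.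
rewrite ler_wpM2l ?(ltW y0)// lerD2r ler_wpM2r ?sqr_ge0//; lra.
Qed.

Lemma trig_taylor s n y t : 0 < y ->
  `|Sum (fun k => LL k * ee y k * cos_shift s (k%:R * t)) -
    \sum_(j < n) cos_shift (s + j) 0 * t ^+ j / j`!%:R * FF j y| <= `|t| ^+ n * FF n y.
Proof.
move=> y0.
have sL := LL_ee_summable y0.
have sj (j : 'I_n) : abs_summable (fun k => cos_shift (s + j) 0 * t ^+ j / j`!%:R *
    (k%:R ^+ j * LL k * ee y k)) by apply/abs_summableZ/LL_summable.
have E : \sum_(j < n) cos_shift (s + j) 0 * t ^+ j / j`!%:R * FF j y =
    \sum_(j < n) Sum (fun k => cos_shift (s + j) 0 * t ^+ j / j`!%:R *
      (k%:R ^+ j * LL k * ee y k)).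
  by apply: eq_bigr => j _; rewrite /FF SumZ//; exact: LL_summable.
rewrite E -(Sum_sum _ sj) -SumB; last first.
- exact: abs_summable_sum.
- exact: abs_summable_trig.
rewrite -SumZ; last exact: LL_summable.
apply: norm_Sum => [|k]; first exact/abs_summableZ/LL_summable.
have -> : LL k * ee y k * cos_shift s (k%:R * t) -
    \sum_(j < n) cos_shift (s + j) 0 * t ^+ j / j`!%:R * (k%:R ^+ j * LL k * ee y k) =
  LL k * ee y k * (cos_shift s (k%:R * t) -
    \sum_(j < n) cos_shift (s + j) 0 * (k%:R * t) ^+ j / j`!%:R).
  rewrite mulrBr mulr_sumr; congr (_ - _); apply: eq_bigr => j _.
  by rewrite exprMn; ring.
have L0 : 0 <= LL k * ee y k by rewrite mulr_ge0 ?LL_ge0 ?ee_ge0.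
rewrite normrM (ger0_norm L0).
apply: le_trans (ler_wpM2l L0 (cos_taylor _ _ _)) _.
rewrite normrM exprMn ger0_norm// le_eqVlt; apply/orP; left; apply/eqP; ring.
Qed.

Lemma sin_natpi (m : nat) : sin (m%:R * pi) = 0 :> R.
Proof.
elim: m => [|m IH]; first by rewrite mul0r sin0.
by rewrite -natr1 mulrDl mul1r sinD IH sinpi mulr0 mul0r addr0.
Qed.

Lemma J_cos (m n : nat) (l : R) : 0 < l ->
  has_prim (fun x => cos ((m%:R - n%:R) * (l * x))) /\
  J (fun x => cos ((m%:R - n%:R) * (l * x))) (- (pi / l)) (pi / l) =
  if m == n then 2 * pi / l else 0.
Proof.
move=> l0; have [->|mn] := eqVneq m n.
  rewrite subrr; under eq_fun do rewrite mul0r cos0.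
  split; first exact: has_prim_cst.
  by rewrite J_cst opprK; field; rewrite gt_eqF.
pose d : R := (m%:R - n%:R) * l.
have d0 : d != 0 by apply: mulf_neq0; [rewrite subr_eq0 eqr_nat|rewrite gt_eqF].
have D x : is_derive x 1 (fun x => d^-1 * sin (d * x)) (cos ((m%:R - n%:R) * (l * x))).
  have := is_deriveZ d^-1 (is_derive_scale_arg (is_derive_sin (d * x))).
  by move=> /trigger_derive; apply; rewrite /GRing.scale/= mulrA mulVf// mul1r mulrA.
split; first by eexists; exact: D.
rewrite (JE _ _ D) mulrN sinN.
have -> : d * (pi / l) = m%:R * pi - n%:R * pi.
  by rewrite /d; move: (pi : R) => p; field; rewrite gt_eqF.
by rewrite sinB !sin_natpi mul0r mulr0 subrr mulr0 oppr0 mulr0 subrr.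
Qed.

(** The real part of [(AA + i BB) exp(- i n t)]. *)
Definition wave n y t : R := AA y t * cos (n%:R * t) + BB y t * sin (n%:R * t).

Lemma pp_ee_summable y : 0 < y -> abs_summable (fun k => pp k * ee y k).
Proof. by move=> y0; have := pp_summable 0 y0; under eq_fun do rewrite expr0 mul1r. Qed.

Lemma waveE n y t : 0 < y ->
  abs_summable (fun m => pp m * ee y m * cos ((m%:R - n%:R) * t)) /\
  wave n y t = Sum (fun m => pp m * ee y m * cos ((m%:R - n%:R) * t)).
Proof.
move=> y0; have s := pp_ee_summable y0.
split.
  apply: (abs_summable_le _ s) => k.
  have h0 : 0 <= pp k * ee y k by rewrite mulr_ge0 ?pp_ge0 ?ee_ge0.
  by rewrite normrM ger0_norm// ler_piMr// cos_max.
have s0 := abs_summable_trig 0 t s; have s3 := abs_summable_trig 3 t s.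
rewrite /wave /AA /BB mulrC [Sum _ * sin _]mulrC -SumZ// -SumZ// -SumD.
- by apply: eq_Sum => m; rewrite cos_shift0 cos_shift3 mulrBl cosB; ring.
- exact: abs_summableZ.
- exact: abs_summableZ.
Qed.

Lemma continuous_wave n y l : 0 < y -> continuous (fun x => wave n y (l * x)).
Proof.
move=> y0.
have d0 c t : is_derive t 1 (fun x => cos (c * x)) (c * - sin (c * t)).
  exact: (is_derive_scale_arg (is_derive_cos (c * t))).
have d1 c t : is_derive t 1 (fun x => sin (c * x)) (c * cos (c * t)).
  exact: (is_derive_scale_arg (is_derive_sin (c * t))).
have dw t : exists df, is_derive t 1 (wave n y) df.
  eexists; exact: (is_deriveD (is_deriveM (is_derive_AA t y0) (d0 n%:R t))
    (is_deriveM (is_derive_BB t y0) (d1 n%:R t))).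
have [df dfP] := choice dw.
apply: (@is_derive_continuous _ _ (fun x => l * df (l * x))) => x.
exact: is_derive_scale_arg.
Qed.

(** Only a finite sum is integrated termwise; the tail is bounded, uniformly in the angle, by the
    tail at angle 0. The scale [l] allows a rescaled angle. *)
Lemma fourier_coefficient n y l : 0 < y -> 0 < l ->
  J (fun x => wave n y (l * x)) (- (pi / l)) (pi / l) = 2 * pi / l * (pp n * ee y n).
Proof.
move=> y0 l0; have pi0 := @pi_gt0 R.
have pl : 0 < pi / l by rewrite divr_gt0.
apply/eqP; rewrite -subr_eq0 -normr_le0; apply/ler_addgt0Pr => e e0; rewrite add0r.
pose d := e * l / (2 * pi).
have d0 : 0 < d by rewrite divr_gt0 ?mulr_gt0.
have s := pp_ee_summable y0.
have [N0 HN0] := Sum_approx s d0.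
pose N := (N0 + n.+1)%N.
have NN0 : (N0 <= N)%N by exact: leq_addr.
have nN : (n < N)%N by exact: leq_addl.
pose f (m : nat) x : R := pp m * ee y m * cos ((m%:R - n%:R) * (l * x)).
have hf (m : 'I_N) : has_prim (f m).
  by apply: has_primZ; have [] := J_cos m n l0.
have hw : has_prim (fun x => wave n y (l * x)).
  exact/continuous_has_prim/continuous_wave.
have E : 2 * pi / l * (pp n * ee y n) =
    J (fun x => \sum_(m < N) f m x) (- (pi / l)) (pi / l).
  rewrite J_sum// (bigD1 (Ordinal nN))//= big1 ?addr0.
    have [h Jh] := J_cos n n l0.
    by rewrite /f JZ// Jh eqxx mulrC.
  move=> m mn; have [h Jh] := J_cos m n l0.
  rewrite /f JZ// Jh ifF ?mulr0//; apply/negbTE; apply: contra mn => /eqP H.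
  by apply/eqP/val_inj.
have hs : has_prim (fun x => \sum_(m < N) f m x) by exact: has_prim_sum.
rewrite E -JB//.
have -> : e = J (fun=> d) (- (pi / l)) (pi / l).
  by rewrite J_cst /d; move: (pi : R) pi0 => p p0; field; rewrite !gt_eqF.
apply: norm_J; [exact: has_primB|exact: has_prim_cst|lra|].
move=> x _; have [sw ->] := waveE n (l * x) y0.
have H1 := HN0 N NN0; apply: ltW; apply: le_lt_trans H1.
have tl (a : nat -> R) M : abs_summable a ->
    Sum a - \sum_(m < M) a m = Sum (fun m => a (m + M)%N) /\
    abs_summable (fun m => a (m + M)%N).
  move=> sa; elim: M => [|M [IH1 IH2]].
    have -> : (fun m => a (m + 0)%N) = a by apply/funext => m; rewrite addn0.
    by rewrite big_ord0 subr0.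
  have -> : (fun m => a (m + M.+1)%N) = (fun m => a (m.+1 + M)%N).
    by apply/funext => m; rewrite addSnnS.
  split; last exact: abs_summable_shift IH2.
  by rewrite big_ord_recr/= opprD addrA IH1 (Sum_recl IH2) add0n addrAC subrr add0r.
have [t1 _] := tl _ N sw; have [t2 t2s] := tl _ N s.
rewrite t1 t2; apply: le_trans (ler_norm _); apply: norm_Sum => // m.
have h0 : 0 <= pp (m + N) * ee y (m + N) by rewrite mulr_ge0 ?pp_ge0 ?ee_ge0.
by rewrite normrM ger0_norm// ler_piMr// cos_max.
Qed.

Lemma wave_polar n y t : 0 < y ->
  wave n y t = PP y * (expR (CC y t - CC y 0) * cos (DD y t - n%:R * t)).
Proof.
by move=> y0; rewrite /wave; have [-> ->] := AA_BB_polar t y0; rewrite cosB; ring.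
Qed.

End circle_method.

(** * Expansions in powers of [n^(-1/16)] *)

Section taylor_classes.
Context {R : realType}.
Implicit Types (f g : R -> R) (x y z : R) (K : nat).

(** The polynomial may have any degree, so a product of approximations needs no truncation. *)
Definition taylorK K f := exists (Q : {poly R}) (C d : R),
  [/\ 0 <= C, 0 < d & forall x, `|x| <= d -> `|f x - Q.[x]| <= C * `|x| ^+ K].

Definition taylor f := forall K, taylorK K f.

Lemma poly_locally_bounded (Q : {poly R}) (d : R) : exists2 B : R, 0 <= B &
  forall x, `|x| <= d -> `|Q.[x]| <= B.
Proof.
exists (\sum_(i < size Q) `|Q`_i| * `|d| ^+ i).
  by apply: sumr_ge0 => i _; rewrite mulr_ge0// exprn_ge0.
move=> x xd; rewrite horner_coef; apply: le_trans (ler_norm_sum _ _ _) _.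
apply: ler_sum => i _; rewrite normrM normrX ler_wpM2l// lerXn2r// ?nnegrE//.
by apply: le_trans xd _; exact: ler_norm.
Qed.

Lemma taylorKM K f g : taylorK K f -> taylorK K g -> taylorK K (fun x => f x * g x).
Proof.
move=> [Q [C [d [C0 d0 H]]]] [Q' [C' [d' [C'0 d'0 H']]]].
pose e := Num.min 1 (Num.min d d').
have e0 : 0 < e by rewrite !lt_min ltr01 d0.
have [B B0 HB] := poly_locally_bounded Q e.
have [B' B'0 HB'] := poly_locally_bounded Q' e.
exists (Q * Q'), (C * (C' + B') + B * C'), e; split=> //.
  by rewrite addr_ge0 ?mulr_ge0 ?addr_ge0.
move=> x xe; have := xe; rewrite /e !le_min => /and3P[x1 xd xd'].
have h1 := H x xd; have h2 := H' x xd'; have b1 := HB x xe; have b2 := HB' x xe.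
have xK : 0 <= `|x| ^+ K by rewrite exprn_ge0.
have xK1 : `|x| ^+ K <= 1 by rewrite exprn_ile1.
have -> : f x * g x - (Q * Q').[x] = (f x - Q.[x]) * g x + Q.[x] * (g x - Q'.[x]).
  by rewrite hornerM; ring.
apply: le_trans (ler_normD _ _) _; rewrite !normrM mulrDl; apply: lerD.
  rewrite mulrAC; apply: ler_pM => //.
  rewrite -(subrK Q'.[x] (g x)); apply: le_trans (ler_normD _ _) _; apply: lerD => //.
  by apply: le_trans h2 _; rewrite ler_piMr.
by rewrite -mulrA; apply: ler_pM.
Qed.

Lemma taylorK_cst K (c : R) : taylorK K (fun=> c).
Proof.
exists c%:P, 0, 1; split=> // x _.
by rewrite hornerC subrr normr0 mul0r.
Qed.

Lemma poly_primitive (Q : {poly R}) : exists2 P : {poly R}, P^`() = Q & P.[0] = 0.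
Proof.
exists (\sum_(i < size Q) (Q`_i / i.+1%:R) *: 'X^(i.+1)); last first.
  rewrite horner_sum big1// => i _.
  by rewrite hornerZ hornerXn exprS mul0r mulr0.
rewrite raddf_sum/= -[RHS]coefK poly_def; apply: eq_bigr => i _.
rewrite derivZ derivXn/= -scalerMnr scalerMnl; congr (_ *: _).
by rewrite -[LHS]mulr_natr divfK// pnatr_eq0.
Qed.

Lemma taylorK_primitive K f df (d : R) : 0 < d ->
  (forall x, `|x| <= d -> is_derive x 1 f (df x)) -> taylorK K df -> taylorK K.+1 f.
Proof.
move=> d0 fdf [Q [C [d' [C0 d'0 H]]]].
have [P PQ P0] := poly_primitive Q.
exists ((f 0)%:P + P), C, (Num.min d d'); split=> //; first by rewrite lt_min d0.
move=> x; rewrite le_min => /andP[xd xd'].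
have dg z : `|z| <= `|x| -> is_derive z 1 (f - horner P) (df z - Q.[z]).
  move=> zx; rewrite -PQ; apply: is_deriveB.
  by apply: fdf; apply: le_trans xd.
have [c cx] := MVT0 dg (lexx _).
rewrite !fctE P0 subr0 hornerD hornerC => E.
have -> : f x - (f 0 + P.[x]) = (df c - Q.[c]) * x by rewrite -E; ring.
rewrite normrM exprSr mulrA ler_wpM2r//; apply: le_trans (H _ (le_trans cx xd')) _.
by rewrite ler_wpM2l// lerXn2r ?nnegrE.
Qed.

Lemma taylor_inv1D : taylor (fun x => (1 + x)^-1).
Proof.
move=> K; exists (\sum_(i < K) (-1) ^+ i *: 'X^i), 2, (1 / 2); split=> //.
move=> x; rewrite ler_norml => /andP[x1 x2].
have p : 0 < 1 + x by lra.
have -> : (\sum_(i < K) (-1) ^+ i *: 'X^i).[x] = \sum_(i < K) (- x) ^+ i.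
  rewrite horner_sum; apply: eq_bigr => i _.
  by rewrite hornerZ hornerXn -exprMn mulN1r.
have H := subrX1 (- x) K.
have -> : (1 + x)^-1 - \sum_(i < K) (- x) ^+ i = (1 + x)^-1 * (- x) ^+ K.
  apply: (mulfI (lt0r_neq0 p)); rewrite mulrA mulfV ?gt_eqF// mul1r mulrBr mulfV ?gt_eqF//.
  have -> : (1 + x) * (\sum_(i < K) (- x) ^+ i) = - ((- x - 1) * \sum_(i < K) (- x) ^+ i) by ring.
  by rewrite -H; ring.
rewrite normrM normrX normrN ler_wpM2r ?exprn_ge0//.
have v0 : 0 <= (1 + x)^-1 by rewrite invr_ge0 ltW.
by rewrite (ger0_norm v0) invf_ple ?posrE//; lra.
Qed.

(** [(1 + x)^a] near 0, in a form that differentiates directly; see [pow1_powR]. *)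
Definition pow1 (a : R) x : R := expR (a * ln (1 + x)).

Lemma is_derive_pow1 a x : `|x| <= 1 / 2 ->
  is_derive x 1 (pow1 a) (a * (1 + x)^-1 * pow1 a x).
Proof.
rewrite ler_norml => /andP[x1 x2]; have p : 0 < 1 + x by lra.
have d1 : is_derive x 1 (fun x => 1 + x) 1.
  have := is_deriveD (is_derive_cst (1 : R) x 1) (is_derive_id x 1).
  by move=> /trigger_derive; apply; rewrite add0r.
have d2 := @is_derive1_comp _ (@ln R) _ x _ _ (is_derive1_ln p) d1.
have d3 := is_deriveZ a d2.
have := @is_derive1_comp _ expR _ x _ _ (is_derive_expR _) d3.
move=> /trigger_derive; apply.
by rewrite /pow1 /GRing.scale/= mulr1 mulrC.
Qed.

(** The equation [f' = a f / (1 + x)] bootstraps: order [K] for [f] gives order [K] for [f'], hence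
    order [K + 1] for [f]. *)
Lemma taylor_pow1 a : taylor (pow1 a).
Proof.
elim=> [|K IH].
  exists 0, (expR `|a|), (1 / 2); split=> //.
  move=> x x2; rewrite horner0 subr0 expr0 mulr1 ger0_norm ?expR_ge0//.
  rewrite ler_expR; apply: le_trans (ler_norm _) _; rewrite normrM ler_piMr//.
  by apply: le_trans (norm_ln1D x2) _; lra.
apply: (@taylorK_primitive _ _ (fun x => a * (1 + x)^-1 * pow1 a x) (1 / 2)) => //.
  by move=> x x2; exact: is_derive_pow1.
apply: taylorKM => //; apply: taylorKM; first exact: taylorK_cst.
exact: taylor_inv1D.
Qed.

Lemma taylor_expR : taylor (@expR R).
Proof.
move=> K; exists (\sum_(i < K) (i`!%:R)^-1 *: 'X^i), (expR 1), 1; split=> //.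
move=> x x1; have := expR_taylor K x1.
rewrite horner_sum.
have -> : \sum_(i < K) (((i`!%:R)^-1 *: 'X^i) : {poly R}).[x] = \sum_(k < K) x ^+ k / k`!%:R.
  by apply: eq_bigr => i _; rewrite hornerZ hornerXn mulrC.
by [].
Qed.

Lemma taylor_cos : taylor (@cos R).
Proof.
move=> K; exists (\sum_(i < K) (cos_shift (0 + i) 0 / i`!%:R) *: 'X^i), 1, 1; split=> //.
move=> x _; have := cos_taylor 0 K x; rewrite cos_shift0 mul1r.
rewrite horner_sum.
have -> : \sum_(i < K) ((cos_shift (0 + i) 0 / i`!%:R *: 'X^i) : {poly R}).[x] =
    \sum_(k < K) cos_shift (0 + k) 0 * x ^+ k / k`!%:R.
  by apply: eq_bigr => i _; rewrite hornerZ hornerXn mulrAC.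
by [].
Qed.

End taylor_classes.

(** * Functions of [n] and [t] up to powers of [w] *)

Section asymptotic_class.
Context {R : realType}.
Implicit Types (f g h : nat -> R -> R) (K M n : nat) (t : R).

(* All the scales of the problem are powers of [n^(-1/16)]: the radius is at [y ~ gw n ^+ 8],
   angles are rescaled by [gw n ^+ 12] and cut off at [1 / gw n], where the Gaussian is
   already flat. *)
Definition gw n : R := n%:R `^ (- (1 / 16)).

Lemma gw_gt0 n : (0 < n)%N -> 0 < gw n.
Proof. by move=> n0; rewrite powR_gt0// ltr0n. Qed.

Lemma gw_ge0 n : 0 <= gw n. Proof. exact: powR_ge0. Qed.

Lemma gw_pow16 n : gw n ^+ 16 = n%:R^-1.
Proof.
rewrite -powR_mulrn ?gw_ge0// -powRrM mulNr div1r mulVf// powR_inv1//.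
Qed.

Lemma gw_le1 n : (0 < n)%N -> gw n <= 1.
Proof.
move=> n0; rewrite -(@ler_pXn2r _ 16) ?nnegrE ?gw_ge0// gw_pow16 expr1n.
by rewrite invf_le1 ?ltr0n// ler1n.
Qed.

Lemma gw_small (d : R) : 0 < d -> exists N, forall n, (N <= n)%N -> gw n <= d.
Proof.
move=> d0; exists (Num.bound (d ^- 16)).+1 => n Nn.
have n0 : (0 < n)%N by apply: leq_trans Nn.
rewrite -(@ler_pXn2r _ 16) ?nnegrE ?gw_ge0// ?(ltW d0)// gw_pow16.
rewrite -[leRHS]invrK lef_pV2 ?posrE ?ltr0n ?invr_gt0 ?exprn_gt0//.
apply: ltW; apply: lt_le_trans (archi_boundP _) _; first by rewrite invr_ge0 exprn_ge0// ltW.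
by rewrite ler_nat ltnW.
Qed.

(* [f n t = O(gw n ^+ K)], uniformly for [t] below the cutoff. *)
Definition bigw K f := exists (C : R) N, 0 <= C /\
  forall n t, (N <= n)%N -> `|t| <= (gw n)^-1 -> `|f n t| <= C * gw n ^+ K.

Lemma bigw_ext K f g : (exists N, forall n t, (N <= n)%N -> `|t| <= (gw n)^-1 ->
  f n t = g n t) -> bigw K f -> bigw K g.
Proof.
move=> [N1 E] [C [N [C0 H]]]; exists C, (N + N1)%N; split=> // n t Nn tn.
rewrite -E//; last by rewrite (leq_trans (leq_addl _ _) Nn).
by apply: H => //; rewrite (leq_trans (leq_addr _ _) Nn).
Qed.

Lemma bigwD K f g : bigw K f -> bigw K g -> bigw K (fun n t => f n t + g n t).
Proof.
move=> [C [N [C0 H]]] [C' [N' [C'0 H']]]; exists (C + C'), (N + N')%N.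
split=> [|n t Nn tn]; first by rewrite addr_ge0.
apply: le_trans (ler_normD _ _) _; rewrite mulrDl; apply: lerD.
  by apply: H => //; rewrite (leq_trans (leq_addr _ _) Nn).
by apply: H' => //; rewrite (leq_trans (leq_addl _ _) Nn).
Qed.

Lemma bigwM K K' f g : bigw K f -> bigw K' g ->
  bigw (K + K') (fun n t => f n t * g n t).
Proof.
move=> [C [N [C0 H]]] [C' [N' [C'0 H']]]; exists (C * C'), (N + N')%N.
split=> [|n t Nn tn]; first by rewrite mulr_ge0.
rewrite normrM exprD mulrACA; apply: ler_pM => //.
  by apply: H => //; rewrite (leq_trans (leq_addr _ _) Nn).
by apply: H' => //; rewrite (leq_trans (leq_addl _ _) Nn).
Qed.

Lemma bigw_le K K' f : (K' <= K)%N -> bigw K f -> bigw K' f.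
Proof.
move=> KK [C [N [C0 H]]]; exists C, N.+1; split=> // n t Nn tn.
apply: le_trans (H _ _ (ltnW Nn) tn) _; rewrite ler_wpM2l// ler_wiXn2l ?gw_ge0//.
by rewrite gw_le1// (leq_trans _ Nn).
Qed.

Lemma bigwZ K (c : R) f : bigw K f -> bigw K (fun n t => c * f n t).
Proof.
move=> [C [N [C0 H]]]; exists (`|c| * C), N; split=> [|n t Nn tn].
  by rewrite mulr_ge0.
by rewrite normrM -mulrA ler_wpM2l// H.
Qed.

Lemma bigw_cst (c : R) : bigw 0 (fun _ _ => c).
Proof. by exists `|c|, 0%N; split=> // n t _ _; rewrite expr0 mulr1. Qed.

Lemma bigw_gw K : bigw K (fun n _ => gw n ^+ K).
Proof. by exists 1, 0%N; split=> // n t _ _; rewrite mul1r ger0_norm// exprn_ge0// gw_ge0. Qed.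

(** [f = O(w^(-M))], without negative exponents. *)
Definition grows M f := bigw 0 (fun n t => gw n ^+ M * f n t).

Lemma grows_mul M K f g : grows M f -> bigw (K + M) g -> bigw K (fun n t => f n t * g n t).
Proof.
move=> [C [N [C0 H]]] [C' [N' [C'0 H']]]; exists (C * C'), (N + N')%N.
split=> [|n t Nn tn]; first by rewrite mulr_ge0.
have h1 := H n t (leq_trans (leq_addr _ _) Nn) tn.
have h2 := H' n t (leq_trans (leq_addl _ _) Nn) tn.
rewrite expr0 mulr1 normrM in h1.
have w0 : 0 <= gw n ^+ M by rewrite exprn_ge0// gw_ge0.
rewrite normrM; apply: le_trans (ler_wpM2l (normr_ge0 _) h2) _.
rewrite exprD; have -> : `|f n t| * (C' * (gw n ^+ K * gw n ^+ M)) =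
  (gw n ^+ M * `|f n t|) * (C' * gw n ^+ K) by ring.
rewrite -[leRHS]mulrA; apply: ler_wpM2r.
  by apply: mulr_ge0 => //; rewrite exprn_ge0 ?gw_ge0.
by rewrite (ger0_norm w0) in h1.
Qed.

Lemma grows_le M M' f : (M <= M')%N -> grows M f -> grows M' f.
Proof.
move=> MM [C [N [C0 H]]]; exists C, N.+1; split=> // n t Nn tn.
apply: le_trans (H _ _ (ltnW Nn) tn); rewrite !normrM ler_wpM2r//.
rewrite !ger0_norm ?exprn_ge0 ?gw_ge0// ler_wiXn2l ?gw_ge0// gw_le1//.
by rewrite (leq_trans _ Nn).
Qed.

Lemma growsD M f g : grows M f -> grows M g -> grows M (fun n t => f n t + g n t).
Proof.
move=> gf gg; apply: bigw_ext (bigwD gf gg).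
by exists 0%N => n t _ _; rewrite mulrDr.
Qed.

Lemma growsM M M' f g : grows M f -> grows M' g -> grows (M + M') (fun n t => f n t * g n t).
Proof.
move=> gf gg; have := bigwM gf gg; rewrite addn0; apply: bigw_ext.
by exists 0%N => n t _ _; rewrite exprD mulrACA.
Qed.

Lemma bigw_grows K f : bigw K f -> grows 0 f.
Proof.
move=> /(bigw_le (leq0n K)); apply: bigw_ext.
by exists 0%N => n t _ _; rewrite expr0 mul1r.
Qed.

Section asy.
Context (P : (nat -> R -> R) -> Prop).

(** Shared by polynomials in [w] (after integration) and polynomials in [w] and [t] (before it). The
    growth condition is what lets approximations be multiplied. *)
Record alg : Prop := Alg {
  alg_cst : forall c : R, P (fun _ _ => c);
  alg_gw : P (fun n _ => gw n);
  alg_add : forall f g, P f -> P g -> P (fun n t => f n t + g n t);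
  alg_mul : forall f g, P f -> P g -> P (fun n t => f n t * g n t);
  alg_grows : forall f, P f -> exists M, grows M f }.

Context (algP : alg).

(* [f] is approximated to every order in [gw n] by elements of [P]. *)
Definition asy f := forall K, exists2 g, P g & bigw K (fun n t => f n t - g n t).

Lemma asy_alg f : P f -> asy f.
Proof.
move=> Pf K; exists f => //; exists 0, 0%N; split=> // n t _ _.
by rewrite subrr normr0 mul0r.
Qed.

Lemma asy_cst (c : R) : asy (fun _ _ => c).
Proof. exact/asy_alg/alg_cst. Qed.

Lemma asy_gw : asy (fun n _ => gw n).
Proof. exact/asy_alg/alg_gw. Qed.

Lemma asy_ext f g : (exists N, forall n t, (N <= n)%N -> `|t| <= (gw n)^-1 ->
  f n t = g n t) -> asy f -> asy g.
Proof.
move=> [N E] af K; have [h Ph Hh] := af K; exists h => //.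
by apply: bigw_ext Hh; exists N => n t Nn tn; rewrite E.
Qed.

Lemma asyD f g : asy f -> asy g -> asy (fun n t => f n t + g n t).
Proof.
move=> af ag K; have [f' Pf Hf] := af K; have [g' Pg Hg] := ag K.
exists (fun n t => f' n t + g' n t); first exact: alg_add.
apply: bigw_ext (bigwD Hf Hg); exists 0%N => n t _ _; ring.
Qed.

Lemma asy_grows f : asy f -> exists M, grows M f.
Proof.
move=> af; have [g Pg Hg] := af 0%N; have [M HM] := alg_grows algP Pg.
exists M; have := growsD (grows_le (leq0n M) (bigw_grows Hg)) HM.
by apply: bigw_ext; exists 0%N => n t _ _; rewrite subrK.
Qed.

(** Each error is multiplied by a factor that may grow, so the approximants are taken to a precision
    that exceeds [K] by the orders of growth. *)
Lemma asyM f g : asy f -> asy g -> asy (fun n t => f n t * g n t).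
Proof.
move=> af ag K.
have [M Mf] := asy_grows af; have [M' Mg] := asy_grows ag.
have [f' Pf Hf] := af (K + M' + M)%N; have [g' Pg Hg] := ag (K + M)%N.
exists (fun n t => f' n t * g' n t); first exact: alg_mul.
have Mg' : grows M' g'.
  have := growsD Mg (grows_le (leq0n M') (bigw_grows (bigwZ (-1) Hg))).
  by apply: bigw_ext; exists 0%N => n t _ _; rewrite mulN1r opprB addrC subrK.
have h1 := grows_mul Mf Hg.
have Hf' : bigw (K + M') (fun n t => f n t - f' n t).
  by apply: bigw_le Hf; exact: leq_addr.
have h2 := grows_mul Mg' Hf'.
apply: bigw_ext (bigwD h1 h2); exists 0%N => n t _ _; ring.
Qed.

Lemma asyZ (c : R) f : asy f -> asy (fun n t => c * f n t).
Proof. by move=> af; apply: asyM => //; exact: asy_cst. Qed.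

Lemma asyB f g : asy f -> asy g -> asy (fun n t => f n t - g n t).
Proof.
move=> af ag; have := asyD af (asyZ (-1) ag); apply: asy_ext.
by exists 0%N => n t _ _; rewrite mulN1r.
Qed.

Lemma asyX K f : asy f -> asy (fun n t => f n t ^+ K).
Proof.
move=> af; elim: K => [|K IH].
  by have := asy_cst 1; apply: asy_ext; exists 0%N => n t _ _; rewrite expr0.
have := asyM af IH; apply: asy_ext.
by exists 0%N => n t _ _; rewrite exprS.
Qed.

Lemma asy_sum (I : Type) (s : seq I) (f : I -> nat -> R -> R) :
  (forall i, asy (f i)) -> asy (fun n t => \sum_(i <- s) f i n t).
Proof.
move=> af; elim: s => [|i s IH].
  by have := asy_cst 0; apply: asy_ext; exists 0%N => n t _ _; rewrite big_nil.
have := asyD (af i) IH; apply: asy_ext.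
by exists 0%N => n t _ _; rewrite big_cons.
Qed.

Lemma asy_horner (Q : {poly R}) f : asy f -> asy (fun n t => Q.[f n t]).
Proof.
move=> af; have := @asy_sum _ (index_enum 'I_(size Q)) (fun i n t => Q`_i * f n t ^+ i).
move=> /(_ (fun i => asyZ _ (asyX _ af))); apply: asy_ext.
by exists 0%N => n t _ _; rewrite horner_coef.
Qed.

Lemma asy_approx f : (forall K, exists2 g, asy g & bigw K (fun n t => f n t - g n t)) ->
  asy f.
Proof.
move=> H K; have [g ag Hg] := H K; have [h Ph Hh] := ag K; exists h => //.
by apply: bigw_ext (bigwD Hg Hh); exists 0%N => n t _ _; ring.
Qed.

Lemma asy_flat f : (forall K, bigw K f) -> asy f.
Proof.
move=> H; apply: asy_approx => K; exists (fun _ _ => 0); first exact: asy_cst.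
by apply: bigw_ext (H K); exists 0%N => n t _ _; rewrite subr0.
Qed.

(** As [f = O(w)], order [K] in the argument of [phi] is order [K] in [w]. *)
Lemma asy_taylor (phi : R -> R) f : taylor phi -> asy f -> bigw 1 f ->
  asy (fun n t => phi (f n t)).
Proof.
move=> Tphi af [C [N [C0 H]]]; apply: asy_approx => K.
have [Q [C' [d [C'0 d0 HQ]]]] := Tphi K.
exists (fun n t => Q.[f n t]); first exact: asy_horner.
have dC : 0 < d / (C + 1) by rewrite divr_gt0// ltr_wpDl.
have [N' HN'] := gw_small dC.
exists (C' * C ^+ K), (N + N')%N; split=> [|n t Nn tn].
  by rewrite mulr_ge0// exprn_ge0.
have h := H n t (leq_trans (leq_addr _ _) Nn) tn; rewrite expr1 in h.
have := HN' n (leq_trans (leq_addl _ _) Nn); rewrite ler_pdivlMr ?ltr_wpDl// => wd.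
have w0 := gw_ge0 n.
have fd : `|f n t| <= d by apply: le_trans h _; nra.
apply: le_trans (HQ _ fd) _; rewrite -mulrA -exprMn ler_wpM2l//.
by rewrite lerXn2r// nnegrE mulr_ge0.
Qed.

End asy.

End asymptotic_class.

(** * Polynomials in [w], polynomials in [w] and [t], and division by powers of [w] *)

Section algebras.
Context {R : realType}.
Implicit Types (f g h : nat -> R -> R) (K M n : nat) (t : R).

Definition Pw f := exists Q : {poly R}, f = fun n _ => Q.[gw n].

(** The outer indeterminate stands for [w], the inner one for [t]. *)
Definition Pwt f := exists W : {poly {poly R}}, f = fun n t => W.[(gw n)%:P].[t].

Lemma grows_cst (c : R) : grows 0 (fun _ _ => c).
Proof. exact: (bigw_grows (bigw_cst c)). Qed.

Lemma grows_gw : grows 0 (fun n _ => gw n : R).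
Proof. by have := bigw_grows (@bigw_gw R 1); apply: bigw_ext; exists 0%N => n t _ _. Qed.

Lemma bigw_gwt : bigw 0 (fun n t => gw n * t : R).
Proof.
exists 1, 1%N; split=> // n t n0 tn; rewrite expr0 mulr1 normrM ger0_norm ?gw_ge0//.
by rewrite -ler_pdivlMl ?gw_gt0// mulr1.
Qed.

Lemma grows_t : grows 1 (fun _ t => t : R).
Proof. by have := bigw_gwt; apply: bigw_ext; exists 0%N => n t _ _; rewrite expr1. Qed.

Definition grows_some f := exists M, grows M f.

Lemma grows_someD f g : grows_some f -> grows_some g ->
  grows_some (fun n t => f n t + g n t).
Proof.
move=> [M HM] [M' HM']; exists (M + M')%N; apply: growsD.
  exact: grows_le (leq_addr _ _) HM.
exact: grows_le (leq_addl _ _) HM'.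
Qed.

Lemma grows_someM f g : grows_some f -> grows_some g ->
  grows_some (fun n t => f n t * g n t).
Proof. by move=> [M HM] [M' HM']; exists (M + M')%N; apply: growsM. Qed.

Lemma grows_some_cst (c : R) : grows_some (fun _ _ => c).
Proof. by exists 0%N; exact: grows_cst. Qed.

Lemma grows_some_sum (N : nat) (f : nat -> nat -> R -> R) :
  (forall i, grows_some (f i)) -> grows_some (fun n t => \sum_(i < N) f i n t).
Proof.
move=> gf; elim: N => [|N IH].
  have [M HM] := grows_some_cst 0; exists M; apply: bigw_ext HM.
  by exists 0%N => n t _ _; rewrite big_ord0.
have [M HM] := grows_someD IH (gf N); exists M; apply: bigw_ext HM.
by exists 0%N => n t _ _; rewrite big_ord_recr.
Qed.

Lemma grows_someX (k : nat) f : grows_some f -> grows_some (fun n t => f n t ^+ k).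
Proof.
move=> gf; elim: k => [|k IH].
  have [M HM] := grows_some_cst 1; exists M; apply: bigw_ext HM.
  by exists 0%N => n t _ _; rewrite expr0.
have [M HM] := grows_someM gf IH; exists M; apply: bigw_ext HM.
by exists 0%N => n t _ _; rewrite exprS.
Qed.

Lemma horner2E (W : {poly {poly R}}) (x t : R) :
  W.[x%:P].[t] = \sum_(i < size W) (\sum_(j < size W`_i) (W`_i)`_j * t ^+ j) * x ^+ i.
Proof.
rewrite (horner_coef W) horner_sum; apply: eq_bigr => i _.
by rewrite hornerM -rmorphXn/= hornerC horner_coef.
Qed.

Lemma alg_Pwt : alg Pwt.
Proof.
split.
- by move=> c; exists c%:P%:P; apply/funext => n; apply/funext => t; rewrite !hornerC.
- by exists 'X; apply/funext => n; apply/funext => t; rewrite hornerX hornerC.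
- move=> _ _ [W ->] [V ->]; exists (W + V).
  by apply/funext => n; apply/funext => t; rewrite !hornerD.
- move=> _ _ [W ->] [V ->]; exists (W * V).
  by apply/funext => n; apply/funext => t; rewrite !hornerM.
- move=> _ [W ->].
  have gr : grows_some (fun n t =>
      \sum_(i < size W) (\sum_(j < size W`_i) (W`_i)`_j * t ^+ j) * gw n ^+ i).
    apply: (@grows_some_sum _ (fun i n t => (\sum_(j < size W`_i) (W`_i)`_j * t ^+ j) * gw n ^+ i)).
    move=> i; apply: grows_someM.
      apply: (@grows_some_sum _ (fun j n t => (W`_i)`_j * t ^+ j)) => j.
      apply: grows_someM; first exact: grows_some_cst.
      by apply: (@grows_someX _ (fun _ t => t)); exists 1%N; exact: grows_t.
    by apply: (@grows_someX _ (fun n _ => gw n)); exists 0%N; exact: grows_gw.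
  have [M HM] := gr; exists M; apply: bigw_ext HM.
  by exists 0%N => n t _ _; rewrite horner2E.
Qed.

Lemma Pwt_t : Pwt (fun _ t => t).
Proof. by exists 'X%:P; apply/funext => n; apply/funext => t; rewrite hornerC hornerX. Qed.

Lemma Pw_Pwt f : Pw f -> Pwt f.
Proof.
move=> [Q ->]; exists (map_poly polyC Q); apply/funext => n; apply/funext => t.
by rewrite horner_map/= hornerC.
Qed.

Lemma alg_Pw : alg Pw.
Proof.
split.
- by move=> c; exists c%:P; apply/funext => n; apply/funext => t; rewrite !hornerC.
- by exists 'X; apply/funext => n; apply/funext => t; rewrite hornerX.
- move=> _ _ [W ->] [V ->]; exists (W + V).
  by apply/funext => n; apply/funext => t; rewrite !hornerD.
- move=> _ _ [W ->] [V ->]; exists (W * V).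
  by apply/funext => n; apply/funext => t; rewrite !hornerM.
- by move=> f /Pw_Pwt; exact: alg_grows alg_Pwt _.
Qed.

Lemma asy_Pw_Pwt f : asy Pw f -> asy Pwt f.
Proof. by move=> af K; have [g /Pw_Pwt Pg Hg] := af K; exists g. Qed.

(** [Q.[gw n]] tends to the constant coefficient and, being [O(w)], to 0. *)
Lemma bigw_poly_coef0 (Q : {poly R}) M : bigw M.+1 (fun n _ => Q.[gw n]) -> Q`_0 = 0.
Proof.
move=> [C [N [C0 H]]].
have [B B0 HB] := poly_locally_bounded (Q %/ 'X) 1.
apply/eqP; rewrite -normr_le0; apply/ler_addgt0Pr => e e0; rewrite add0r.
have d0 : 0 < e / (C + B + 1) by rewrite divr_gt0// ltr_wpDl ?addr_ge0.
have [N' HN'] := gw_small d0.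
pose n := (N + N').+1.
have Nn : (N <= n)%N by rewrite (leq_trans (leq_addr N' N)).
have Nn' : (N' <= n)%N by rewrite (leq_trans (leq_addl N N')).
have w0 : 0 < gw n :> R by exact: gw_gt0.
have w1 : gw n <= 1 :> R by exact: gw_le1.
have := HN' n Nn'; rewrite ler_pdivlMr ?ltr_wpDl ?addr_ge0// => we.
have h := H n 0 Nn; rewrite normr0 invr_ge0 ltW// in h.
have {}h := h isT.
have QE : Q = (Q %/ 'X) * 'X + (Q`_0)%:P.
  rewrite {1}(divp_eq Q 'X); congr (_ + _).
  by rewrite -['X]subr0 -(polyC0 R) modp_XsubC horner_coef0.
have E : Q`_0 = Q.[gw n] - (Q %/ 'X).[gw n] * gw n.
  by rewrite {2}QE hornerD hornerM hornerX hornerC; ring.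
rewrite E; apply: le_trans (ler_normB _ _) _.
rewrite normrM (ger0_norm (ltW w0)).
have b := HB (gw n); rewrite (ger0_norm (ltW w0)) in b; have {}b := b w1.
have wM : gw n ^+ M.+1 <= gw n :> R by rewrite exprS ler_piMr ?(ltW w0)// exprn_ile1// ltW.
have := ler_wpM2l C0 wM; have := ler_wpM2r (ltW w0) b.
move: h; set q := `|Q.[gw n]|; set r := `|_|; move=> *; lra.
Qed.

Lemma bigw_poly_div (Q : {poly R}) M : bigw M (fun n _ => Q.[gw n]) ->
  exists Q' : {poly R}, Q = Q' * 'X^M.
Proof.
elim: M Q => [|M IH] Q H; first by exists Q; rewrite expr0 mulr1.
have Q0 := bigw_poly_coef0 H.
have QE : Q = (Q %/ 'X) * 'X.
  have M0 : Q %% 'X = 0.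
    by rewrite -['X]subr0 -(polyC0 R) modp_XsubC horner_coef0 Q0.
  by rewrite {1}(divp_eq Q 'X) M0 addr0.
have [|Q' E] := IH (Q %/ 'X).
  have [C [N [C0 HC]]] := H; exists C, N.+1; split=> // n t Nn tn.
  have w0 : 0 < gw n :> R by apply: gw_gt0; exact: leq_trans Nn.
  have := HC n t (ltnW Nn) tn; rewrite {1}QE hornerM hornerX normrM (ger0_norm (ltW w0)).
  by rewrite exprSr mulrA ler_pM2r.
by exists Q'; rewrite {1}QE E exprSr mulrA.
Qed.

(** Renormalises after a cancellation: a polynomial approximant that is itself [O(w^M)] is divisible
    by [X^M]. *)
Lemma asy_Pw_div M f : asy Pw f -> bigw M f -> asy Pw (fun n t => f n t / gw n ^+ M).
Proof.
move=> af Hf K; have [_ [Q ->] H] := af (K + M)%N.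
have HQ : bigw M (fun n _ => Q.[gw n]).
  have := bigwD Hf (bigwZ (-1) (bigw_le (leq_addl K M) H)).
  by apply: bigw_ext; exists 0%N => n t _ _; rewrite mulN1r opprB addrC subrK.
have [Q' QE] := bigw_poly_div HQ.
exists (fun n _ => Q'.[gw n]); first by exists Q'.
have [C [N [C0 HC]]] := H; exists C, N.+1; split=> // n t Nn tn.
have w0 : 0 < gw n ^+ M :> R by rewrite exprn_gt0//; apply: gw_gt0; exact: leq_trans Nn.
have := HC n t (ltnW Nn) tn; rewrite QE hornerM hornerXn exprD.
have -> : f n t - Q'.[gw n] * gw n ^+ M = (f n t / gw n ^+ M - Q'.[gw n]) * gw n ^+ M.
  by rewrite mulrBl divfK// gt_eqF.
by rewrite normrM (ger0_norm (ltW w0)) mulrA ler_pM2r.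
Qed.

Lemma bigw_div M K f : bigw (K + M) f -> bigw K (fun n t => f n t / gw n ^+ M).
Proof.
move=> [C [N [C0 HC]]]; exists C, N.+1; split=> // n t Nn tn.
have w0 : 0 < gw n ^+ M :> R by rewrite exprn_gt0//; apply: gw_gt0; exact: leq_trans Nn.
rewrite normrM normfV (ger0_norm (ltW w0)) ler_pdivrMr// -mulrA -exprD.
by apply: HC => //; exact: ltnW.
Qed.

End algebras.

(** * The saddle point *)

Section gaussian_moments.
Context {R : realType}.
Implicit Types (x y z t : R) (K M n : nat).

(** For [x >= 1] the primitive increases and its sum with [exp(-x^2)] decreases, so the limit lies
    between them. *)
Lemma gauss_prim_tail : exists G : R -> R,
  [/\ forall x, is_derive x 1 G (expR (- x ^+ 2)),
      forall x, G (- x) = - G x &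
      forall x, 1 <= x -> `|G x - Num.sqrt pi / 2| <= expR (- x ^+ 2)].
Proof.
have [G [dG Godd Glim]] := @gauss_prim R; exists G; split=> // x x1.
have cG : (fun n : nat => G n%:R) @ \oo --> Num.sqrt pi / 2.
  by apply: (@cvg_comp _ _ _ (fun n : nat => n%:R) G _ _ _ _ Glim); exact: cvgr_idn.
have mono z : x <= z -> G x <= G z <= G x + expR (- x ^+ 2).
  move=> xz; apply/andP; split.
    have [c _] := MVT_is_derive xz (fun y _ => dG y).
    have : 0 <= expR (- c ^+ 2) * (z - x) by rewrite mulr_ge0 ?expR_ge0 ?subr_ge0.
    lra.
  have dE y : is_derive y 1 (fun y => expR (- y ^+ 2)) (expR (- y ^+ 2) * (- (2 * y))).
    have d1 : is_derive y 1 (fun y => - y ^+ 2) (- (2 * y)).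
      have -> : (fun y => - y ^+ 2) = horner (- 'X^2).
        by apply/funext => w; rewrite hornerN hornerXn.
      have -> : - (2 * y) = (- 'X^2)^`().[y].
        by rewrite derivN derivXn hornerN hornerMn hornerX mulr_natl.
      exact: is_derive_poly.
    have := @is_derive1_comp _ expR _ y _ _ (is_derive_expR _) d1.
    by [].
  have dS y : is_derive y 1 (G + (fun y => expR (- y ^+ 2)))
      (expR (- y ^+ 2) + expR (- y ^+ 2) * (- (2 * y))).
    exact: is_deriveD.
  have [c /andP[xc _]] := MVT_is_derive xz (fun y _ => dS y).
  rewrite !fctE => E.
  have e1 := expR_ge0 (- c ^+ 2); have e2 := expR_ge0 (- z ^+ 2).
  have : (expR (- c ^+ 2) + expR (- c ^+ 2) * - (2 * c)) * (z - x) <= 0.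
    by rewrite mulr_le0_ge0 ?subr_ge0//; nra.
  by rewrite -E; lra.
have b1 : G x <= Num.sqrt pi / 2.
  rewrite -(cvg_lim (@Rhausdorff R) cG); apply: limr_ge; first by apply/cvg_ex; eexists; exact: cG.
  have := nbhs_infty_ger x; apply: filterS => n xn.
  by have /andP[] := mono _ xn.
have b2 : Num.sqrt pi / 2 <= G x + expR (- x ^+ 2).
  rewrite -(cvg_lim (@Rhausdorff R) cG); apply: limr_le; first by apply/cvg_ex; eexists; exact: cG.
  have := nbhs_infty_ger x; apply: filterS => n xn.
  by have /andP[] := mono _ xn.
have := expR_ge0 (- x ^+ 2).
by rewrite ler_norml => ?; apply/andP; split; lra.
Qed.

Lemma bigw_exp_tail (c : R) K : 0 < c -> bigw K (fun n _ => expR (- (c / gw n ^+ 2))).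
Proof.
move=> c0; have [C C0 H] := poly_gauss_bounded ('X^K : {poly R}).
pose s := Num.sqrt (2 * c).
have s0 : 0 < s by rewrite sqrtr_gt0 mulr_gt0.
have s2 : s ^+ 2 = 2 * c by rewrite sqr_sqrtr// mulr_ge0// ltW.
exists (C / s ^+ K), 1%N; split; first by rewrite divr_ge0// exprn_ge0// ltW.
move=> n t n0 _; have w0 : 0 < gw n :> R by exact: gw_gt0.
rewrite ger0_norm ?expR_ge0//.
have E : (s * (gw n)^-1) ^+ 2 / 2 = c / gw n ^+ 2.
  rewrite [(s * _) ^+ 2]exprMn s2 exprVn; field.
  by rewrite gt_eqF.
have u0 : 0 < s * (gw n)^-1 by rewrite divr_gt0.
have := H (s * (gw n)^-1); rewrite E hornerXn gtr0_norm ?exprn_gt0//.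
rewrite -ler_pdivlMl ?exprn_gt0// => h; apply: le_trans h _.
rewrite le_eqVlt; apply/orP; left; apply/eqP.
move: (gw n) w0 => w w0; move: s s0 {s2 E u0} => s s0.
rewrite exprMn exprVn; field.
by rewrite !expf_neq0// gt_eqF.
Qed.

Context (a : R) (a0 : 0 < a).

Definition ga t : R := expR (- (a * t ^+ 2 / 2)).

Lemma ga_ge0 t : 0 <= ga t. Proof. exact: expR_ge0. Qed.

Lemma is_derive_ga t : is_derive t 1 ga (- (a * t) * ga t).
Proof.
have d1 : is_derive t 1 (fun t => - (a * t ^+ 2 / 2)) (- (a * t)).
  have -> : (fun t => - (a * t ^+ 2 / 2)) = horner (- ((a / 2) *: 'X^2)).
    by apply/funext => z; rewrite hornerN hornerZ hornerXn mulrAC.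
  have -> : - (a * t) = (- ((a / 2) *: 'X^2))^`().[t].
    rewrite derivN derivZ derivXn hornerN hornerZ hornerMn hornerX.
    by rewrite -mulr_natr; field.
  exact: is_derive_poly.
have := @is_derive1_comp _ expR _ t _ _ (is_derive_expR _) d1.
by move=> /trigger_derive; apply; rewrite mulrC.
Qed.

Lemma is_derive_gaX j t : is_derive t 1 (fun t => ga t * t ^+ j)
  (j%:R * (ga t * t ^+ j.-1) - a * (ga t * t ^+ j.+1)).
Proof.
have -> : (fun t => ga t * t ^+ j) = ga * horner 'X^j.
  by apply/funext => z; rewrite !fctE hornerXn.
have := is_deriveM (is_derive_ga t) (is_derive_poly 'X^j t).
move=> /trigger_derive; apply.
rewrite derivXn hornerMn !hornerXn /GRing.scale/= -mulr_natr exprS; ring.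
Qed.

Lemma has_prim_gaX j : has_prim (fun t => ga t * t ^+ j).
Proof. exact/continuous_has_prim/(is_derive_continuous (is_derive_gaX j)). Qed.

Lemma has_prim_ga : has_prim ga.
Proof. exact/continuous_has_prim/(is_derive_continuous is_derive_ga). Qed.

Lemma ga_cutoff n : ga (gw n)^-1 = expR (- (a / 2 / gw n ^+ 2)).
Proof. by rewrite /ga exprVn mulrAC. Qed.

Lemma bigw_cst_diff (f : nat -> R -> R) (mu : R) :
  (forall K, bigw K (fun n t => f n t - mu)) -> bigw 0 f.
Proof.
move=> H; have := bigwD (H 0%N) (bigw_cst mu).
by apply: bigw_ext; exists 0%N => n t _ _; rewrite subrK.
Qed.

Definition moment j n : R := J (fun t => ga t * t ^+ j) (- (gw n)^-1) (gw n)^-1.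

Lemma moment0 : forall K, bigw K (fun n _ => moment 0 n - Num.sqrt (2 * pi / a)).
Proof.
move=> K; have [G [dG Godd Gt]] := gauss_prim_tail.
pose b := Num.sqrt (a / 2).
have b0 : 0 < b by rewrite sqrtr_gt0 divr_gt0.
have b2 : b ^+ 2 = a / 2 by rewrite sqr_sqrtr// divr_ge0// ltW.
have d t : is_derive t 1 (fun t => b^-1 * G (b * t)) (ga t * t ^+ 0).
  have := is_deriveZ b^-1 (is_derive_scale_arg (dG (b * t))).
  move=> /trigger_derive; apply; rewrite /GRing.scale/= mulrA mulVf ?gt_eqF//.
  by rewrite mul1r expr0 mulr1 /ga exprMn b2; congr expR; field.
have a2 : 0 < a / 2 by rewrite divr_gt0.
have [C [N [C0 H]]] := bigw_exp_tail K a2.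
have [N' HN'] := gw_small b0.
exists (2 * b^-1 * C), (N + N').+1; split; first by rewrite !mulr_ge0// invr_ge0 ltW.
move=> n t Nn tn.
have w0 : 0 < gw n :> R by apply: gw_gt0; exact: leq_trans Nn.
have wb : gw n <= b by apply: HN'; rewrite (leq_trans (leq_addl _ _) (ltnW Nn)).
have Nn' : (N <= n)%N by rewrite (leq_trans (leq_addr _ _) (ltnW Nn)).
rewrite /moment (JE _ _ d) mulrN Godd.
have x1 : 1 <= b * (gw n)^-1 by rewrite ler_pdivlMr// mul1r.
have -> : b^-1 * G (b * (gw n)^-1) - b^-1 * - G (b * (gw n)^-1) - Num.sqrt (2 * pi / a) =
    2 * b^-1 * (G (b * (gw n)^-1) - Num.sqrt pi / 2).
  have -> : Num.sqrt (2 * pi / a) = Num.sqrt pi / b.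
    have -> : 2 * pi / a = pi * (a / 2)^-1 by move: (pi : R) => p; field; rewrite gt_eqF.
    by rewrite sqrtrM ?pi_ge0// sqrtrV// ltW.
  by field; rewrite gt_eqF.
rewrite normrM ger0_norm; last by rewrite mulr_ge0// invr_ge0 ltW.
rewrite -[leRHS]mulrA; apply: ler_wpM2l.
  by rewrite divr_ge0// ltW.
apply: le_trans (Gt _ x1) _; apply: le_trans (H n t Nn' tn).
rewrite ger0_norm ?expR_ge0//; have -> : (b * (gw n)^-1) ^+ 2 = a / 2 / gw n ^+ 2.
  by rewrite [(b * _) ^+ 2]exprMn b2 exprVn.
exact: lexx.
Qed.

Lemma moment1 n : moment 1 n = 0.
Proof.
have d t : is_derive t 1 (fun t => - a^-1 * ga t) (ga t * t ^+ 1).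
  have := is_deriveZ (- a^-1) (is_derive_ga t).
  move=> /trigger_derive; apply; rewrite /GRing.scale/= expr1; field.
  by rewrite gt_eqF.
by rewrite /moment (JE _ _ d) /ga sqrrN subrr.
Qed.

Lemma momentSS j n : moment j.+2 n =
  a^-1 * (j.+1%:R * moment j n -
   (ga (gw n)^-1 * (gw n)^-1 ^+ j.+1 - ga (- (gw n)^-1) * (- (gw n)^-1) ^+ j.+1)).
Proof.
have := JE (- (gw n)^-1) (gw n)^-1 (is_derive_gaX j.+1).
have h0 := has_prim_gaX j; have h2 := has_prim_gaX j.+2.
rewrite JB; [|exact: has_primZ..]; rewrite JZ// JZ// /= -/(moment j n) -/(moment j.+2 n).
move=> <-; field; by rewrite gt_eqF.
Qed.

(** Integration by parts links the moments [j] and [j + 2] up to boundary terms at the cutoff, which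
    are flat; so two consecutive moments are carried through the induction. *)
Lemma moment_limit j : exists mu, forall K, bigw K (fun n _ => moment j n - mu).
Proof.
suff : (exists mu, forall K, bigw K (fun n _ => moment j n - mu)) /\
  (exists mu, forall K, bigw K (fun n _ => moment j.+1 n - mu)) by case.
elim: j => [|j [[mu H] IH]].
  split; first by exists (Num.sqrt (2 * pi / a)); exact: moment0.
  exists 0 => K; exists 0, 0%N; split=> // n t _ _.
  by rewrite moment1 subr0 normr0 mul0r.
split=> //; exists (a^-1 * (j.+1%:R * mu)) => K.
have a2 : 0 < a / 2 by rewrite divr_gt0.
have T : bigw K (fun n _ => ga (gw n)^-1 / gw n ^+ j.+1).
  apply: bigw_div; have := bigw_exp_tail (K + j.+1) a2; apply: bigw_ext.
  by exists 0%N => n t _ _; rewrite ga_cutoff.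
(* The factor [1 - (-1)^(j+1)] joins the boundary terms at the two ends, the Gaussian being even. *)
have := bigwD (bigwZ (a^-1 * j.+1%:R) (H K)) (bigwZ (- (a^-1 * (1 - (-1) ^+ j.+1))) T).
apply: bigw_ext; exists 0%N => n t _ _.
have gaN x : ga (- x) = ga x by rewrite /ga sqrrN.
rewrite momentSS [(- (gw n)^-1) ^+ j.+1]exprNn gaN -[(gw n ^+ j.+1)^-1]exprVn.
move: (ga _) (_ ^+ j.+1) ((gw n)^-1 ^+ j.+1) (j.+1%:R) => p q u v; move: (moment _ _) (a^-1) => m b; ring.
Qed.

Lemma bigw_J f K : (forall n, has_prim (fun t => ga t * f n t)) -> bigw K f ->
  bigw K (fun n _ => J (fun t => ga t * f n t) (- (gw n)^-1) (gw n)^-1).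
Proof.
move=> hf [C [N [C0 H]]].
have [B [N' [B0 HB]]] := bigw_cst_diff moment0.
exists (C * B), (N + N').+1; split; first by rewrite mulr_ge0.
move=> n t Nn tn.
have w0 : 0 < gw n :> R by apply: gw_gt0; exact: leq_trans Nn.
have Nn1 : (N <= n)%N by rewrite (leq_trans (leq_addr _ _) (ltnW Nn)).
have Nn2 : (N' <= n)%N by rewrite (leq_trans (leq_addl _ _) (ltnW Nn)).
have v0 : 0 <= (gw n)^-1 :> R by rewrite invr_ge0 ltW.
have h0 := has_prim_gaX 0.
have hc : has_prim (fun t => C * gw n ^+ K * (ga t * t ^+ 0)) by exact: has_primZ.
apply: (@le_trans _ _ (J (fun t => C * gw n ^+ K * (ga t * t ^+ 0)) (- (gw n)^-1) (gw n)^-1)).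
  apply: norm_J => //; first by rewrite ge0_cp.
  move=> x xw; rewrite normrM (ger0_norm (ga_ge0 _)) expr0 mulr1 mulrC.
  by rewrite ler_wpM2r ?ga_ge0// H// ler_norml.
rewrite JZ// -/(moment 0 n) mulrAC ler_wpM2r ?exprn_ge0 ?gw_ge0// ler_wpM2l//.
have := HB n t Nn2 tn; rewrite expr0 mulr1; apply: le_trans; exact: ler_norm.
Qed.

(** Integration turns a polynomial in [w] and [t] into a combination of powers of [w] and moments,
    and each moment is a constant up to a flat error. *)
Lemma asy_J f : (forall n, has_prim (fun t => ga t * f n t)) -> asy Pwt f ->
  asy Pw (fun n _ => J (fun t => ga t * f n t) (- (gw n)^-1) (gw n)^-1).
Proof.
move=> hf af; apply: asy_approx => K; have [_ [W ->] H] := af K.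
have hm (i j : nat) n : has_prim (fun t => (W`_i)`_j * gw n ^+ i * (ga t * t ^+ j)).
  exact/has_primZ/has_prim_gaX.
have WE n t : ga t * W.[(gw n)%:P].[t] =
    \sum_(i < size W) \sum_(j < size W`_i) (W`_i)`_j * gw n ^+ i * (ga t * t ^+ j).
  rewrite horner2E mulr_sumr; apply: eq_bigr => i _.
  by rewrite mulr_suml mulr_sumr; apply: eq_bigr => j _; ring.
have hs n (i : nat) : has_prim (fun t =>
    \sum_(j < size W`_i) (W`_i)`_j * gw n ^+ i * (ga t * t ^+ j)).
  by apply: has_prim_sum => j.
have hW n : has_prim (fun t => ga t * W.[(gw n)%:P].[t]).
  by under eq_fun do rewrite WE; apply: has_prim_sum => i.
exists (fun n _ => J (fun t => ga t * W.[(gw n)%:P].[t]) (- (gw n)^-1) (gw n)^-1).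
  have ae : asy Pw (fun n _ => \sum_(i < size W) \sum_(j < size W`_i)
     (W`_i)`_j * gw n ^+ i * moment j n).
    apply: (asy_sum alg_Pw) => i; apply: (asy_sum alg_Pw) => j.
    apply: (asyM alg_Pw); first by apply/(asyZ alg_Pw)/(asyX alg_Pw)/asy_gw/alg_Pw.
    have [mu Hmu] := moment_limit j.
    have := asyD alg_Pw (asy_flat alg_Pw Hmu) (asy_cst alg_Pw mu).
    by apply: asy_ext; exists 0%N => n t _ _; rewrite subrK.
  apply: asy_ext ae; exists 0%N => n t _ _.
  under [in RHS]eq_J do rewrite WE.
  rewrite J_sum; last by move=> i; exact: hs.
  apply: eq_bigr => i _; rewrite J_sum; last by move=> j; exact: hm.
  by apply: eq_bigr => j _; rewrite JZ//; exact: has_prim_gaX.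
have hd n : has_prim (fun t => ga t * (f n t - W.[(gw n)%:P].[t])).
  by under eq_fun do rewrite mulrBr; exact: has_primB.
have := bigw_J hd H; apply: bigw_ext; exists 0%N => n t _ _.
rewrite -JB//; apply: eq_J => x; exact: mulrBr.
Qed.

End gaussian_moments.

(** * Rescaling at the saddle point *)

Section saddle_point_scaling.
Context {R : realType}.
Implicit Types (f g h : nat -> R -> R) (K M n : nat) (t : R).

Lemma bigwX K m f : bigw K f -> bigw (K * m) (fun n t => f n t ^+ m).
Proof.
move=> Hf; elim: m => [|m IH].
  by rewrite muln0; have := bigw_cst (1 : R); apply: bigw_ext; exists 0%N => n t _ _; rewrite expr0.
rewrite mulnS; have := bigwM Hf IH; apply: bigw_ext.
by exists 0%N => n t _ _; rewrite exprS.
Qed.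

(** The functions allowed inside [exp] and [cos]: they have an expansion and vanish in the limit. *)
Definition tame f := asy Pwt f /\ bigw 1 f.

Lemma tame_ext f g : (exists N, forall n t, (N <= n)%N -> `|t| <= (gw n)^-1 ->
  f n t = g n t) -> tame f -> tame g.
Proof. by move=> E [af bf]; split; [apply: asy_ext af|apply: bigw_ext bf]. Qed.

Lemma tameD f g : tame f -> tame g -> tame (fun n t => f n t + g n t).
Proof. by move=> [af bf] [ag bg]; split; [exact: (asyD alg_Pwt)|exact: bigwD]. Qed.

Lemma tameZ (c : R) f : tame f -> tame (fun n t => c * f n t).
Proof. by move=> [af bf]; split; [exact: (asyZ alg_Pwt)|exact: bigwZ]. Qed.

Lemma tame_flat f : (forall K, bigw K f) -> tame f.
Proof. by move=> H; split=> //; exact: (asy_flat alg_Pwt). Qed.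

Lemma tame_sum (J : nat) (f : nat -> nat -> R -> R) : (forall j, tame (f j)) ->
  tame (fun n t => \sum_(j < J) f j n t).
Proof.
move=> H; elim: J => [|J IH].
  apply: (@tame_ext (fun n t => 0)).
    by exists 0%N => n t _ _; rewrite big_ord0.
  by apply: tame_flat => K; exists 0, 0%N; split=> // n t _ _; rewrite normr0 mul0r.
apply: tame_ext (tameD IH (H J)).
by exists 0%N => n t _ _; rewrite big_ord_recr.
Qed.

Lemma bigw_taylor K (phi : R -> R) f : taylor phi -> bigw K.+1 f ->
  bigw K.+1 (fun n t => phi (f n t) - phi 0).
Proof.
move=> Tphi [D [N [D0 HD]]].
have [Q [C [d [C0 d0 H]]]] := Tphi 1%N.
have [B B0 HB] := poly_locally_bounded (Q %/ 'X) d.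
have QE x : Q.[x] = Q.[0] + x * (Q %/ 'X).[x].
  rewrite {1 2}(divp_eq Q 'X) -['X]subr0 -(polyC0 R) modp_XsubC polyC0 subr0.
  by rewrite !hornerE; ring.
have H0 : phi 0 = Q.[0].
  by apply/eqP; rewrite -subr_eq0 -normr_le0; have := H 0; rewrite normr0 mulr0; apply; exact: ltW.
have dD : 0 < d / (D + 1) by rewrite divr_gt0// ltr_wpDl.
have [N' HN'] := gw_small dD.
exists ((C + B) * D), (N + N').+1; split=> [|n t Nn tn].
  by rewrite mulr_ge0// addr_ge0.
have h := HD n t (leq_trans (leq_addr _ _) (ltnW Nn)) tn.
have := HN' n (leq_trans (leq_addl _ _) (ltnW Nn)); rewrite ler_pdivlMr ?ltr_wpDl// => wd.
have w0 := @gw_ge0 R n.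
have wK : gw n ^+ K.+1 <= gw n :> R.
  by rewrite exprS ler_piMr// exprn_ile1// gw_le1// (leq_trans _ Nn).
have fd : `|f n t| <= d by apply: le_trans h _; nra.
have -> : phi (f n t) - phi 0 = (phi (f n t) - Q.[f n t]) + f n t * (Q %/ 'X).[f n t].
  by rewrite (QE (f n t)) H0; ring.
apply: le_trans (ler_normD _ _) _; rewrite normrM.
have h1 := H _ fd; rewrite expr1 in h1; have h2 := HB _ fd.
have h3 := ler_wpM2l (normr_ge0 (f n t)) h2.
apply: le_trans (lerD h1 h3) _; rewrite [`|_| * B]mulrC -mulrDl -mulrA.
by rewrite ler_wpM2l// addr_ge0.
Qed.

Lemma tame_taylor (phi : R -> R) f : taylor phi -> tame f ->
  tame (fun n t => phi (f n t) - phi 0).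
Proof.
move=> Tphi [af bf]; split; last exact: bigw_taylor.
by apply: (asyB alg_Pwt); [exact: (asy_taylor alg_Pwt)|exact: (asy_cst alg_Pwt)].
Qed.

(* [zz n ^+ 2] is the saddle point [pi / sqrt (6 n)], and [zz n ^+ 3] the width of the peak. *)
Definition zq : R := Num.sqrt (pi / Num.sqrt 6).
Definition zz n : R := zq * gw n ^+ 4.

Lemma zq_gt0 : 0 < zq.
Proof. by rewrite sqrtr_gt0 divr_gt0 ?pi_gt0// sqrtr_gt0. Qed.

Lemma zz_gt0 n : (0 < n)%N -> 0 < zz n.
Proof. by move=> n0; rewrite mulr_gt0 ?zq_gt0// exprn_gt0// gw_gt0. Qed.

Lemma zq2 : zq ^+ 2 = pi / Num.sqrt 6.
Proof. by rewrite sqr_sqrtr// divr_ge0 ?pi_ge0// sqrtr_ge0. Qed.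

Lemma zz4 n : zz n ^+ 4 = pi ^+ 2 / 6 / n%:R.
Proof.
rewrite /zz exprMn -exprM gw_pow16 (exprM zq 2 2) zq2.
by rewrite [(pi / _) ^+ 2]exprMn exprVn sqr_sqrtr.
Qed.

Lemma zz_n n : (0 < n)%N -> n%:R = pi ^+ 2 / 6 / zz n ^+ 4.
Proof.
move=> n0; have nR : 0 < n%:R :> R by rewrite ltr0n.
rewrite zz4; have := @pi_gt0 R; move: (pi : R) => p p0; field.
by rewrite !gt_eqF.
Qed.

Lemma bigw_zz : bigw 4 (fun n _ => zz n).
Proof. exact/bigwZ/bigw_gw. Qed.

Lemma asy_zz : asy Pwt (fun n _ => zz n).
Proof. exact/(asyZ alg_Pwt)/(asyX alg_Pwt)/(asy_gw alg_Pwt). Qed.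

Lemma asy_zz_Pw : asy Pw (fun n _ => zz n).
Proof. exact/(asyZ alg_Pw)/(asyX alg_Pw)/(asy_gw alg_Pw). Qed.

Lemma asy_t : asy Pwt (fun _ t => t).
Proof. exact/asy_alg/Pwt_t. Qed.

Lemma bigw_zzt : bigw 3 (fun n t => zz n * t).
Proof.
have := bigwM (bigwZ zq (@bigw_gw R 3)) bigw_gwt; apply: bigw_ext.
by exists 0%N => n t _ _; rewrite /zz; ring.
Qed.

Lemma bigw_zzt3 : bigw 1 (fun n t => zz n * t ^+ 3).
Proof.
have := bigwM (bigwZ zq (@bigw_gw R 1)) (bigwX 3 bigw_gwt); apply: bigw_ext.
by exists 0%N => n t _ _; rewrite /zz; ring.
Qed.

(** [zz] has order [w^4] and [|t| <= 1/w], so the monomial is [O(w^(4i - k))]. *)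
Lemma tame_zzt i k : (k <= 3 * i)%N -> (k < 4 * i)%N -> tame (fun n t => zz n ^+ i * t ^+ k).
Proof.
move=> ki ki'; split.
  by apply: (asyM alg_Pwt); apply: (asyX alg_Pwt); [exact: asy_zz|exact: asy_t].
have e : (4 * i = (4 * i - k) + k)%N by rewrite subnK// ltnW.
apply: (@bigw_le _ ((4 * i - k) + 0 * k)); first by rewrite mul0n addn0 subn_gt0.
have := bigwM (bigwZ (zq ^+ i) (@bigw_gw R (4 * i - k))) (bigwX k bigw_gwt).
apply: bigw_ext; exists 0%N => n t _ _.
by rewrite [(gw n * t) ^+ k]exprMn [zz n ^+ i]exprMn -exprM {2}e exprD; ring.
Qed.

Lemma bigw_flat0 (r : R -> R) K : flat0 r -> bigw K (fun n _ => r (zz n ^+ 2)).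
Proof.
move=> /(_ K)[C [d [C0 /andP[d0 _] H]]].
have [C' [N' [C'0 H']]] := bigw_zz.
have dC : 0 < d / (C' + 1) ^+ 2.
  by rewrite divr_gt0// exprn_gt0// ltr_wpDl.
have [N HN] := gw_small dC.
exists (C * (C' ^+ 2) ^+ K), (N + N').+1; split.
  by rewrite mulr_ge0// !exprn_ge0.
move=> n t Nn tn.
have n0 : (0 < n)%N by exact: leq_trans Nn.
have w0 := @gw_ge0 R n; have w1 := @gw_le1 R n n0.
have z0 := zz_gt0 n0.
have wd := HN n (leq_trans (leq_addr _ _) (ltnW Nn)).
have zw := H' n t (leq_trans (leq_addl _ _) (ltnW Nn)) tn.
rewrite gtr0_norm// in zw.
have zw2 : zz n ^+ 2 <= C' ^+ 2 * gw n.
  apply: (@le_trans _ _ ((C' * gw n ^+ 4) ^+ 2)).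
    by rewrite ler_pXn2r ?nnegrE ?(ltW z0)// mulr_ge0// exprn_ge0.
  rewrite [(C' * _) ^+ 2]exprMn ler_wpM2l ?exprn_ge0// -exprM.
  by rewrite exprS ler_piMr// exprn_ile1.
have zd : zz n ^+ 2 <= d.
  apply: le_trans zw2 _; rewrite ler_pdivlMr ?exprn_gt0 ?ltr_wpDl// in wd.
  apply: le_trans wd; rewrite mulrC ler_wpM2l// ler_pXn2r ?nnegrE ?addr_ge0// lerDl//.
apply: le_trans (H _ _) _; first by rewrite exprn_gt0.
rewrite -mulrA -exprMn ler_wpM2l//.
apply: lerXn2r => //; rewrite nnegrE; first by rewrite exprn_ge0// ltW.
by apply: mulr_ge0 => //; exact: exprn_ge0.
Qed.

(** The [j]-th Taylor term of the logarithm at the angle [zz^3 t], minus what does not tend to 0: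
    for [j = 1] this is [n] times the angle, by the choice of the saddle point; for [j = 2] it is
    the Gaussian exponent. *)
Definition YY j n t : R := (zz n ^+ 3 * t) ^+ j / j`!%:R * FF j (zz n ^+ 2) -
  (j == 1%N)%:R * (n%:R * (zz n ^+ 3 * t)) - (j == 2)%:R * (pi ^+ 2 / 6 * t ^+ 2).

Let Yflat j : forall K, bigw K (fun n t => (j`!%:R)^-1 * ((zz n ^+ 3 * t) ^+ j *
  (FF j (zz n ^+ 2) - EF j (zz n ^+ 2)))).
Proof.
move=> K; apply: bigwZ.
have b0 : bigw 0 (fun n t => (zz n ^+ 3 * t) ^+ j).
  rewrite -(mul0n j); apply: bigwX.
  have := bigwM (bigwX 2 bigw_zz) bigw_zzt => /(bigw_le (leq0n _)).
  by apply: bigw_ext; exists 0%N => n t _ _; ring.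
by have := bigwM b0 (bigw_flat0 K (FF_asymp j)).
Qed.

(** For [j >= 3] the main term is a multiple of [zz^(j-2) t^j], of order [w^(3j - 8)], positive from
    [j = 3] on; the other terms are smaller or flat. For [j = 1, 2] the subtraction in [YY] has
    removed the main term. *)
Lemma tame_YY j : (0 < j)%N -> tame (YY j).
Proof.
case: j => [//|[|[|j]]] _.
- have := tameD (tameD (tameZ (- 2^-1) (@tame_zzt 1 1 isT isT))
    (tameZ (24^-1) (@tame_zzt 3 1 isT isT))) (tame_flat (Yflat 1)).
  apply: tame_ext; exists 1%N => n t n0 _; have z0 := zz_gt0 n0.
  rewrite /YY /= (zz_n n0) -[in RHS](subrK (EF 1 (zz n ^+ 2)) (FF 1 _)).
  move: (FF 1 _ - _) => F; rewrite /= !factE /=; have := @pi_gt0 R.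
  move: (zz n) z0 (pi : R) => z z0 p p0; field.
  by rewrite gt_eqF.
- have := tameD (tameZ (- 4^-1) (@tame_zzt 2 2 isT isT)) (tame_flat (Yflat 2)).
  apply: tame_ext; exists 1%N => n t n0 _; have z0 := zz_gt0 n0.
  rewrite /YY /= -[in RHS](subrK (EF 2 (zz n ^+ 2)) (FF 2 _)).
  move: (FF 2 _ - _) => F; rewrite /= !factE /=; have := @pi_gt0 R.
  move: (zz n) z0 (pi : R) => z z0 p p0; field.
  by rewrite gt_eqF.
- have T : tame (fun n t => zz n ^+ j.+1 * t ^+ j.+3).
    split; first by apply: (asyM alg_Pwt); apply: (asyX alg_Pwt); [exact: asy_zz|exact: asy_t].
    have := bigwM (bigw_le (leq0n _) (bigwX j bigw_zzt)) bigw_zzt3.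
    by apply: bigw_ext; exists 0%N => n t _ _; rewrite exprMn !exprS expr0; ring.
  have l3 : (j.+3 <= 3 * j.+3)%N by rewrite leq_pmull.
  have l4 : (j.+3 < 4 * j.+3)%N by rewrite ltn_Pmull.
  have := tameD (tameD (tameZ (pi ^+ 2 / 6) T)
    (tameZ (- (j.+2`!%:R / 2 / j.+3`!%:R)) (tame_zzt l3 l4))) (tame_flat (Yflat j.+3)).
  apply: tame_ext; exists 1%N => n t n0 _; have z0 := zz_gt0 n0.
  rewrite /YY -[in RHS](subrK (EF j.+3 (zz n ^+ 2)) (FF j.+3 _)).
  move: (FF j.+3 _ - _) => F; rewrite /EF /= !mul0r !subr0.
  have : (j.+3`!%:R : R) != 0 by rewrite pnatr_eq0 -lt0n fact_gt0.
  move: (j.+3`!%:R : R) (j.+2`!%:R : R) => a b a0.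
  have := @pi_gt0 R; move: (zz n) z0 (pi : R) => z z0 p p0.
  rewrite !(exprS _ j.+3) !(exprS _ j.+2) !(exprS _ j.+1) !(exprS _ j) [(z ^+ 3 * t) ^+ j]exprMn.
  rewrite [z ^+ 2 ^+ j]exprAC [z ^+ 3 ^+ j]exprAC.
  have : z ^+ j != 0 by rewrite expf_neq0// gt_eqF.
  move: (z ^+ j) (t ^+ j) => zj tj zj0; field.
  by rewrite a0 zj0 gt_eqF.
Qed.

End saddle_point_scaling.

(** * The integrand near and away from the saddle point *)

Section circle_integral.
Context {R : realType}.
Implicit Types (f g h : nat -> R -> R) (K M n s : nat) (t : R).

Lemma cos_shiftSS s (x : R) : cos_shift s.+2 x = - cos_shift s x.
Proof.
rewrite /cos_shift -cosDpi; congr cos; rewrite -addn2 natrD.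
by move: (pi : R) => p; field.
Qed.

(* The exponent at the rescaled angle minus its Taylor polynomial of degree 2, whose
   coefficients are replaced by their main terms; the real part is [s = 0] and the
   imaginary part [s = 3]. *)
Definition WW s n t : R :=
  Sum (fun k => LL k * ee (zz n ^+ 2) k * cos_shift s (k%:R * (zz n ^+ 3 * t))) -
  cos_shift s 0 * FF 0 (zz n ^+ 2) - cos_shift (s + 1) 0 * (n%:R * (zz n ^+ 3 * t)) -
  cos_shift (s + 2) 0 * (pi ^+ 2 / 6 * t ^+ 2).

Lemma bigw_WW_YY s K : bigw K (fun n t => WW s n t -
  \sum_(j < K.+3.+2) cos_shift (s + j.+1) 0 * YY j.+1 n t).
Proof.
(* The shape of the Taylor remainder: [(zz^3 t)^(K+6)] times [FF (K+6)] at [zz^2], which is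
   [O(zz^(-2(K+8)))]. *)
have T : bigw (3 * K) (fun n t => zz n ^+ K.+2 * t ^+ (K.+3.+3)).
  have := bigwM (bigwX K (@bigw_zzt R)) (bigw_le (leq0n _) (bigwX 2 (@bigw_zzt3 R))).
  rewrite addn0; apply: bigw_ext; exists 0%N => n t _ _.
  by rewrite exprMn !exprS expr0; ring.
have [C [N [C0 H]]] := bigw_le (leq_pmull K (isT : (0 < 3)%N)) T.
have [C' [N' [C'0 H']]] := @bigw_zz R.
have d0 : 0 < (C' + 1)^-1 by rewrite invr_gt0 ltr_wpDl.
have [M HM] := gw_small d0.
pose c : R := (K.+3.+4)`!%:R * 2 ^+ (K.+3.+4) * 4.
have c0 : 0 <= c by apply: mulr_ge0 => //; apply: mulr_ge0; rewrite ?exprn_ge0 ?ler0n.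
exists (c * C), (N + (N' + M)).+1; split; first by rewrite mulr_ge0.
move=> n t Nn tn.
have n0 : (0 < n)%N by exact: leq_trans Nn.
have h := H n t (leq_trans (leq_addr _ _) (ltnW Nn)) tn.
have h' := H' n t (leq_trans (leq_trans (leq_addr _ _) (leq_addl _ _)) (ltnW Nn)) tn.
have wd := HM n (leq_trans (leq_trans (leq_addl _ _) (leq_addl _ _)) (ltnW Nn)).
have z0 := @zz_gt0 R _ n0; have w0 := @gw_ge0 R n; have w1 := @gw_le1 R n n0.
rewrite gtr0_norm// in h'.
have z1 : zz n <= 1 :> R.
  apply: le_trans h' _; have w4 : gw n ^+ 4 <= gw n :> R by rewrite exprS ler_piMr// exprn_ile1.
  apply: le_trans (ler_wpM2l C'0 w4) _.
  by rewrite -div1r ler_pdivlMr ?ltr_wpDl// in wd; apply: le_trans wd; nra.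
have y0 : 0 < zz n ^+ 2 :> R by rewrite exprn_gt0.
have y01 : 0 < (zz n ^+ 2 : R) <= 1.
  by apply/andP; split=> //; apply: exprn_ile1 => //; exact: ltW.
have := @trig_taylor R s (K.+3.+3) _ (zz n ^+ 3 * t) y0.
have -> : Sum (fun k => LL k * ee (zz n ^+ 2) k * cos_shift s (k%:R * (zz n ^+ 3 * t))) -
    \sum_(j < K.+3.+3) cos_shift (s + j) 0 * (zz n ^+ 3 * t) ^+ j / j`!%:R * FF j (zz n ^+ 2) =
    WW s n t - \sum_(j < K.+3.+2) cos_shift (s + j.+1) 0 * YY j.+1 n t.
  rewrite /WW; set S := Sum _; move: (K.+3) => m; rewrite !big_ord_recl /= /bump /= !add1n.
  rewrite addn0 /YY /= !factE /=.
  set Z := \sum_(i < m) _; set Z' := \sum_(i < m) _.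
  have -> : Z = Z'.
    apply: eq_bigr => i _; rewrite /bump /= !add1n; field.
    by rewrite pnatr_eq0 -lt0n fact_gt0.
  by move: Z' {Z} => Z'; field.
move=> le1; apply: le_trans le1 _.
have F := FF_le (K.+3.+3) y01; rewrite -/c in F.
apply: le_trans (ler_wpM2l (exprn_ge0 _ (normr_ge0 _)) F) _.
rewrite -[leRHS]mulrA; apply: le_trans (ler_wpM2l c0 h).
clear -z0; move: (zz n) z0 c => z z0 c.
rewrite [`|_ * t|]normrM [`|_ * t ^+ _|]normrM !normrX (gtr0_norm z0).
rewrite le_eqVlt; apply/orP; left; apply/eqP; move: (`|t|) => u.
rewrite [(z ^+ 3 * u) ^+ _]exprMn -!exprM.
have -> : (3 * K.+2.+4 = 2 * K.+4.+4 + K.+2)%N by lia.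
rewrite exprD; have : z ^+ (2 * K.+4.+4) != 0 by rewrite expf_neq0// gt_eqF.
by move: (z ^+ (2 * _)) (z ^+ K.+2) (u ^+ _) => p q v p0; field.
Qed.

Lemma tame_WW s : tame (WW s).
Proof.
have T K : tame (fun n t => \sum_(j < K.+3.+2) cos_shift (s + j.+1) 0 * YY j.+1 n t : R).
  apply: (@tame_sum _ _ (fun j n t => cos_shift (s + j.+1) 0 * YY j.+1 n t)) => j.
  exact/tameZ/tame_YY.
split.
  apply: asy_approx => K; eexists; first exact: (T K).1.
  exact: bigw_WW_YY.
have := bigwD (bigw_WW_YY s 1) (T 1%N).2; apply: bigw_ext.
by exists 0%N => n t _ _; rewrite subrK.
Qed.

(** The rescaled Fourier integrand divided by its size [PP (zz n ^+ 2)] at angle 0. *)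
Definition arc n t : R :=
  expR (CC (zz n ^+ 2) (zz n ^+ 3 * t) - CC (zz n ^+ 2) 0) *
  cos (DD (zz n ^+ 2) (zz n ^+ 3 * t) - n%:R * (zz n ^+ 3 * t)).

Lemma CC_FF y : CC y 0 = FF 0 y :> R.
Proof.
rewrite /CC /FF; congr Sum; apply/funext => k.
by rewrite mulr0 cos_shift0 cos0 mulr1 expr0 mul1r.
Qed.

Lemma arcE n t : arc n t = ga (pi ^+ 2 / 3) t * (expR (WW 0 n t) * cos (WW 3 n t)).
Proof.
have W0 : WW 0 n t = CC (zz n ^+ 2) (zz n ^+ 3 * t) - CC (zz n ^+ 2) 0 + pi ^+ 2 / 6 * t ^+ 2.
  rewrite /WW CC_FF add0n (cos_shiftSS 0) cos_shift1 cos_shift3 sin0 cos_shift0 cos0.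
  by rewrite -/(CC _ _); ring.
have W3 : WW 3 n t = DD (zz n ^+ 2) (zz n ^+ 3 * t) - n%:R * (zz n ^+ 3 * t).
  rewrite /WW !cos_shiftSS !cos_shift1 !cos_shift3 sin0 cos_shift0 cos0.
  by rewrite -/(DD _ _); ring.
rewrite W0 W3 /arc /ga [RHS]mulrA -expRD; congr (expR _ * _).
by move: (pi : R) => p; field.
Qed.

Lemma arc_wave n t : (0 < n)%N ->
  arc n t = (PP (zz n ^+ 2))^-1 * wave n (zz n ^+ 2) (zz n ^+ 3 * t).
Proof.
move=> n0; have y0 : 0 < zz n ^+ 2 :> R by rewrite exprn_gt0// zz_gt0.
by rewrite wave_polar// mulKf// gt_eqF// (lt_le_trans ltr01)// PP_ge1.
Qed.

Lemma has_prim_arc n : (0 < n)%N -> has_prim (arc n).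
Proof.
move=> n0; have y0 : 0 < zz n ^+ 2 :> R by rewrite exprn_gt0// zz_gt0.
have -> : arc n = (fun t => (PP (zz n ^+ 2))^-1 * wave n (zz n ^+ 2) (zz n ^+ 3 * t)).
  by apply/funext => t; exact: arc_wave.
exact/has_primZ/continuous_has_prim/continuous_wave.
Qed.

Definition arc_integral n : R := J (arc n) (- (pi / zz n ^+ 3)) (pi / zz n ^+ 3).

Lemma pp_arc_integral n : (0 < n)%N ->
  pp n = zz n ^+ 3 / (2 * pi) * (PP (zz n ^+ 2) / ee (zz n ^+ 2) n) * arc_integral n.
Proof.
move=> n0; have z0 := @zz_gt0 R _ n0.
have y0 : 0 < zz n ^+ 2 :> R by rewrite exprn_gt0.
have l0 : 0 < zz n ^+ 3 :> R by rewrite exprn_gt0.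
have hw : has_prim (fun t => wave n (zz n ^+ 2) (zz n ^+ 3 * t)).
  exact/continuous_has_prim/continuous_wave.
have := fourier_coefficient n y0 l0; rewrite /arc_integral.
have -> : arc n = (fun t => (PP (zz n ^+ 2))^-1 * wave n (zz n ^+ 2) (zz n ^+ 3 * t)).
  by apply/funext => t; exact: arc_wave.
rewrite JZ// => ->.
have P0 : PP (zz n ^+ 2) != 0 :> R by rewrite gt_eqF// (lt_le_trans ltr01)// PP_ge1.
have e0 : ee (zz n ^+ 2) n != 0 :> R by rewrite gt_eqF// expR_gt0.
have := @pi_gt0 R; move: (zz n) z0 P0 e0 (pi : R) (pp n) => z z0 P0 e0 p q p0.
move: (PP _) (ee _ _) P0 e0 => P e P0 e0.
by field; rewrite P0 e0 !gt_eqF.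
Qed.

End circle_integral.

Section circle_asymptotics.
Context {R : realType}.
Implicit Types (f g h : nat -> R -> R) (K M n s : nat) (t : R).

Lemma eventually_small : exists N, forall n, (N <= n)%N ->
  [/\ (0 < n)%N, zz n <= gw n :> R & gw n <= 1 / 2 :> R].
Proof.
have q0 := @zq_gt0 R.
have d0 : 0 < Num.min (1 / 2) (zq + 1)^-1 :> R.
  by rewrite lt_min invr_gt0 addr_gt0// andbT divr_gt0.
have [N HN] := gw_small d0; exists N.+1 => n Nn.
have n0 : (0 < n)%N by exact: leq_trans Nn.
have := HN n (ltnW Nn); rewrite le_min => /andP[w2 wq]; split=> //.
have w0 := @gw_gt0 R n n0.
have wz : zq * gw n <= 1 :> R.
  rewrite -div1r ler_pdivlMr ?addr_gt0// in wq; nra.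
rewrite /zz exprS mulrA; have w3 : gw n ^+ 3 <= gw n :> R.
  by rewrite exprS ler_piMr ?(ltW w0)// exprn_ile1//; lra.
apply: (@le_trans _ _ (1 * gw n ^+ 3)); last by rewrite mul1r.
by rewrite ler_wpM2r// exprn_ge0// ltW.
Qed.

(** In the rescaled angle [CC_minor] gives the exponent [- x^2 / (64 + 4 zz^2 x^2)]. As [zz <= w]
    and [w |x| >= 1], its size is at least [1 / (68 w^2)]. *)
Lemma minor_arc : exists N, forall n x, (N <= n)%N -> (gw n)^-1 <= `|x| <= pi / zz n ^+ 3 ->
  `|arc n x| <= expR (- (1 / 68 / gw n ^+ 2)) :> R.
Proof.
have [N HN] := eventually_small; exists N => n x Nn /andP[xw xp].
have [n0 zw w2] := HN n Nn.
have w0 := @gw_gt0 R n n0; have z0 := @zz_gt0 R n n0.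
rewrite /arc normrM (ger0_norm (expR_ge0 _)).
apply: (@le_trans _ _ (expR (CC (zz n ^+ 2) (zz n ^+ 3 * x) - CC (zz n ^+ 2) 0))).
  by rewrite ler_piMr ?expR_ge0// ler_norml cos_geN1 cos_le1.
have y01 : 0 < (zz n ^+ 2 : R) <= 1 / 2.
  by rewrite exprn_gt0//=; apply: (@le_trans _ _ (zz n)) => //; [rewrite expr2 ler_piMl//; lra|lra].
have xpi : `|zz n ^+ 3 * x| <= pi.
  by rewrite normrM (gtr0_norm (exprn_gt0 3 z0)) mulrC -ler_pdivlMr// exprn_gt0.
have := CC_minor y01 xpi; rewrite ler_expR.
set D := CC _ _ - _ => H.
have v1 : 1 <= gw n * `|x| by rewrite -ler_pdivrMl// mulr1.
have v2 := zw; clearbody D.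
move: (gw n) (zz n) w0 z0 {xw xp xpi y01 zw w2} v1 v2 H => w z w0 z0 v1 v2 H.
have [//|Dw] := leP D (- (1 / 68 / w ^+ 2)).
have H' : D * (64 + 4 * z ^+ 2 * x ^+ 2) <= - x ^+ 2.
  have z6 : 0 < z ^+ 6 by rewrite exprn_gt0.
  rewrite -(ler_pM2r z6); apply: le_trans (le_trans H _).
    by rewrite le_eqVlt; apply/orP; left; apply/eqP; ring.
  by rewrite le_eqVlt; apply/orP; left; apply/eqP; ring.
have x2 : 1 <= w ^+ 2 * x ^+ 2.
  by rewrite -exprMn -[(w * x) ^+ 2]real_normK ?num_real// normrM (gtr0_norm w0) exprn_ege1.
have z2 : z ^+ 2 <= w ^+ 2 by rewrite ler_pXn2r ?nnegrE// ltW.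
have p : 0 < 64 + 4 * z ^+ 2 * x ^+ 2.
  by rewrite ltr_wpDr// mulr_ge0 ?sqr_ge0// mulr_ge0// sqr_ge0.
have := lt_le_trans (_ : - (1 / 68 / w ^+ 2) * (64 + 4 * z ^+ 2 * x ^+ 2) < _) H'.
rewrite ltr_pM2r// => /(_ Dw).
have w20 : 0 < w ^+ 2 by rewrite exprn_gt0.
rewrite -(ltr_pM2r w20).
have -> : - (1 / 68 / w ^+ 2) * (64 + 4 * z ^+ 2 * x ^+ 2) * w ^+ 2 =
   - (64 + 4 * (z ^+ 2 * x ^+ 2)) / 68 by field; rewrite gt_eqF.
have : z ^+ 2 * x ^+ 2 <= w ^+ 2 * x ^+ 2 by rewrite ler_wpM2r// sqr_ge0.
have -> : - x ^+ 2 * w ^+ 2 = - (w ^+ 2 * x ^+ 2) by ring.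
move: (z ^+ 2 * _) (w ^+ 2 * _) x2 => u v; lra.
Qed.

Lemma bigw_arc_tail (A B : nat -> R) K :
  (exists N, forall n x, (N <= n)%N -> A n <= B n /\
    (A n <= x <= B n -> (gw n)^-1 <= `|x| <= pi / zz n ^+ 3)) ->
  (forall n, B n - A n <= pi / zz n ^+ 3) ->
  bigw K (fun n _ => J (arc n) (A n) (B n)).
Proof.
move=> [N HN] AB; have [N' HN'] := minor_arc.
have c0 : 0 < 1 / 68 :> R by rewrite divr_gt0.
have q0 := @zq_gt0 R.
(* The extra 12 pays for the length [pi / zz^3], of order [w^(-12)], of the interval. *)
have [C [M [C0 HC]]] := bigw_div (bigw_exp_tail (K + 12) c0).
exists (pi / zq ^+ 3 * C), (N + (N' + M)).+1; split.
  by rewrite mulr_ge0// divr_ge0 ?pi_ge0// exprn_ge0// ltW.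
move=> n t Nn tn; have n0 : (0 < n)%N by exact: leq_trans Nn.
have Nn1 : (N <= n)%N := leq_trans (leq_addr _ _) (ltnW Nn).
have Nn2 : (N' <= n)%N := leq_trans (leq_trans (leq_addr _ _) (leq_addl _ _)) (ltnW Nn).
have Nn3 : (M <= n)%N := leq_trans (leq_trans (leq_addl _ _) (leq_addl _ _)) (ltnW Nn).
have w0 := @gw_gt0 R n n0; have z0 := @zz_gt0 R n n0.
apply: (@le_trans _ _ (J (fun=> expR (- (1 / 68 / gw n ^+ 2))) (A n) (B n))).
  apply: norm_J; [exact: has_prim_arc|exact: has_prim_cst|exact: (HN n 0 Nn1).1|].
  by move=> x xAB; apply: HN' => //; apply: (HN n x Nn1).2.
rewrite J_cst; apply: le_trans (ler_wpM2l (expR_ge0 _) (AB n)) _.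
have := HC n t Nn3 tn; rewrite ger0_norm; last by rewrite divr_ge0 ?expR_ge0// exprn_ge0// ltW.
have pq : 0 <= pi / zq ^+ 3 :> R by rewrite divr_ge0 ?pi_ge0// exprn_ge0// ltW.
move=> h; rewrite -[leRHS]mulrA; apply: le_trans (ler_wpM2l pq h).
rewrite le_eqVlt; apply/orP; left; apply/eqP; rewrite /zz.
move: (gw n) w0 (zq : R) q0 (pi : R) => w w0 q q0 p.
by move: (expR _) => e; field; rewrite !gt_eqF.
Qed.

Lemma asy_arc_integral : asy Pw (fun n _ => arc_integral n : R) /\
  bigw 1 (fun n _ => arc_integral n - Num.sqrt (2 * (pi : R) / (pi ^+ 2 / 3))).
Proof.
have a0 : 0 < pi ^+ 2 / 3 :> R by rewrite divr_gt0// exprn_gt0// pi_gt0.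
(* Set to 0 at [n = 0], where the series degenerate, so that a primitive exists for every [n], as
   [asy_J] requires. *)
pose E n t := if (0 < n)%N then expR (WW 0 n t) * cos (WW 3 n t) : R else 0.
have EE n t : (0 < n)%N -> E n t = expR (WW 0 n t) * cos (WW 3 n t) by rewrite /E => ->.
have T1 := tame_taylor taylor_expR (@tame_WW R 0).
have T2 := tame_taylor taylor_cos (@tame_WW R 3).
have aE1 : asy Pwt (fun n t => E n t - 1).
  have := asyD alg_Pwt (asyM alg_Pwt T1.1 T2.1) (asyD alg_Pwt T1.1 T2.1).
  apply: asy_ext; exists 1%N => n t n0 _; rewrite EE// expR0 cos0; ring.
have aE : asy Pwt E.
  have := asyD alg_Pwt aE1 (asy_cst alg_Pwt 1).
  by apply: asy_ext; exists 0%N => n t _ _; rewrite subrK.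
have bE : bigw 1 (fun n t => E n t - 1).
  have := bigwD (bigw_le (isT : (1 <= 2)%N) (bigwM T1.2 T2.2)) (bigwD T1.2 T2.2).
  apply: bigw_ext; exists 1%N => n t n0 _; rewrite EE// expR0 cos0; ring.
have arcE' n : (0 < n)%N -> arc n = (fun t => ga (pi ^+ 2 / 3) t * E n t).
  by move=> n0; apply/funext => t; rewrite EE// arcE.
have hE n : has_prim (fun t => ga (pi ^+ 2 / 3) t * E n t).
  case: (posnP n) => [->|n0]; last by rewrite -arcE'//; exact: has_prim_arc.
  by under eq_fun do rewrite /E mulr0; exact: has_prim_cst.
have hg := has_prim_ga (pi ^+ 2 / 3 : R).
have hE1 n : has_prim (fun t => ga (pi ^+ 2 / 3) t * (E n t - 1)).
  by under eq_fun do rewrite mulrBr mulr1; exact: has_primB.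
have [N HN] := eventually_small.
have pz n : (0 < n)%N -> 0 < (pi / zz n ^+ 3 : R).
  by move=> n0; rewrite divr_gt0 ?pi_gt0// exprn_gt0// zz_gt0.
have wz n : (N <= n)%N -> 0 < (gw n : R)^-1 <= pi / zz n ^+ 3.
  move=> /HN[n0 zw w2]; have w0 := @gw_gt0 R n n0; have z0 := @zz_gt0 R n n0.
  rewrite invr_gt0 w0/= ler_pdivlMr ?exprn_gt0// mulrC -ler_pdivlMr ?invr_gt0//.
  rewrite invrK; have p2 := @pi_ge2 R.
  have z3 : zz n ^+ 3 <= zz n :> R by rewrite exprS ler_piMr ?(ltW z0)// exprn_ile1 ?(ltW z0)//; lra.
  nra.
have tl1 K : bigw K (fun n _ => J (arc n) (gw n)^-1 (pi / zz n ^+ 3) : R).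
  apply: (@bigw_arc_tail (fun n => (gw n)^-1) (fun n => pi / zz n ^+ 3)); last first.
    by move=> n; rewrite gerBl invr_ge0 gw_ge0.
  exists N => n x Nn; have /andP[w0 wp] := wz n Nn; split=> // /andP[x1 x2].
  by rewrite ger0_norm ?x1//; apply: le_trans x1; exact: ltW.
have tl2 K : bigw K (fun n _ => J (arc n) (- (pi / zz n ^+ 3)) (- (gw n)^-1) : R).
  apply: (@bigw_arc_tail (fun n => - (pi / zz n ^+ 3)) (fun n => - (gw n)^-1)); last first.
    by move=> n; rewrite opprK addrC gerBl invr_ge0 gw_ge0.
  exists N => n x Nn; have /andP[w0 wp] := wz n Nn; split; first by rewrite lerN2.
  move=> /andP[x1 x2]; rewrite ler0_norm; last by apply: le_trans x2 _; rewrite oppr_le0 ltW.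
  by rewrite lerNr x2 lerNl x1.
have tl : forall K, bigw K (fun n _ => arc_integral n -
    J (fun t => ga (pi ^+ 2 / 3) t * E n t) (- (gw n)^-1) (gw n)^-1 : R).
  move=> K; apply: bigw_ext (bigwD (tl1 K) (tl2 K)); exists 1%N => n t n0 _.
  rewrite -arcE'// /arc_integral /J; lra.
split.
  have := asyD alg_Pw (asy_flat alg_Pw tl) (asy_J a0 hE aE).
  by apply: asy_ext; exists 0%N => n t _ _; rewrite subrK.
have := bigwD (tl 1%N) (bigwD (bigw_J a0 hE1 bE) (moment0 a0 1)).
apply: bigw_ext; exists 0%N => n t _ _.
have -> : J (fun t => ga (pi ^+ 2 / 3) t * (E n t - 1)) (- (gw n)^-1) (gw n)^-1 =
  J (fun t => ga (pi ^+ 2 / 3) t * E n t) (- (gw n)^-1) (gw n)^-1 -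
  moment (pi ^+ 2 / 3) 0 n.
  rewrite /moment -JB//; last exact: has_prim_gaX.
  by apply: eq_J => x; rewrite expr0 mulr1 mulrBr mulr1.
by ring.
Qed.

End circle_asymptotics.

(** * The expansion of [p(n)] *)

Section partition_asymptotics.
Context {R : realType}.
Implicit Types (f g h : nat -> R -> R) (K M n s : nat) (t : R).

Definition expansion (A B C : R) (a : nat -> R) := exists f : nat -> R,
  [/\ asy Pw (fun n _ => f n), bigw 1 (fun n _ => f n - C) &
    exists N, forall n, (N <= n)%N ->
      a n = expR (A * Num.sqrt n%:R) * n%:R `^ (- B) * f n].

Lemma gw8 n : (0 < n)%N -> gw n ^+ 8 = (Num.sqrt n%:R)^-1 :> R.
Proof.
move=> n0; rewrite -sqrtrV ?ler0n// -gw_pow16 (exprM _ 8 2) sqrtr_sqr ger0_norm//.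
by rewrite exprn_ge0// gw_ge0.
Qed.

Lemma sqrt_two_thirds : Num.sqrt (2 / 3) = 2 / Num.sqrt 6 :> R.
Proof.
have s0 : 0 < Num.sqrt 6 :> R by rewrite sqrtr_gt0.
have -> : 2 / 3 = (2 / Num.sqrt 6) ^+ 2 :> R by rewrite expr_div_n sqr_sqrtr//; field.
by rewrite sqrtr_sqr ger0_norm// divr_ge0// ltW.
Qed.

(** The factor [zz^3 / (2 pi)] of the Fourier formula and [zz / sqrt(2 pi)] of [PP] multiply to a
    multiple of [zz^4 = pi^2 / (6 n)]; the last root is the Gaussian integral. *)
Lemma saddle_constant : pi ^+ 2 / 6 / (2 * pi * Num.sqrt (2 * pi)) *
  Num.sqrt (2 * pi / (pi ^+ 2 / 3)) = 1 / (4 * Num.sqrt 3) :> R.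
Proof.
have p0 := @pi_gt0 R; have s3 : 0 < Num.sqrt 3 :> R by rewrite sqrtr_gt0.
have -> : 2 * pi / (pi ^+ 2 / 3) = 2 * pi * (Num.sqrt 3 / pi) ^+ 2 :> R.
  rewrite expr_div_n sqr_sqrtr//; move: (pi : R) p0 => p p0; field.
  by rewrite gt_eqF.
rewrite [Num.sqrt (_ * _ ^+ 2)]sqrtrM ?mulr_ge0 ?ltW// sqrtr_sqr ger0_norm ?divr_ge0 ?ltW//.
have s2 : 0 < Num.sqrt (2 * pi) :> R by rewrite sqrtr_gt0 mulr_gt0.
have E : Num.sqrt 3 ^+ 2 = 3 :> R by rewrite sqr_sqrtr.
move: (pi : R) p0 (Num.sqrt (2 * pi)) s2 (Num.sqrt 3) s3 E => p p0 q q0 s s0 E.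
have -> : p ^+ 2 / 6 / (2 * p * q) * (q * (s / p)) = s ^+ 2 / 12 / s.
  by field; rewrite !gt_eqF.
by rewrite E; field; rewrite gt_eqF.
Qed.

Lemma expansion_partitions : expansion (pi * Num.sqrt (2 / 3)) 1 (1 / (4 * Num.sqrt 3)) pp.
Proof.
(* [u] collects what remains of the logarithm beyond the main exponent and the square root: the term
   [- y/24] and the flat error. *)
pose r (y : R) := FF 0 y - EF 0 y.
pose u n t : R := - 24^-1 * zz n ^+ 2 + r (zz n ^+ 2).
have fr K : bigw K (fun n _ => r (zz n ^+ 2)) := bigw_flat0 K (FF_asymp 0).
have au : asy Pw u.
  apply: (asyD alg_Pw); last exact: (asy_flat alg_Pw).
  exact/(asyZ alg_Pw)/(asyX alg_Pw)/asy_zz_Pw.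
have bu : bigw 1 u.
  have h := bigw_le (isT : (1 <= 8)%N) (bigwX 2 (@bigw_zz R)).
  exact: (bigwD (bigwZ (- 24^-1) h) (fr 1%N)).
have [_ be] := tame_taylor taylor_expR (conj (asy_Pw_Pwt au) bu).
have ae := asy_taylor alg_Pw taylor_expR au bu.
have [aI bI] := @asy_arc_integral R.
pose c : R := pi ^+ 2 / 6 / (2 * pi * Num.sqrt (2 * pi)).
exists (fun n => c * (expR (u n 0) * arc_integral n)); split.
- exact: (asyZ alg_Pw _ (asyM alg_Pw ae aI)).
- rewrite -saddle_constant -/c; set S := Num.sqrt _ in bI *.
  have := bigwZ c (bigwD (bigw_le (isT : (1 <= 2)%N) (bigwM be bI)) (bigwD (bigwZ S be) bI)).
  apply: bigw_ext; exists 0%N => n t _ _; rewrite expR0.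
  have -> : u n t = u n 0 by [].
  by ring.
- exists 1%N => n n0; have z0 := @zz_gt0 R n n0; have p0 := @pi_gt0 R.
  have y0 : 0 < zz n ^+ 2 :> R by rewrite exprn_gt0.
  have nE := @zz_n R n n0.
  (* At the saddle point [pi^2 / (6 y)] and [n y] are equal, whence the factor 2. *)
  have Ae : pi * Num.sqrt (2 / 3) * Num.sqrt n%:R = 2 * (pi ^+ 2 / 6) / zz n ^+ 2 :> R.
    rewrite sqrt_two_thirds /zz [(zq * _) ^+ 2]exprMn zq2 -exprM gw8// invfM invrK.
    have s6 : Num.sqrt 6 ^+ 2 = 6 :> R by rewrite sqr_sqrtr.
    have s0 : 0 < Num.sqrt 6 :> R by rewrite sqrtr_gt0.
    move: (Num.sqrt (6 : R)) (pi : R) (Num.sqrt (n%:R : R)) s0 p0 s6 => s p v s0 p0 s6.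
    have -> : 2 * (p ^+ 2 / 6) * ((p / s)^-1 * v) = 2 * p * s * v / 6 by field; rewrite !gt_eqF.
    by rewrite -s6; field; rewrite gt_eqF.
  have e1 : PP (zz n ^+ 2) / ee (zz n ^+ 2) n =
      expR (pi * Num.sqrt (2 / 3) * Num.sqrt n%:R) *
      (zz n / Num.sqrt (2 * pi)) * expR (u n 0) :> R.
    rewrite PP_exp// /ee -expRN opprK -expRD Ae.
    have -> : zz n / Num.sqrt (2 * pi) = expR (1 / 2 * ln (zz n ^+ 2 / (2 * pi))) :> R.
      have p2 : 0 < 2 * pi :> R by rewrite mulr_gt0.
      have yp : 0 < zz n ^+ 2 / (2 * pi) :> R by rewrite divr_gt0.
      rewrite -half_ln_sqrt// lnK ?posrE ?sqrtr_gt0//.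
      by rewrite [Num.sqrt (_ / _)]sqrtrM ?(ltW y0)// sqrtr_sqr (gtr0_norm z0) sqrtrV// ltW.
    rewrite -!expRD; congr expR; rewrite {1}nE /u /r /= /EE.
    set l := ln _; set F := FF _ _; clearbody l F; move: (pi : R) (zz n) z0 => p z z0; field.
    by rewrite gt_eqF.
  rewrite -[X in _ `^ X]/(- (1 : R)) powR_inv1 ?ler0n// pp_arc_integral// e1.
  move: (expR (_ * Num.sqrt n%:R)) => e; rewrite nE /c; have s0 : 0 < Num.sqrt (2 * pi) :> R by rewrite sqrtr_gt0 mulr_gt0.
  move: (pi : R) p0 (Num.sqrt (2 * pi)) s0 (expR (u n 0)) (arc_integral n) => p p0 s s0 a b.
  move: (zz n) z0 => z z0; field.
  by rewrite !gt_eqF.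
Qed.

End partition_asymptotics.

(** * The log-concavity operator on expansions *)

Section shifts.
Context {R : realType}.
Implicit Types (f g : nat -> R) (K M n k : nat) (x t : R) (phi : R -> R).

Lemma taylor_quadratic phi : taylor phi -> exists c C d : R,
  [/\ 0 <= C, 0 < d & forall x, `|x| <= d -> `|phi x - phi 0 - c * x| <= C * `|x| ^+ 2].
Proof.
move=> /(_ 2)[Q [C [d [C0 d0 H]]]].
have [B B0 HB] := poly_locally_bounded (Q %/ 'X %/ 'X) d.
have QE (V : {poly R}) x : V.[x] = V.[0] + x * (V %/ 'X).[x].
  rewrite {1 2}(divp_eq V 'X) -['X]subr0 -(polyC0 R) modp_XsubC polyC0 subr0.
  by rewrite !hornerE; ring.
have H0 : phi 0 = Q.[0].
  by apply/eqP; rewrite -subr_eq0 -normr_le0; have := H 0; rewrite normr0 expr0n mulr0; apply; exact: ltW.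
exists (Q %/ 'X).[0], (C + B), d; split=> [|//|x xd]; first exact: addr_ge0.
have -> : phi x - phi 0 - (Q %/ 'X).[0] * x =
    (phi x - Q.[x]) + x ^+ 2 * (Q %/ 'X %/ 'X).[x].
  by rewrite H0 (QE Q x) (QE (Q %/ 'X) x); ring.
apply: le_trans (ler_normD _ _) _; rewrite mulrDl; apply: lerD; first exact: H.
by rewrite normrM normrX mulrC ler_wpM2r ?exprn_ge0// HB.
Qed.

Lemma gw16_small (d : R) : 0 < d -> exists N, forall n, (N <= n)%N ->
  [/\ (1 < n)%N, 0 < gw n ^+ 16 :> R & gw n ^+ 16 <= d].
Proof.
move=> d0; have [N HN] := gw_small d0; exists N.+2 => n Nn.
have n1 : (1 < n)%N by exact: leq_trans Nn.
have n0 : (0 < n)%N by exact: ltnW.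
have w0 := @gw_gt0 R n n0; split=> //; first by rewrite exprn_gt0.
apply: le_trans (HN n (ltnW (ltnW Nn))).
by rewrite exprS ler_piMr ?(ltW w0)// exprn_ile1 ?(ltW w0)// gw_le1.
Qed.

Lemma bigw_taylor_gw16 phi (s : R) : taylor phi ->
  bigw 16 (fun n _ => phi (s * gw n ^+ 16) - phi 0).
Proof. by move=> Tphi; have := bigw_taylor Tphi (bigwZ s (@bigw_gw R 16)). Qed.

Lemma bigw_taylor_second_diff phi : taylor phi ->
  bigw 32 (fun n _ => phi (gw n ^+ 16) + phi (- gw n ^+ 16) - 2 * phi 0).
Proof.
move=> /taylor_quadratic[c [C [d [C0 d0 H]]]]; have [N HN] := gw16_small d0.
exists (2 * C), N; split=> [|n t Nn _]; first exact: mulr_ge0.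
have [_ x0 xd] := HN n Nn; rewrite (exprM _ 16 2).
set x := gw n ^+ 16 in x0 xd *.
have h1 := H x; rewrite (gtr0_norm x0) in h1.
have h2 := H (- x); rewrite normrN (gtr0_norm x0) in h2.
have -> : phi x + phi (- x) - 2 * phi 0 =
  (phi x - phi 0 - c * x) + (phi (- x) - phi 0 - c * - x) by ring.
apply: le_trans (ler_normD _ _) _.
have := h1 xd; have := h2 xd; lra.
Qed.

Lemma pow1_powR (a x : R) : -1 < x -> pow1 a x = (1 + x) `^ a.
Proof. by move=> x1; rewrite /pow1 /powR gt_eqF//; lra. Qed.

Lemma pow1X (a x : R) k : pow1 a x ^+ k = pow1 (k%:R * a) x.
Proof. by rewrite /pow1 -expRM_natl mulrA. Qed.

Lemma pow1_0 (a : R) : pow1 a 0 = 1.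
Proof. by rewrite /pow1 addr0 ln1 mulr0 expR0. Qed.

Lemma natr_succ n : (0 < n)%N -> n.+1%:R = n%:R * (1 + gw n ^+ 16) :> R.
Proof.
move=> n0; have nR : n%:R != 0 :> R by rewrite pnatr_eq0 -lt0n.
by rewrite gw_pow16 mulrDr mulr1 divff// natr1.
Qed.

Lemma natr_pred n : (0 < n)%N -> n.-1%:R = n%:R * (1 - gw n ^+ 16) :> R.
Proof.
move=> n0; have nR : n%:R != 0 :> R by rewrite pnatr_eq0 -lt0n.
by rewrite gw_pow16 mulrBr mulr1 divff// -subn1 natrB.
Qed.

Lemma gw16_lt1 n : (1 < n)%N -> gw n ^+ 16 < 1 :> R.
Proof. by move=> n1; rewrite gw_pow16 invf_lt1 ?ltr0n ?ltr1n// ltnW. Qed.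

Lemma gw_succ n : (0 < n)%N -> gw n.+1 = gw n * pow1 (- (1 / 16)) (gw n ^+ 16) :> R.
Proof.
move=> n0; have w0 := @gw_ge0 R n.
have x0 : 0 <= gw n ^+ 16 :> R by rewrite exprn_ge0.
by rewrite {1}/gw natr_succ// powRM ?ler0n ?addr_ge0// -pow1_powR// (lt_le_trans _ x0).
Qed.

Lemma gw_pred n : (1 < n)%N -> gw n.-1 = gw n * pow1 (- (1 / 16)) (- gw n ^+ 16) :> R.
Proof.
move=> n1; have x1 := gw16_lt1 n1.
rewrite {1}/gw natr_pred ?(ltnW n1)// powRM ?ler0n ?subr_ge0 ?(ltW x1)//.
by rewrite -pow1_powR// ltrN2.
Qed.

Lemma bigw_succ K f : bigw K (fun n _ => f n) -> bigw K (fun n _ => f n.+1).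
Proof.
move=> [C [N [C0 H]]]; exists C, N.+1; split=> // n t Nn _.
have n0 : (0 < n)%N by exact: leq_trans Nn.
have := H n.+1 0 (leqW (ltnW Nn)); rewrite normr0 invr_ge0 gw_ge0 => /(_ isT) h.
apply: le_trans h _; rewrite ler_wpM2l// lerXn2r ?nnegrE ?gw_ge0//.
rewrite -(@ler_pXn2r _ 16) ?nnegrE ?gw_ge0// !gw_pow16.
by rewrite lef_pV2 ?posrE ?ltr0n// ler_nat.
Qed.

Lemma bigw_pred K f : bigw K (fun n _ => f n) -> bigw K (fun n _ => f n.-1).
Proof.
move=> [C [N [C0 H]]]; exists (C * 2 ^+ K), N.+2; split=> [|n t Nn _].
  by rewrite mulr_ge0// exprn_ge0.
have n1 : (1 < n)%N by exact: leq_trans Nn.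
have n0 : (0 < n.-1)%N by rewrite -ltnS prednK// ltnW.
have Nn' : (N <= n.-1)%N by rewrite -ltnS prednK ?(ltnW n1)// ltnW.
have := H n.-1 0 Nn'; rewrite normr0 invr_ge0 gw_ge0 => /(_ isT) h.
apply: le_trans h _; rewrite -mulrA -exprMn ler_wpM2l//.
apply: lerXn2r; rewrite ?nnegrE ?mulr_ge0 ?gw_ge0//.
rewrite -(@ler_pXn2r _ 16) ?nnegrE ?mulr_ge0 ?gw_ge0// [(2 * _) ^+ 16]exprMn !gw_pow16.
have n2 : (n <= 2 * n.-1)%N.
  by rewrite mul2n -addnn -{1}(prednK (ltnW n1)) -addn1 leq_add2l.
have e : n.-1%:R^-1 <= 2 / n%:R :> R.
  rewrite -div1r ler_pdivrMr ?ltr0n// mulrAC ler_pdivlMr ?ltr0n ?(ltnW n1)//.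
  by rewrite mul1r -natrM ler_nat.
apply: le_trans e _; rewrite ler_wpM2r ?invr_ge0//.
by rewrite -natrX ler_nat.
Qed.

(** A shift of [n] multiplies [w] by [(1 + w^16)^(-1/16)] or [(1 - w^16)^(-1/16)], which expands in
    [w]. *)
Lemma asy_shift f : asy Pw (fun n _ => f n) ->
  asy Pw (fun n _ => f n.+1) /\ asy Pw (fun n _ => f n.-1).
Proof.
move=> af.
have ax s : asy Pw (fun n _ => s * gw n ^+ 16 : R).
  exact/(asyZ alg_Pw)/(asyX alg_Pw)/(asy_gw alg_Pw).
have bx s : bigw 1 (fun n _ => s * gw n ^+ 16 : R).
  exact/bigwZ/(bigw_le (isT : (1 <= 16)%N))/bigw_gw.
have aw s : asy Pw (fun n _ => gw n * pow1 (- (1 / 16)) (s * gw n ^+ 16) : R).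
  apply: (asyM alg_Pw); first exact: (asy_gw alg_Pw).
  exact: (asy_taylor alg_Pw (taylor_pow1 _) (ax s) (bx s)).
split; apply: asy_approx => K; have [_ [Q ->] H] := af K.
  exists (fun n _ => Q.[gw n.+1]).
    have := asy_horner alg_Pw Q (aw 1); apply: asy_ext.
    by exists 1%N => n t n0 _; rewrite [1 * gw n ^+ 16]mul1r gw_succ.
  exact: bigw_succ H.
exists (fun n _ => Q.[gw n.-1]).
  have := asy_horner alg_Pw Q (aw (-1)); apply: asy_ext.
  by exists 2%N => n t n0 _; rewrite mulN1r gw_pred.
exact: bigw_pred H.
Qed.

Lemma bigw_sum (I : Type) (r : seq I) K (F : I -> nat -> R -> R) :
  (forall i, bigw K (F i)) -> bigw K (fun n t => \sum_(i <- r) F i n t).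
Proof.
move=> H; elim: r => [|i r IH].
  exists 0, 0%N; split=> // n t _ _.
  by rewrite big_nil normr0 mul0r.
by apply: bigw_ext (bigwD (H i) IH); exists 0%N => n t _ _; rewrite big_cons.
Qed.

(** Approximating [f] to order 32 suffices, the error being already as small as the second
    difference. On a monomial [w^i] the shifts multiply by values of one Taylor-expandable function
    at [w^16] and [- w^16], whose linear terms cancel in the second difference. *)
Lemma bigw_shift f : asy Pw (fun n _ => f n) ->
  [/\ bigw 16 (fun n _ => f n.+1 - f n), bigw 16 (fun n _ => f n.-1 - f n) &
      bigw 32 (fun n _ => f n.+1 + f n.-1 - 2 * f n)].
Proof.
move=> af; have [_ [Q ->] H] := af 32%N.
have H1 := bigw_succ H; have H2 := bigw_pred H.
have l : (16 <= 32)%N by [].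
pose phi i := pow1 (i%:R * (- (1 / 16)) : R).
have wS i n : (0 < n)%N -> gw n.+1 ^+ i = gw n ^+ i * phi i (gw n ^+ 16).
  by move=> n0; rewrite gw_succ// exprMn pow1X.
have wP i n : (1 < n)%N -> gw n.-1 ^+ i = gw n ^+ i * phi i (- gw n ^+ 16).
  by move=> n0; rewrite gw_pred// exprMn pow1X.
have bw i : bigw 0 (fun n _ => gw n ^+ i : R).
  exact: bigw_le (leq0n i) (bigw_gw i).
have Q1 : bigw 16 (fun n _ => Q.[gw n.+1] - Q.[gw n]).
  have B (i : 'I_(size Q)) : bigw 16 (fun n _ => Q`_i * (gw n ^+ i * (phi i (1 * gw n ^+ 16) - phi i 0))).
    by apply: bigwZ; have := bigwM (bw i) (bigw_taylor_gw16 1 (taylor_pow1 (i%:R * - (1 / 16)))).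
  apply: bigw_ext (bigw_sum (index_enum _) B); exists 1%N => n t n0 _.
  rewrite !horner_coef -sumrB; apply: eq_bigr => i _.
  by rewrite wS// [1 * gw n ^+ 16]mul1r [phi i 0]pow1_0; ring.
have Q2 : bigw 16 (fun n _ => Q.[gw n.-1] - Q.[gw n]).
  have B (i : 'I_(size Q)) : bigw 16 (fun n _ => Q`_i * (gw n ^+ i * (phi i (-1 * gw n ^+ 16) - phi i 0))).
    by apply: bigwZ; have := bigwM (bw i) (bigw_taylor_gw16 (-1) (taylor_pow1 (i%:R * - (1 / 16)))).
  apply: bigw_ext (bigw_sum (index_enum _) B); exists 2%N => n t n0 _.
  rewrite !horner_coef -sumrB; apply: eq_bigr => i _.
  by rewrite wP// mulN1r [phi i 0]pow1_0; ring.
have Q3 : bigw 32 (fun n _ => Q.[gw n.+1] + Q.[gw n.-1] - 2 * Q.[gw n]).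
  have B (i : 'I_(size Q)) : bigw 32 (fun n _ => Q`_i * (gw n ^+ i *
      (phi i (gw n ^+ 16) + phi i (- gw n ^+ 16) - 2 * phi i 0))).
    by apply: bigwZ; exact: (bigwM (bw i) (bigw_taylor_second_diff (taylor_pow1 (i%:R * - (1 / 16))))).
  apply: bigw_ext (bigw_sum (index_enum _) B); exists 2%N => n t n1 _.
  rewrite !horner_coef mulr_sumr -big_split -sumrB; apply: eq_bigr => i _ /=.
  by rewrite wP// wS ?(ltnW n1)// [phi i 0]pow1_0; ring.
split.
- have := bigwD Q1 (bigw_le l (bigwD H1 (bigwZ (-1) H))).
  by apply: bigw_ext; exists 0%N => n t _ _; ring.
- have := bigwD Q2 (bigw_le l (bigwD H2 (bigwZ (-1) H))).
  by apply: bigw_ext; exists 0%N => n t _ _; ring.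
have := bigwD Q3 (bigwD (bigwD H1 H2) (bigwZ (-2) H)).
by apply: bigw_ext; exists 0%N => n t _ _; ring.
Qed.

End shifts.

Section log_concavity_operator.
Context {R : realType}.
Implicit Types (a f g : nat -> R) (K M n k : nat) (x t A B C : R).

Lemma bigw_expR_linear K (u : nat -> R -> R) : bigw K.+1 u ->
  bigw (K.+1 + K.+1) (fun n t => expR (u n t) - 1 - u n t).
Proof.
move=> [C [N [C0 H]]].
have dC : 0 < (C + 1)^-1 by rewrite invr_gt0 ltr_wpDl.
have [N' HN'] := gw_small dC.
exists (expR 1 * (C * C)), (N + N').+1; split=> [|n t Nn tn].
  by rewrite mulr_ge0 ?expR_ge0// mulr_ge0.
have h := H n t (leq_trans (leq_addr _ _) (ltnW Nn)) tn.
have := HN' n (leq_trans (leq_addl _ _) (ltnW Nn)).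
rewrite -div1r ler_pdivlMr ?ltr_wpDl// => wd.
have w0 := @gw_ge0 R n.
have wK : gw n ^+ K.+1 <= gw n :> R.
  by rewrite exprS ler_piMr// exprn_ile1// gw_le1// (leq_trans _ Nn).
have u1 : `|u n t| <= 1 by apply: le_trans h _; nra.
have := expR_taylor 2 u1; rewrite !big_ord_recl big_ord0 /= !factE/= expr0 expr1 !divr1 addr0 opprD addrA.
move=> H2; apply: le_trans H2 _; rewrite -mulrA ler_wpM2l ?expR_ge0//.
by rewrite expr2 exprD mulrACA ler_pM.
Qed.

(** The second difference of the square root at [n], divided by [sqrt n]. *)
Definition sqrt_diff n : R :=
  pow1 (1 / 2) (1 * gw n ^+ 16) + pow1 (1 / 2) (-1 * gw n ^+ 16) - 2.

Let ax s M : asy Pw (fun n _ => s * gw n ^+ M : R).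
Proof. exact/(asyZ alg_Pw)/(asyX alg_Pw)/(asy_gw alg_Pw). Qed.

Let bx s M : bigw M (fun n _ => s * gw n ^+ M : R).
Proof. exact/bigwZ/bigw_gw. Qed.

Lemma asy_sqrt_diff : asy Pw (fun n _ => sqrt_diff n).
Proof.
have H s := asy_taylor alg_Pw (taylor_pow1 (1 / 2)) (ax s 16) (bigw_le (isT : (1 <= 16)%N) (bx s 16)).
exact: (asyB alg_Pw (asyD alg_Pw (H 1) (H (-1))) (asy_cst alg_Pw 2)).
Qed.

Lemma bigw_sqrt_diff : bigw 32 (fun n _ => sqrt_diff n).
Proof.
have := bigw_taylor_second_diff (taylor_pow1 (1 / 2 : R)); apply: bigw_ext.
exists 0%N => n t _ _.
by rewrite pow1_0 /sqrt_diff [1 * gw n ^+ 16]mul1r [-1 * gw n ^+ 16]mulN1r mulr1.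
Qed.

Lemma sqrt_diff_leading : bigw 1 (fun n _ => sqrt_diff n / gw n ^+ 32 + 1 / 4).
Proof.
have b1 := bigw_le (isT : (1 <= 32)%N) (bigw_taylor (taylor_pow1 (1 / 2)) (bx (-1) 32)).
have [C [N [C0 H]]] := bigw_le (isT : (1 <= 32)%N) bigw_sqrt_diff.
have [C' [N' [C'0 H']]] := b1.
exists (C + C'), (N + N').+2; split=> [|n t Nn tn]; first exact: addr_ge0.
have n1 : (1 < n)%N by exact: leq_trans Nn.
have h := H n t (leq_trans (leq_addr _ _) (ltnW (ltnW Nn))) tn.
have := H' n t (leq_trans (leq_addl _ _) (ltnW (ltnW Nn))) tn; rewrite pow1_0.
have x1 := @gw16_lt1 R n n1.
have x0 : 0 < gw n ^+ 16 :> R by rewrite exprn_gt0// gw_gt0// ltnW.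
move: h; rewrite expr1 /sqrt_diff (exprM (gw n : R) 16 2).
move: (gw n ^+ 16) x1 x0 => x x1 x0; move: (gw n) => w.
have x2 : x ^+ 2 < 1 by rewrite exprn_ilt1// ltW.
rewrite [1 * x]mul1r !mulN1r !pow1_powR; [|lra..].
rewrite !div1r !powR12_sqrt; [|lra..].
have e1 : Num.sqrt (1 - x ^+ 2) = Num.sqrt (1 + x) * Num.sqrt (1 - x).
  by rewrite -sqrtrM; [congr Num.sqrt; ring|lra].
rewrite e1; have p2 : Num.sqrt (1 + x) ^+ 2 = 1 + x by rewrite sqr_sqrtr//; lra.
have q2 : Num.sqrt (1 - x) ^+ 2 = 1 - x by rewrite sqr_sqrtr//; lra.
have := sqrtr_ge0 (1 + x); have := sqrtr_ge0 (1 - x).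
move: (Num.sqrt (1 + x)) (Num.sqrt (1 - x)) p2 q2 => p q p2 q2 q0 p0.
(* From [p^2 = 1 + x] and [q^2 = 1 - x]: [h (4 + h) = 2 s] and [s (2 + s) = - x^2]. So [h / x^2] is
   exactly [-2 / ((4 + h)(2 + s))], close to [-1/4] because [h] and [s] are [O(w)]. *)
set h := p + q - 2; set s := p * q - 1 => hb sb.
have h2 : -2 <= h by rewrite /h; lra.
have s1 : -1 <= s by rewrite /s; nra.
have E : h * ((4 + h) * (2 + s)) = - 2 * x ^+ 2.
  have e2 : h * (4 + h) = 2 * s by rewrite /h /s; ring: p2 q2.
  rewrite mulrA e2; have : (p * q) ^+ 2 = 1 - x ^+ 2 by rewrite exprMn p2 q2; ring.
  by rewrite /s; move: (p * q) => u; lra.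
have s0 : s <= 0.
  by have := sqr_ge0 (p - q); rewrite sqrrB p2 q2 /s -mulr_natr; move: (p * q) => u; lra.
have d0 : 2 <= (4 + h) * (2 + s).
  by rewrite -[leLHS]mulr1 ler_pM//; lra.
clearbody h s; have -> : h / x ^+ 2 + 4^-1 = (4 * s + h * (2 + s)) / (4 * ((4 + h) * (2 + s))).
  have -> : h / x ^+ 2 = - 2 / ((4 + h) * (2 + s)).
    apply: (canRL (mulfK _)); first by rewrite gt_eqF//; lra.
    by rewrite mulrAC E mulfK// expf_neq0// gt_eqF.
  by field; rewrite !gt_eqF//; lra.
rewrite normrM normfV [`|4 * _|]gtr0_norm; last by lra.
rewrite ler_pdivrMr; last by lra.
have t1 : `|4 * s + h * (2 + s)| <= 4 * `|s| + `|h| * 2.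
  apply: le_trans (ler_normD _ _) _; rewrite !normrM (ger0_norm (ler0n R 4)) lerD2l.
  by rewrite ler_wpM2l// ger0_norm; lra.
apply: le_trans t1 _; move: (`|s|) (`|h|) (normr_ge0 s) (normr_ge0 h) sb hb.
move: (_ * (2 + s)) d0 => d d0 s' h' s'0 h'0 sb hb; nra.
Qed.

End log_concavity_operator.

Section log_concavity_step.
Context {R : realType}.
Implicit Types (a f g : nat -> R) (K M n k : nat) (x t A B C : R).

(** [a(n)^2 - a(n+1) a(n-1)] without the common factor [exp(2 A sqrt n) n^(-2B)]; [pow1] carries
    [(1 - n^(-2))^(-B)], which comes from [(n+1)(n-1)]. *)
Definition log_defect A B f n : R :=
  f n ^+ 2 - expR (A * (sqrt_diff n / gw n ^+ 8)) * pow1 (- B) (-1 * gw n ^+ 32) * (f n.+1 * f n.-1).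

Lemma logconcave_op_defect A B f a N n :
  (forall n, (N <= n)%N -> a n = expR (A * Num.sqrt n%:R) * n%:R `^ (- B) * f n) ->
  (N.+2 <= n)%N ->
  logconcave_op a n = expR (2 * A * Num.sqrt n%:R) * (n%:R `^ (- B)) ^+ 2 * log_defect A B f n.
Proof.
move=> aE Nn; have n1 : (1 < n)%N by exact: leq_trans Nn.
have n0 : (0 < n)%N by exact: ltnW.
have -> : logconcave_op a n = a n ^+ 2 - a n.+1 * a n.-1 by case: n n0 {Nn n1}.
have x1 := @gw16_lt1 R n n1.
have x0 : 0 < gw n ^+ 16 :> R by rewrite exprn_gt0// gw_gt0.
have w8 : Num.sqrt n%:R = (gw n ^+ 8)^-1 :> R by rewrite gw8// invrK.
have Np : (N <= n.-1)%N by rewrite -ltnS prednK// ltnW.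
have N1 : (N <= n)%N := leq_trans Np (leq_pred n).
rewrite (aE n N1) (aE _ Np) (aE _ (leqW N1)).
have sS : Num.sqrt n.+1%:R + Num.sqrt n.-1%:R = 2 * Num.sqrt n%:R + sqrt_diff n / gw n ^+ 8 :> R.
  rewrite natr_succ// natr_pred// !sqrtrM ?ler0n// /sqrt_diff.
  rewrite [1 * gw n ^+ 16]mul1r [-1 * gw n ^+ 16]mulN1r !pow1_powR; [|lra..].
  rewrite div1r !powR12_sqrt; [|lra..].
  by rewrite w8; ring.
have pS : n.+1%:R `^ (- B) * n.-1%:R `^ (- B) = (n%:R `^ (- B)) ^+ 2 * pow1 (- B) (-1 * gw n ^+ 32) :> R.
  rewrite natr_succ// natr_pred// !powRM ?ler0n//; [|lra..].
  have x21 : gw n ^+ 32 < 1 :> R by rewrite (exprM _ 16 2) exprn_ilt1// ltW.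
  rewrite pow1_powR; last by lra.
  rewrite mulrACA -expr2 -powRM; [|lra..].
  by congr (_ * (_ `^ _)); rewrite (exprM _ 16 2); ring.
have eS : expR (A * Num.sqrt n.+1%:R) * expR (A * Num.sqrt n.-1%:R) =
    expR (A * Num.sqrt n%:R) ^+ 2 * expR (A * (sqrt_diff n / gw n ^+ 8)).
  by rewrite expr2 -!expRD; congr expR; rewrite -mulrDr sS; ring.
have e2 : expR (2 * A * Num.sqrt n%:R) = expR (A * Num.sqrt n%:R) ^+ 2.
  by rewrite expr2 -expRD; congr expR; ring.
rewrite e2 /log_defect.
have -> : expR (A * Num.sqrt n.+1%:R) * n.+1%:R `^ (- B) * f n.+1 *
    (expR (A * Num.sqrt n.-1%:R) * n.-1%:R `^ (- B) * f n.-1) =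
    (expR (A * Num.sqrt n.+1%:R) * expR (A * Num.sqrt n.-1%:R)) *
    (n.+1%:R `^ (- B) * n.-1%:R `^ (- B)) * (f n.+1 * f n.-1) by ring.
by rewrite eS pS; ring.
Qed.

(** The order 24 is 32 - 8: [sqrt_diff] is of order [w^32] and is multiplied by
    [sqrt n = w^(-8)]. *)
Lemma asy_log_defect A B C f : asy Pw (fun n _ => f n) -> bigw 1 (fun n _ => f n - C) ->
  asy Pw (fun n _ => log_defect A B f n) /\
  bigw 1 (fun n _ => log_defect A B f n / gw n ^+ 24 - C ^+ 2 * A / 4).
Proof.
move=> af bf; have [afs afp] := asy_shift af; have [b1 b2 b3] := bigw_shift af.
have aD := asy_Pw_div (asy_sqrt_diff (R := R)) (bigw_le (isT : (8 <= 32)%N) bigw_sqrt_diff).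
have bD : bigw 24 (fun n _ => sqrt_diff n / gw n ^+ 8 : R) := @bigw_div R 8 24 _ bigw_sqrt_diff.
have au := asyZ alg_Pw A aD; have bu := bigwZ A bD.
have av : asy Pw (fun n _ => -1 * gw n ^+ 32 : R).
  exact/(asyZ alg_Pw)/(asyX alg_Pw)/(asy_gw alg_Pw).
have bv : bigw 32 (fun n _ => -1 * gw n ^+ 32 : R) by exact/bigwZ/bigw_gw.
have aE := asy_taylor alg_Pw taylor_expR au (bigw_le (isT : (1 <= 24)%N) bu).
have aP := asy_taylor alg_Pw (taylor_pow1 (- B)) av (bigw_le (isT : (1 <= 32)%N) bv).
have afsp := asyM alg_Pw afs afp.
split; first exact: (asyB alg_Pw (asyX alg_Pw 2 af) (asyM alg_Pw (asyM alg_Pw aE aP) afsp)).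
have bP := bigw_taylor (taylor_pow1 (- B)) bv.
have bE := bigw_expR_linear bu.
have f0 : bigw 0 (fun n _ => f n).
  have := bigwD (bigw_le (isT : (0 <= 1)%N) bf) (bigw_cst C).
  by apply: bigw_ext; exists 0%N => n t _ _; rewrite subrK.
have bff : bigw 32 (fun n _ => f n.+1 * f n.-1 - f n ^+ 2).
  have := bigwD (bigwM f0 b3) (bigwM b1 b2).
  by apply: bigw_ext; exists 0%N => n t _ _; ring.
have bfC : bigw 1 (fun n _ => f n.+1 * f n.-1 - C ^+ 2).
  have := bigwD (bigw_le (isT : (1 <= 32)%N) bff)
    (bigwD (bigwM f0 bf) (bigwZ C bf)).
  by apply: bigw_ext; exists 0%N => n t _ _; ring.
have ff0 : bigw 0 (fun n _ => f n.+1 * f n.-1).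
  have := bigwD (bigw_le (isT : (0 <= 1)%N) bfC) (bigw_cst (C ^+ 2)).
  by apply: bigw_ext; exists 0%N => n t _ _; rewrite subrK.
have E0 : bigw 0 (fun n _ => expR (A * (sqrt_diff n / gw n ^+ 8))).
  have := bigwD (bigw_le (isT : (0 <= 24)%N) (bigw_taylor taylor_expR bu)) (bigw_cst (1 : R)).
  by apply: bigw_ext; exists 0%N => n t _ _; rewrite expR0 subrK.
(* The defect is [(f^2 - f+ f-) - f+ f- (e (P - 1) + (e - 1 - u) + u)], and only the last
   term [f+ f- u] is of order 24. *)
have bR : bigw 25 (fun n _ => log_defect A B f n + f n.+1 * f n.-1 * (A * (sqrt_diff n / gw n ^+ 8))).
  have h1 := bigw_le (isT : (25 <= 32)%N) (bigwZ (-1) bff).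
  have h2 := bigw_le (isT : (25 <= 32)%N) (bigwZ (-1) (bigwM ff0 (bigwM E0 bP))).
  have h3 := bigw_le (isT : (25 <= 48)%N) (bigwZ (-1) (bigwM ff0 bE)).
  apply: bigw_ext (bigwD h1 (bigwD h2 h3)); exists 0%N => n t _ _.
  by rewrite pow1_0 /log_defect; ring.
have h4 : bigw 1 (fun n _ => (log_defect A B f n + f n.+1 * f n.-1 * (A * (sqrt_diff n / gw n ^+ 8))) / gw n ^+ 24).
  exact: (@bigw_div R 24 1).
have sl := @sqrt_diff_leading R.
have h5 := bigwD h4 (bigwD (bigwZ (- A) (bigwM ff0 sl)) (bigwZ (A / 4) bfC)).
apply: bigw_ext h5; exists 1%N => n t n0 _.
have w0 := @gw_gt0 R n n0; rewrite [gw n ^+ 32](exprD _ 8 24).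
have p0 : gw n ^+ 8 != 0 :> R by rewrite expf_neq0// gt_eqF.
have q0 : gw n ^+ 24 != 0 :> R by rewrite expf_neq0// gt_eqF.
move: (log_defect A B f n) (f n.+1) (f n.-1) (sqrt_diff n) (gw n ^+ 8) (gw n ^+ 24) p0 q0 => F u v s p q p0 q0.
by field; rewrite p0 q0.
Qed.

Lemma expansion_logconcave_op A B C a : expansion A B C a ->
  expansion (2 * A) (2 * B + 3 / 2) (C ^+ 2 * A / 4) (logconcave_op a).
Proof.
move=> [f [af bf [N aE]]].
have [aF bF] := asy_log_defect A B af bf.
exists (fun n => log_defect A B f n / gw n ^+ 24); split=> //.
  apply: asy_Pw_div => //.
  have := bigwM (@bigw_gw R 24) (bigwD (bigw_le (isT : (0 <= 1)%N) bF) (bigw_cst (C ^+ 2 * A / 4))).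
  rewrite addn0; apply: bigw_ext; exists 1%N => n t n0 _; rewrite subrK mulrC divfK//.
  by rewrite expf_neq0// gt_eqF// gw_gt0.
exists N.+2 => n Nn; rewrite (logconcave_op_defect aE Nn).
have n0 : (0 < n)%N by exact: leq_trans Nn.
have nR : (n%:R : R) != 0 by rewrite pnatr_eq0 -lt0n.
(* [w^24 = n^(-3/2)]: the power divided out of the defect moves into the exponent [B]. *)
have -> : n%:R `^ (- (2 * B + 3 / 2)) = (n%:R `^ (- B)) ^+ 2 * gw n ^+ 24 :> R.
  rewrite /gw -!powR_mulrn ?powR_ge0// -!powRrM -powRD.
    by congr (_ `^ _); rewrite -[24%:R]/(24 : R); field.
  by rewrite nR implybT.
have w0 : gw n ^+ 24 != 0 :> R by rewrite expf_neq0// gt_eqF// gw_gt0.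
move: (expR _) (_ `^ _) (log_defect A B f n) (gw n ^+ 24) w0 => e p F q q0.
by field.
Qed.

End log_concavity_step.

(** * Iteration and the constant *)

Section iterated_operator.
Context {R : realType}.
Implicit Types (A B C : R) (a : nat -> R) (n r : nat).

(** Written with [5/2 * 2^r] so that it also makes sense at [r = 0], the start of the induction. *)
Definition iter_constant r : R :=
  pi ^+ (2 ^ r - 1) / (2 `^ (5 / 2 * 2 ^+ r + r%:R - 1 / 2) * 3 `^ (2 ^+ r - 1 / 2)).

Lemma iter_constant0 : iter_constant 0 = 1 / (4 * Num.sqrt 3).
Proof.
rewrite /iter_constant expn0 subnn !expr0 (_ : 5 / 2 * 1 + 0%:R - 1 / 2 = 2%:R :> R); last by field.
rewrite powR_mulrn// (_ : 1 - 1 / 2 = 2^-1 :> R); last by field.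
by rewrite powR12_sqrt// -natrX.
Qed.

(** The rule [C -> C^2 A / 4] with [A] proportional to [2^r]: this factor [2^r] is the source of the
    summand [r] in the exponent of 2. *)
Lemma iter_constantS r :
  iter_constant r.+1 = iter_constant r ^+ 2 * (2 ^+ r * (pi * Num.sqrt (2 / 3))) / 4.
Proof.
have en m : (0 < m)%N -> (2 * m - 1 = (m - 1) * 2 + 1)%N by lia.
rewrite /iter_constant sqrtrM// sqrtrV//.
set u : R := 2 `^ (5 / 2 * 2 ^+ r + r%:R - 1 / 2).
set v : R := 3 `^ (2 ^+ r - 1 / 2).
have n20 : (2 : R) != 0 by rewrite pnatr_eq0.
have n30 : (3 : R) != 0 by rewrite pnatr_eq0.
have u0 : 0 < u by rewrite powR_gt0.
have v0 : 0 < v by rewrite powR_gt0.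
have s2 : 0 < Num.sqrt 2 :> R by rewrite sqrtr_gt0.
have s3 : 0 < Num.sqrt 3 :> R by rewrite sqrtr_gt0.
have e2 : 2 `^ (5 / 2 * 2 ^+ r.+1 + r.+1%:R - 1 / 2) * 2 ^+ r = u ^+ 2 * Num.sqrt 2 * 2 :> R.
  rewrite -[2 ^+ r]powR_mulrn// -[u ^+ 2]powR_mulrn ?(ltW u0)// -powR12_sqrt// -powRrM.
  rewrite -[X in _ = _ * X]powRr1// -!powRD ?n20 ?implybT//.
  by congr (_ `^ _); rewrite exprS -[r.+1%:R]natr1 -[2%:R]/(2 : R); field.
have e3 : 3 `^ (2 ^+ r.+1 - 1 / 2) = v ^+ 2 * Num.sqrt 3 :> R.
  rewrite -[v ^+ 2]powR_mulrn ?(ltW v0)// -powR12_sqrt// -powRrM -powRD ?n30 ?implybT//.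
  by congr (_ `^ _); rewrite exprS -[2%:R]/(2 : R); field.
have ep : pi ^+ (2 ^ r.+1 - 1) = (pi ^+ (2 ^ r - 1)) ^+ 2 * pi :> R.
  by rewrite -exprM -exprSr expnS en ?expn_gt0// addn1.
have e2' : 2 `^ (5 / 2 * 2 ^+ r.+1 + r.+1%:R - 1 / 2) = u ^+ 2 * Num.sqrt 2 * 2 / 2 ^+ r :> R.
  by rewrite -e2 mulfK// expf_neq0.
rewrite ep e2' e3.
have p20 : (2 : R) ^+ r != 0 by rewrite expf_neq0.
have s22 : Num.sqrt 2 ^+ 2 = 2 :> R by rewrite sqr_sqrtr.
move: (pi : R) (pi ^+ _ : R) (2 ^+ r : R) (Num.sqrt (2 : R)) (Num.sqrt (3 : R)) u v u0 v0 s2 s3 p20 s22 {e2 e2' e3 ep}.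
move=> p P q s t u v u0 v0 s0 t0 q0 s2.
have -> : P ^+ 2 * p / (u ^+ 2 * s * 2 / q * (v ^+ 2 * t)) =
  P ^+ 2 * p * s * q / (u ^+ 2 * v ^+ 2 * t * (2 * s ^+ 2)) by field; rewrite q0 !gt_eqF.
by rewrite s2; field; rewrite !gt_eqF.
Qed.

(** Under [B -> 2B + 3/2] the quantity [B + 3/2] doubles, and it starts at [5/2]. *)
Lemma expansion_iter r :
  expansion (2 ^+ r * (pi * Num.sqrt (2 / 3))) (5 / 2 * 2 ^+ r - 3 / 2) (iter_constant r)
    (iter r (@logconcave_op R) pp).
Proof.
elim: r => [|r IH].
  rewrite iter_constant0 expr0 mul1r mulr1 (_ : 5 / 2 - 3 / 2 = 1); last by field.
  exact: expansion_partitions.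
have := expansion_logconcave_op IH; rewrite -iter_constantS.
rewrite mulrA -exprS (_ : 2 * (5 / 2 * 2 ^+ r - 3 / 2) + 3 / 2 = 5 / 2 * 2 ^+ r.+1 - 3 / 2)//.
by rewrite exprS; field.
Qed.

Lemma expansion_equiv A B C a : 0 < C -> expansion A B C a ->
  (a : nat -> R^o) ~_\oo (fun n => C * (expR (A * Num.sqrt n%:R) / n%:R `^ B) : R^o).
Proof.
move=> C0 [f [_ [D [N [D0 H]]] [N' aE]]]; apply/eqaddoP => e e0.
(* Below this threshold for [w], [|f - C| <= D w <= e C], a relative error of at most [e]. *)
have d0 : 0 < e * C / (D + 1) by rewrite divr_gt0 ?mulr_gt0// ltr_wpDl.
have [M HM] := gw_small d0.
exists (N + (N' + M)).+1 => // n /= Nn.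
have N1 : (N <= n)%N := leq_trans (leq_addr _ _) (ltnW Nn).
have N2 : (N' <= n)%N := leq_trans (leq_trans (leq_addr _ _) (leq_addl _ _)) (ltnW Nn).
have N3 : (M <= n)%N := leq_trans (leq_trans (leq_addl _ _) (leq_addl _ _)) (ltnW Nn).
have h := H n 0 N1; rewrite normr0 invr_ge0 gw_ge0 expr1 in h; have {}h := h isT.
have := HM n N3; rewrite ler_pdivlMr ?ltr_wpDl// => wd.
have w0 := @gw_ge0 R n.
rewrite !fctE (aE n N2) powRN; set g := expR _ / _.
have -> : expR (A * Num.sqrt n%:R) * (n%:R `^ B)^-1 * f n - C * g = g * (f n - C).
  by rewrite /g; ring.
have g0 : 0 <= g by rewrite divr_ge0 ?expR_ge0// powR_ge0.
have {}g0 : `|g * (f n - C) : R| <= e * `|C * g : R|; last exact: g0.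
clearbody g; rewrite !normrM (ger0_norm g0) (gtr0_norm C0) mulrA mulrC ler_wpM2r//.
by apply: le_trans h _; nra.
Qed.

End iterated_operator.

Theorem theorem1p14 (R : realType) (r : nat) (hr : (1 <= r)%N) :
  (fun n : nat =>
     iter_logconcave_op r (fun k : nat => (num_partitions k)%:R : R) n : R^o)
  ~_\oo
  (fun n : nat =>
     pi ^+ (2 ^ r - 1)
     / (2 `^ (5 * 2 ^+ r.-1 + r%:R - 1 / 2) * 3 `^ (2 ^+ r - 1 / 2))
     * (expR (2 ^+ r * pi * Num.sqrt (2 / 3 * n%:R))
        / n%:R `^ (2 ^+ r + 3 * 2 ^+ r.-1 - 3 / 2)) : R^o).
Proof.
(* For [r >= 1] the halves are absorbed into [2^(r-1)]. *)
have e1 : 5 / 2 * 2 ^+ r = 5 * 2 ^+ r.-1 :> R by rewrite -{1}(prednK hr) exprS; field.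
have e2 : 5 / 2 * 2 ^+ r - 3 / 2 = 2 ^+ r + 3 * 2 ^+ r.-1 - 3 / 2 :> R.
  by rewrite -{1 2}(prednK hr) exprS; field.
have C0 : 0 < iter_constant r :> R.
  by rewrite divr_gt0 ?mulr_gt0 ?powR_gt0// exprn_gt0// pi_gt0.
have := expansion_equiv C0 (@expansion_iter R r); rewrite /iter_constant e2 e1.
have -> : (fun n => pi ^+ (2 ^ r - 1) / (2 `^ (5 * 2 ^+ r.-1 + r%:R - 1 / 2) * 3 `^ (2 ^+ r - 1 / 2)) *
   (expR (2 ^+ r * (pi * Num.sqrt (2 / 3)) * Num.sqrt n%:R) / n%:R `^ (2 ^+ r + 3 * 2 ^+ r.-1 - 3 / 2)) : R^o) =
   (fun n => pi ^+ (2 ^ r - 1) / (2 `^ (5 * 2 ^+ r.-1 + r%:R - 1 / 2) * 3 `^ (2 ^+ r - 1 / 2)) *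
   (expR (2 ^+ r * pi * Num.sqrt (2 / 3 * n%:R)) / n%:R `^ (2 ^+ r + 3 * 2 ^+ r.-1 - 3 / 2)) : R^o).
  apply/funext => n; congr (_ * (expR _ / _)).
  by rewrite [in RHS]sqrtrM// !mulrA.
by [].
Qed.
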